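(* Let $d\ge1$, let $\Omega\subset\mathbb{R}^d$ be a non-empty bounded open set with Lebesgue measure $|\Omega|$, and let $\beta_1,\beta_2,\dots$ be the eigenvalues of $H_{0,\Omega}$. Then for all $k=1,2,\dots$, $$\overline{\beta_k}\ge\frac{\sqrt{4\pi}\,d}{d+1}\left(\frac{\Gamma(1+d/2)\,k}{|\Omega|}\right)^{1/d}.$$
   Context: Fourier transform: $\hat\varphi(\xi)=(2\pi)^{-d/2}\int_{\mathbb{R}^d}e^{-i\xi\cdot x}\varphi(x)\,dx$. The operator $\sqrt{-\Delta}$ on $C_c^\infty(\mathbb{R}^d)$ is the Fourier multiplier with symbol $|\xi|$. For a non-empty bounded open set $\Omega\subset\mathbb{R}^d$, $H_{0,\Omega}$ is the positive self-adjoint operator on $L^2(\Omega)$ that is the Friedrichs extension associated with the quadratic form $\varphi\mapsto\int_\Omega\overline{\varphi}\,\sqrt{-\Delta}\,\varphi$ on $C_c^\infty(\Omega)$, where $\sqrt{-\Delta}\,\varphi$ is computed on $\mathbb{R}^d$. (It is not the square root of the Dirichlet Laplacian in the sense of the functional calculus.) It has compact inverse, hence purely discrete spectrum of positive eigenvalues $0<\beta_1<\beta_2\le\beta_3\le\cdots$, listed with multiplicity. For an integer $k\ge1$, $\overline{\beta_k}:=\frac1k\sum_{\ell=1}^k\beta_\ell$. *)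

(* Defs.v *)
From HB Require Import structures.
From mathcomp Require Import all_boot all_order all_algebra.
From mathcomp Require Import all_classical all_reals all_analysis.
From mathcomp Require Import complex.

Set Implicit Arguments.
Unset Strict Implicit.
Unset Printing Implicit Defensive.

Import Order.TTheory GRing.Theory Num.Theory.
Import numFieldNormedType.Exports.

Local Open Scope classical_set_scope.
Local Open Scope ring_scope.

(* Row vectors carry the sigma-algebra generated by the coordinates, which is
   the Borel sigma-algebra of R^n. *)
Definition rV_display : measure_display.
Proof. exact: default_measure_display. Qed.

Section measurable_rV.
Context (R : realType) (n : nat).

Definition rV_coord (i : 'I_n) (x : 'rV[R]_n) : measurableTypeR R := x ord0 i.

Definition rV_measurable : set (set 'rV[R]_n) := g_sigma_preimage rV_coord.

Let rV_measurable0 : rV_measurable set0.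
Proof. exact: sigma_algebra0. Qed.

Let rV_measurableC A : rV_measurable A -> rV_measurable (~` A).
Proof. exact: sigma_algebraC. Qed.

Let rV_measurable_bigcup (F : (set 'rV[R]_n)^nat) :
  (forall i, rV_measurable (F i)) -> rV_measurable (\bigcup_i F i).
Proof. exact: sigma_algebra_bigcup. Qed.

HB.instance Definition _ := @isMeasurable.Build rV_display
  'rV[R]_n rV_measurable rV_measurable0 rV_measurableC rV_measurable_bigcup.

Lemma measurable_rV_coord (i : 'I_n) : measurable_fun setT (rV_coord i).
Proof.
move=> _ Y mY; rewrite setTI; apply: sub_sigma_algebra => /=.
rewrite -bigcup_seq/=; exists i => /=; first by rewrite mem_index_enum.
by exists Y => //; rewrite setTI.
Qed.

Lemma measurable_fun_rV d (T : measurableType d) (f : T -> 'rV[R]_n) :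
  (forall i, measurable_fun setT (rV_coord i \o f)) -> measurable_fun setT f.
Proof.
move=> mf _ A mA.
suff H : g_sigma_preimage (fun i => rV_coord i \o f) `<=` measurable.
  by apply: H; rewrite g_sigma_preimage_comp; exists A.
apply: smallest_sub; first exact: sigma_algebra_measurable.
rewrite -bigcup_seq/= => B [i _ [C mC <-]].
exact: mf.
Qed.

End measurable_rV.

Section cons_rV.
Context (R : realType) (n : nat).

Definition cons_rV (p : measurableTypeR R * 'rV[R]_n) : 'rV[R]_n.+1 :=
  row_mx (p.1 : R)%:M p.2 : 'rV[R]_(1 + n).

Definition uncons_rV (x : 'rV[R]_n.+1) : measurableTypeR R * 'rV[R]_n :=
  (x ord0 ord0, rsubmx (x : 'rV[R]_(1 + n))).

Lemma cons_rVK : cancel cons_rV uncons_rV.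
Proof.
move=> [a v]; rewrite /uncons_rV /cons_rV row_mxKr /=; congr pair.
have -> : (ord0 : 'I_n.+1) = lshift n (ord0 : 'I_1) by exact/val_inj.
by apply: etrans (row_mxEl _ _ _ _) _; rewrite mxE.
Qed.

Lemma measurable_cons_rV : measurable_fun setT cons_rV.
Proof.
apply: measurable_fun_rV => i.
case: (split_ordP (i : 'I_(1 + n))) => j ->.
  rewrite (_ : _ \o _ = fst)//; apply/funext => -[a v] /=.
  apply: (etrans (row_mxEl (a%:M : 'M[R]_1) v ord0 j)).
  by rewrite (ord1 j) mxE.
rewrite (_ : _ \o _ = rV_coord j \o snd).
  by apply: measurableT_comp => //; exact: measurable_rV_coord.
by apply/funext => -[a v] /=; exact: (row_mxEr (a%:M : 'M[R]_1) v ord0 j).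
Qed.

Lemma measurable_uncons_rV : measurable_fun setT uncons_rV.
Proof.
apply: measurable_fun_pair; first exact: (measurable_rV_coord ord0).
apply: measurable_fun_rV => i.
rewrite (_ : _ \o _ = rV_coord (rshift 1 i : 'I_n.+1)).
  exact: measurable_rV_coord.
by apply/funext => x /=; rewrite /rV_coord mxE.
Qed.

Variable m : {sigma_finite_measure set 'rV[R]_n -> \bar R}.

Definition lebesgue_rVS : set 'rV[R]_n.+1 -> \bar R :=
  pushforward (@lebesgue_measure R \x m)%E cons_rV.

Let lebesgue_rVS0 : lebesgue_rVS set0 = 0%E.
Proof. by rewrite /lebesgue_rVS /pushforward preimage_set0 measure0. Qed.

Let lebesgue_rVS_ge0 A : (0 <= lebesgue_rVS A)%E.
Proof. exact: (measure_ge0 (@lebesgue_measure R \x m)%E). Qed.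

Let lebesgue_rVS_sigma_additive : semi_sigma_additive lebesgue_rVS.
Proof.
move=> F mF tF mUF; rewrite /lebesgue_rVS /pushforward preimage_bigcup.
apply: measure_semi_sigma_additive.
- by move=> k; rewrite -[X in measurable X]setTI; exact: measurable_cons_rV.
- apply/trivIsetP => /= i j _ _ ij; rewrite -preimage_setI.
  by move/trivIsetP : tF => /(_ _ _ _ _ ij) ->//; rewrite preimage_set0.
- rewrite -preimage_bigcup -[X in measurable X]setTI.
  exact: measurable_cons_rV.
Qed.

HB.instance Definition _ := isMeasure.Build _ _ _ lebesgue_rVS
  lebesgue_rVS0 lebesgue_rVS_ge0 lebesgue_rVS_sigma_additive.

Let lebesgue_rVS_sigma_finite : sigma_finite setT lebesgue_rVS.
Proof.
have /sigma_finiteP[F [FT ndF Foo]] := sigma_finiteT (@lebesgue_measure R).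
have /sigma_finiteP[G [GT ndG Goo]] := sigma_finiteT m.
exists (fun k => uncons_rV @^-1` (F k `*` G k)).
  rewrite -preimage_bigcup -[LHS](preimage_setT uncons_rV); congr (_ @^-1` _).
  rewrite -setXTT FT GT predeqE => -[x y]; split.
    move=> [/= [i _ Fix] [j _ Gjy]]; exists (maxn i j) => //; split.
    - by move: x Fix; exact/subsetPset/ndF/leq_maxl.
    - by move: y Gjy; exact/subsetPset/ndG/leq_maxr.
  by move=> [i _ []/= ? ?]; split; exists i.
move=> k; have [mF Fk] := Foo k; have [mG Gk] := Goo k; split.
  rewrite -[X in measurable X]setTI; apply: measurable_uncons_rV => //.
  exact: measurableX.
rewrite /lebesgue_rVS /pushforward -comp_preimage (_ : _ \o _ = id); last first.
  exact/funext/cons_rVK.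
rewrite preimage_id [ltLHS]product_measure1E//.
by rewrite lte_mul_pinfty// ge0_fin_numE.
Qed.

HB.instance Definition _ := Measure_isSigmaFinite.Build _ _ _ lebesgue_rVS
  lebesgue_rVS_sigma_finite.

End cons_rV.

Section lebesgue_rV.
Context (R : realType).

(* The Lebesgue measure of R^n: the point mass for n = 0, and the image of
   lebesgue_measure \x lebesgue_rV n under (t, v) |-> row_mx t v for n + 1. *)
Fixpoint lebesgue_rV (n : nat) : {sigma_finite_measure set 'rV[R]_n -> \bar R} :=
  if n is n'.+1 then lebesgue_rVS (lebesgue_rV n')
  else \d_(0 : 'rV[R]_0).

End lebesgue_rV.

Local Open Scope complex_scope.

Section fourier.
Context (R : realType) (d : nat).
Implicit Types (D Omega : set 'rV[R]_d) (x xi : 'rV[R]_d).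
Implicit Types phi psi u v f : 'rV[R]_d -> R[i].

Definition cintegral D f : R[i] :=
  (\int[lebesgue_rV R d]_(x in D) complex.Re (f x)) +i*
  (\int[lebesgue_rV R d]_(x in D) complex.Im (f x)).

Definition dot (x y : 'rV[R]_d) : R := \sum_(i < d) x ord0 i * y ord0 i.

Definition euclid_norm x : R := Num.sqrt (dot x x).

Definition expi (t : R) : R[i] := cos t +i* sin t.

Definition fourier phi xi : R[i] :=
  ((2 * pi) `^ (- (d%:R / 2)))%:C *
  cintegral setT (fun x => expi (- dot xi x) * phi x).

Definition fourier_inv f x : R[i] :=
  ((2 * pi) `^ (- (d%:R / 2)))%:C *
  cintegral setT (fun xi => expi (dot xi x) * f xi).

Definition sqrt_laplacian phi : 'rV[R]_d -> R[i] :=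
  fourier_inv (fun xi => (euclid_norm xi)%:C * fourier phi xi).

Definition partial (i : 'I_d) (g : 'rV[R]_d -> R) : 'rV[R]_d -> R :=
  'D_(delta_mx ord0 i) g.

Definition smooth (g : 'rV[R]_d -> R) : Prop :=
  forall s : seq 'I_d,
    continuous (foldr partial g s) /\
    forall (i : 'I_d) x, derivable (foldr partial g s) x (delta_mx ord0 i).

Definition support phi : set 'rV[R]_d := closure [set x | phi x != 0].

(* phi is in C_c^oo(Omega), as a function on R^d that vanishes off Omega. *)
Definition test_function Omega phi : Prop :=
  [/\ smooth (fun x => complex.Re (phi x)), smooth (fun x => complex.Im (phi x)),
      compact (support phi) & support phi `<=` Omega].

End fourier.

Section friedrichs.
Context (R : realType) (d : nat).
Variable Omega : set 'rV[R]_d.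
Implicit Types phi psi u v f : 'rV[R]_d -> R[i].

(* Elements of L^2(Omega) are represented by functions on R^d, of which only
   the values on Omega matter, up to a null set. *)
Definition L2sqnorm u : \bar R :=
  (\int[lebesgue_rV R d]_(x in Omega)
     (complex.Re (u x) ^+ 2 + complex.Im (u x) ^+ 2)%:E)%E.

Definition L2 u : Prop :=
  [/\ measurable_fun Omega (fun x => complex.Re (u x)),
      measurable_fun Omega (fun x => complex.Im (u x)) & (L2sqnorm u < +oo)%E].

Definition L2dot u v : R[i] := cintegral Omega (fun x => (u x)^* * v x).

Definition sqrt_form phi psi : R[i] := L2dot phi (sqrt_laplacian psi).

Definition ccvg (z : nat -> R[i]) (l : R[i]) : Prop :=
  (fun n => complex.Re (z n)) @ \oo --> complex.Re l /\
  (fun n => complex.Im (z n)) @ \oo --> complex.Im l.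

(* F n -> u in L^2(Omega) and q (F m - F n) -> 0 as m, n -> oo, for the
   quadratic form q phi = sqrt_form phi phi, which is real-valued. *)
Definition form_cvg (F : nat -> 'rV[R]_d -> R[i]) u : Prop :=
  [/\ forall n, test_function Omega (F n),
      (fun n => L2sqnorm (F n \- u)) @ \oo --> 0%E &
      forall e : R, 0 < e -> \forall N \near \oo, forall m n : nat,
        (N <= m)%N -> (N <= n)%N ->
        `|complex.Re (sqrt_form (F m \- F n) (F m \- F n))| < e].

(* The domain of the closure of the form, and the graph of the closure. *)
Definition form_domain u : Prop := L2 u /\ exists F, form_cvg F u.

Definition closed_form u v (z : R[i]) : Prop :=
  exists F G, [/\ form_cvg F u, form_cvg G v &
    ccvg (fun n => sqrt_form (F n) (G n)) z].

(* The graph of the Friedrichs extension, that is, of the self-adjoint operator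
   associated with the closed form: u is in the domain and is mapped to f iff
   q(v, u) = <v, f> for all v in the form domain. *)
Definition H0 u f : Prop :=
  [/\ form_domain u, L2 f &
      forall v, form_domain v -> closed_form v u (L2dot v f)].

Definition in_eigenspace (lam : R) u : Prop :=
  H0 u (fun x => lam%:C * u x).

Definition L2free n (u : 'I_n -> 'rV[R]_d -> R[i]) : Prop :=
  forall c : 'I_n -> R[i],
    L2sqnorm (fun x => \sum_(i < n) c i * u i x) = 0%E -> forall i, c i = 0.

(* beta lists the eigenvalues in nondecreasing order, each repeated according to
   its multiplicity: the eigenspace of lam has dimension at least n iff lam
   occurs at least n times. Indices start at 0: beta 0 is the lowest eigenvalue. *)
Definition eigenvalues (beta : nat -> R) : Prop :=
  nondecreasing_seq beta /\
  forall (lam : R) (n : nat),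
    (exists u : 'I_n -> 'rV[R]_d -> R[i],
       (forall i, in_eigenspace lam (u i)) /\ L2free u) <->
    (exists j : 'I_n -> nat, injective j /\ forall i, beta (j i) = lam).

End friedrichs.

Definition mean (R : realType) (beta : nat -> R) (k : nat) : R :=
  k%:R^-1 * \sum_(l < k) beta l.

Definition Gamma (R : realType) (s : R) : R :=
  \int[lebesgue_measure]_(t in `]0, +oo[) (t `^ (s - 1) * expR (- t)).

(* Main.v *)
From HB Require Import structures.
Require Import Defs.
From mathcomp Require Import all_boot all_order all_algebra.
From mathcomp Require Import all_classical all_reals all_analysis.
From mathcomp Require Import measurable_realfun complex ring lra.

(** The eigenvalue sum is bounded below by the method of Berezin and of Li and
    Yau. Write S for the sum of the first k eigenvalues, u_0, ..., u_(k-1) for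
    orthonormal eigenfunctions, extended by 0 outside Omega, and F xi for the
    sum of the |fourier u_l xi|^2.

    - F <= (2 pi)^-d |Omega| everywhere: fourier u_l xi is (2 pi)^(-d/2) times
      the scalar product in L^2(Omega) of u_l with a plane wave, whose squared
      norm there is |Omega|, so this is Bessel's inequality.
    - F has integral k (Plancherel), and |xi| F has integral S, because |xi| is
      the symbol of the operator.

    Since |xi| F >= r F - max(0, r - |xi|) F for every r > 0, it follows that S
    is at least r k minus (2 pi)^-d |Omega| times the integral of
    max(0, r - |xi|), which is v r^(d+1) / (d+1) with v the volume of the unit
    ball ([bathtub], [sum_eigenvalues_ge]). At the radius for which
    v r^d |Omega| = (2 pi)^d k the difference is r k d / (d+1), and
    Gamma (1 + d/2) v = pi^(d/2) ([Gamma_ball_vol]) turns it into the bound that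
    is claimed.

    The eigenfunctions are not test functions, while the form is defined through
    test functions. The argument is therefore run with k test functions that are
    orthonormal up to e and whose energies exceed the eigenvalues by at most e
    ([almost_orthonormal_test_vectors]); the inequality of Bessel only loses a
    factor 1 + k e ([almost_bessel]), and e tends to 0 at the end. Such test
    functions exist because the closed form is a limit along test functions.
    This part is abstract: h and q are non-negative hermitian forms, h in the role
    of the scalar product, and every q(., u) is h-bounded, as holds for the form
    of an operator.
    That makes q closable ([form_limit0]), so that the closed form does not
    depend on the approximating sequences, and eigenvectors of different
    eigenvalues are orthogonal.

    For test functions, q and the scalar product are integrals of
    conj (fourier phi) fourier psi with weights |xi| and 1 ([sqrt_form_fourier],
    [L2dot_fourier]). Both follow from Fubini's theorem, the second one with
    [fourier_inversion]. Absolute convergence comes from the decay of the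
    transform, that is from integration by parts ([cos_transform_partial]).
    Inversion is proved by damping with exp(- e (|xi_1| + ... + |xi_d|)), whose
    transform is a product of Poisson kernels: all weights are products over the
    coordinates, as Lebesgue measure on row vectors is an iterated product. *)

Set Implicit Arguments.
Unset Strict Implicit.
Unset Printing Implicit Defensive.

Import Order.TTheory GRing.Theory Num.Theory.
Import numFieldNormedType.Exports.

Local Open Scope classical_set_scope.
Local Open Scope ring_scope.
Local Open Scope complex_scope.

(** * Complex-valued functions through their real and imaginary parts *)

Section complex_parts.
Context (R : realType).
Implicit Types (x y z : R[i]).

Lemma complexP x y : complex.Re x = complex.Re y -> complex.Im x = complex.Im y -> x = y.
Proof. by case: x y => [a b] [c d] /= -> ->. Qed.

Lemma RecD x y : complex.Re (x + y) = complex.Re x + complex.Re y.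
Proof. by case: x y => [a b] [c d]. Qed.

Lemma ImcD x y : complex.Im (x + y) = complex.Im x + complex.Im y.
Proof. by case: x y => [a b] [c d]. Qed.

Lemma RecN x : complex.Re (- x) = - complex.Re x.
Proof. by case: x => [a b]. Qed.

Lemma ImcN x : complex.Im (- x) = - complex.Im x.
Proof. by case: x => [a b]. Qed.

Lemma RecM x y : complex.Re (x * y) =
  complex.Re x * complex.Re y - complex.Im x * complex.Im y.
Proof. by case: x y => [a b] [c d]. Qed.

Lemma ImcM x y : complex.Im (x * y) =
  complex.Re x * complex.Im y + complex.Im x * complex.Re y.
Proof. by case: x y => [a b] [c d]. Qed.

Lemma RecJ x : complex.Re (Num.conj x) = complex.Re x.
Proof. by case: x. Qed.

Lemma ImcJ x : complex.Im (Num.conj x) = - complex.Im x.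
Proof. by case: x. Qed.

Lemma conj_real (r : R) : Num.conj r%:C = r%:C.
Proof. by apply: complexP; rewrite ?RecJ ?ImcJ /= ?oppr0. Qed.

Lemma conjcM x y : Num.conj (x * y) = Num.conj x * Num.conj y.
Proof. exact: rmorphM. Qed.

Lemma realcM (r s : R) : (r * s)%:C = r%:C * s%:C.
Proof. exact: rmorphM. Qed.

Definition ReImE := (RecD, ImcD, RecN, ImcN, RecM, ImcM, RecJ, ImcJ).

(** The modulus on R[i] takes values in R[i]; this equivalent norm takes values
    in R, where measurability, integrability and domination are stated. *)
Definition norm1c z : R := `|complex.Re z| + `|complex.Im z|.

Lemma norm1c_ge0 z : 0 <= norm1c z.
Proof. exact: addr_ge0. Qed.

Lemma norm1cD x y : norm1c (x + y) <= norm1c x + norm1c y.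
Proof.
rewrite /norm1c !ReImE.
have := ler_normD (complex.Re x) (complex.Re y).
have := ler_normD (complex.Im x) (complex.Im y); lra.
Qed.

Lemma norm1cM x y : norm1c (x * y) <= norm1c x * norm1c y.
Proof.
rewrite /norm1c !ReImE.
apply: (@le_trans _ _ ((`|complex.Re x * complex.Re y| + `|complex.Im x * complex.Im y|)
  + (`|complex.Re x * complex.Im y| + `|complex.Im x * complex.Re y|))).
  by apply: lerD; [exact: ler_normB|exact: ler_normD].
by rewrite !normrM; lra.
Qed.

Lemma ler_Re_norm1c z : `|complex.Re z| <= norm1c z.
Proof. by rewrite lerDl. Qed.

Lemma ler_Im_norm1c z : `|complex.Im z| <= norm1c z.
Proof. by rewrite lerDr. Qed.

End complex_parts.

Section complex_measurable.
Context (R : realType) d (T : measurableType d) (D : set T).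
Implicit Types f g : T -> R[i].

Definition cmeasurable f :=
  measurable_fun D (fun x => complex.Re (f x)) /\
  measurable_fun D (fun x => complex.Im (f x)).

Lemma cmeasurable_cst (a : R[i]) : cmeasurable (fun=> a).
Proof. by split; exact: measurable_cst. Qed.

Lemma cmeasurableD f g :
  cmeasurable f -> cmeasurable g -> cmeasurable (fun x => f x + g x).
Proof.
move=> [f1 f2] [g1 g2]; split.
  by under eq_fun do rewrite RecD; exact: measurable_funD.
by under eq_fun do rewrite ImcD; exact: measurable_funD.
Qed.

Lemma cmeasurableM f g :
  cmeasurable f -> cmeasurable g -> cmeasurable (fun x => f x * g x).
Proof.
move=> [f1 f2] [g1 g2]; split.
  under eq_fun do rewrite RecM.
  by apply: measurable_funB; exact: measurable_funM.
under eq_fun do rewrite ImcM.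
by apply: measurable_funD; exact: measurable_funM.
Qed.

Lemma cmeasurable_conj f : cmeasurable f -> cmeasurable (fun x => Num.conj (f x)).
Proof.
move=> [f1 f2]; split; first by under eq_fun do rewrite RecJ.
under eq_fun do rewrite ImcJ; exact: measurableT_comp.
Qed.

Lemma cmeasurable_real (r : T -> R) :
  measurable_fun D r -> cmeasurable (fun x => (r x)%:C).
Proof. by move=> mr; split => //=; exact: measurable_cst. Qed.

End complex_measurable.

Section complex_integral.
Context (R : realType) d (T : measurableType d) (mu : {measure set T -> \bar R}).
Context (D : set T) (mD : measurable D).
Implicit Types f g : T -> R[i].

Definition cintegrable f :=
  mu.-integrable D (EFin \o (fun x => complex.Re (f x))) /\
  mu.-integrable D (EFin \o (fun x => complex.Im (f x))).

(** On lebesgue_rV this is convertible to cintegral, so that the lemmas below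
    apply to the Fourier transform and to L2dot. *)
Definition cint f : R[i] :=
  (\int[mu]_(x in D) complex.Re (f x)) +i* (\int[mu]_(x in D) complex.Im (f x)).

Lemma eq_cint f g : (forall x, D x -> f x = g x) -> cint f = cint g.
Proof.
by move=> fg; congr (_ +i* _); apply: eq_Rintegral => x; rewrite inE => /fg ->.
Qed.

Lemma cintegrable_measurable f : cintegrable f -> cmeasurable D f.
Proof.
by move=> [i1 i2]; split; apply/measurable_EFinP; [exact: measurable_int i1|exact: measurable_int i2].
Qed.

Lemma le_Rintegrable (f g : T -> R) : measurable_fun D f ->
  (forall x, D x -> `|f x| <= g x) -> mu.-integrable D (EFin \o g) ->
  mu.-integrable D (EFin \o f).
Proof.
move=> mf fg; apply: le_integrable => //; first exact/measurable_EFinP.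
by move=> x Dx /=; rewrite lee_fin (le_trans (fg _ Dx))// ler_norm.
Qed.

Lemma le_cintegrable f (g : T -> R) : cmeasurable D f ->
  (forall x, D x -> norm1c (f x) <= g x) -> mu.-integrable D (EFin \o g) ->
  cintegrable f.
Proof.
move=> [mr mi] fg ig; split; apply: le_Rintegrable ig => // x Dx.
  exact: le_trans (ler_Re_norm1c _) (fg _ Dx).
exact: le_trans (ler_Im_norm1c _) (fg _ Dx).
Qed.

Lemma cintegrable_norm1c f : cintegrable f ->
  mu.-integrable D (EFin \o (fun x => norm1c (f x))).
Proof.
move=> [f1 f2]; have := integrableD mD (integrable_norm f1) (integrable_norm f2).
by apply: eq_integrable => // x _ /=; rewrite EFinD.
Qed.

Lemma RintegrableD (f g : T -> R) : mu.-integrable D (EFin \o f) ->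
  mu.-integrable D (EFin \o g) -> mu.-integrable D (EFin \o (fun x => f x + g x)).
Proof. by move=> f1 f2; have := integrableD mD f1 f2; exact: eq_integrable. Qed.

Lemma RintegrableB (f g : T -> R) : mu.-integrable D (EFin \o f) ->
  mu.-integrable D (EFin \o g) -> mu.-integrable D (EFin \o (fun x => f x - g x)).
Proof. by move=> f1 f2; have := integrableB mD f1 f2; exact: eq_integrable. Qed.

Lemma RintegrableZl (a : R) (f : T -> R) : mu.-integrable D (EFin \o f) ->
  mu.-integrable D (EFin \o (fun x => a * f x)).
Proof. by move=> f1; have := integrableZl mD a f1; exact: eq_integrable. Qed.

Lemma cintegrableZ a f : cintegrable f -> cintegrable (fun x => a * f x).
Proof.
move=> [f1 f2]; split; under eq_fun do rewrite ReImE.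
  by apply: RintegrableB; exact: RintegrableZl.
by apply: RintegrableD; exact: RintegrableZl.
Qed.

Lemma cintegrable_conj f : cintegrable f -> cintegrable (fun x => Num.conj (f x)).
Proof.
move=> [f1 f2]; split; first by under eq_fun do rewrite RecJ.
under eq_fun do rewrite ImcJ -mulN1r; exact: RintegrableZl.
Qed.

Lemma cintegrableM_bounded f g (M : R) : cintegrable f -> cmeasurable D g ->
  (forall x, D x -> norm1c (g x) <= M) -> cintegrable (fun x => g x * f x).
Proof.
move=> intf mg gM; apply: (@le_cintegrable _ (fun x => M * norm1c (f x))).
- by apply: cmeasurableM => //; exact: cintegrable_measurable.
- move=> x Dx; apply: le_trans (norm1cM _ _) _.
  by rewrite ler_wpM2r ?norm1c_ge0// gM.
- by apply: RintegrableZl; exact: cintegrable_norm1c.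
Qed.

Lemma cintD f g : cintegrable f -> cintegrable g ->
  cint (fun x => f x + g x) = cint f + cint g.
Proof.
move=> [f1 f2] [g1 g2]; rewrite /cint.
under eq_Rintegral do rewrite RecD.
under [in X in _ +i* X]eq_Rintegral do rewrite ImcD.
by rewrite !RintegralD.
Qed.

Lemma cintZ a f : cintegrable f -> cint (fun x => a * f x) = a * cint f.
Proof.
move=> [f1 f2]; rewrite /cint.
under eq_Rintegral do rewrite RecM.
under [in X in _ +i* X]eq_Rintegral do rewrite ImcM.
rewrite RintegralB ?RintegralD//; do ?exact: RintegrableZl.
by rewrite !RintegralZl//; case: a.
Qed.

Lemma cint_conj f : cintegrable f -> cint (fun x => Num.conj (f x)) = Num.conj (cint f).
Proof.
move=> [f1 f2]; rewrite /cint.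
under eq_Rintegral do rewrite RecJ.
under [in X in _ +i* X]eq_Rintegral do rewrite ImcJ -mulN1r.
by rewrite RintegralZl// mulN1r.
Qed.

Lemma cint_real (f : T -> R) : cint (fun x => (f x)%:C) = (\int[mu]_(x in D) f x)%:C.
Proof. by rewrite /cint/= /Rintegral integral0. Qed.

End complex_integral.

Section restrict.
Context (R : realType) d (T : measurableType d) (mu : {measure set T -> \bar R}).

Lemma cint_setT (D : set T) (f : T -> R[i]) : (forall x, ~ D x -> f x = 0) ->
  cint mu D f = cint mu setT f.
Proof.
move=> f0; rewrite /cint; congr (_ +i* _); rewrite Rintegral_mkcond; apply: eq_Rintegral => x _;
  rewrite patchE; case: ifPn => //; rewrite notin_setE => /f0 ->; by [].
Qed.

End restrict.

Section complex_fubini.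
Context (R : realType) d1 d2 (T1 : measurableType d1) (T2 : measurableType d2).
Context (m1 : {sigma_finite_measure set T1 -> \bar R}).
Context (m2 : {sigma_finite_measure set T2 -> \bar R}).

Lemma measurable_Rintegral_param (h : T1 * T2 -> R) : measurable_fun setT h ->
  measurable_fun setT (fun x => \int[m2]_y h (x, y)).
Proof.
move=> mh; have mEh : measurable_fun setT (EFin \o h) by exact/measurable_EFinP.
rewrite /Rintegral; apply: measurableT_comp; first exact: fine_measurable.
under eq_fun do rewrite integralE.
apply: emeasurable_funB.
  have h0 x : (0 <= ((EFin \o h)^\+)%E x)%E by exact: funepos_ge0.
  have := measurable_fun_fubini_tonelli_F (m2 := m2) _ (measurable_funepos mEh) h0.
  apply: eq_measurable_fun => x _; apply: eq_integral => y _.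
  by rewrite !funeposE.
have h0 x : (0 <= ((EFin \o h)^\-)%E x)%E by exact: funeneg_ge0.
have := measurable_fun_fubini_tonelli_F (m2 := m2) _ (measurable_funeneg mEh) h0.
apply: eq_measurable_fun => x _; apply: eq_integral => y _.
by rewrite !funenegE.
Qed.

Lemma cmeasurable_param (h : T1 * T2 -> R[i]) : cmeasurable setT h ->
  cmeasurable setT (fun x => cint m2 setT (fun y => h (x, y))).
Proof. by move=> [h1 h2]; split; [exact: (measurable_Rintegral_param h1)|exact: (measurable_Rintegral_param h2)]. Qed.

Lemma integrable_prod (p : T1 -> R) (q : T2 -> R) :
  m1.-integrable setT (EFin \o p) -> m2.-integrable setT (EFin \o q) ->
  (m1 \x m2)%E.-integrable setT (EFin \o (fun z => p z.1 * q z.2)).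
Proof.
move=> ip iq.
have mp : measurable_fun setT p by apply/measurable_EFinP; exact: measurable_int ip.
have mq : measurable_fun setT q by apply/measurable_EFinP; exact: measurable_int iq.
apply/integrable12ltyP.
  by apply/measurable_EFinP; apply: measurable_funM; exact: measurableT_comp.
rewrite (eq_integral (fun x => `|(p x)%:E| * (\int[m2]_y `|(q y)%:E|))%E); last first.
  move=> x _; rewrite -ge0_integralZl//.
    by apply: eq_integral => y _; rewrite -abseM.
  by apply/measurable_EFinP; exact: measurableT_comp.
have [_ qoo] := integrableP _ _ _ iq.
have [_ poo] := integrableP _ _ _ ip.
rewrite ge0_integralZr//.
- by apply: lte_mul_pinfty => //; [exact: integral_ge0|rewrite ge0_fin_numE//; exact: integral_ge0].
- by apply/measurable_EFinP; exact: measurableT_comp.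
- exact: integral_ge0.
Qed.

(** All sections are required to be integrable, and not only almost all of them:
    on a divergent section the inner Rintegral is a junk value. *)
Lemma Rfubini (h : T1 * T2 -> R) : (m1 \x m2)%E.-integrable setT (EFin \o h) ->
  (forall x, m2.-integrable setT (EFin \o (fun y => h (x, y)))) ->
  (forall y, m1.-integrable setT (EFin \o (fun x => h (x, y)))) ->
  \int[m1]_x (\int[m2]_y h (x, y)) = \int[m2]_y (\int[m1]_x h (x, y)).
Proof.
move=> ih ih1 ih2; rewrite /Rintegral.
rewrite (eq_integral (fun x => \int[m2]_y (h (x, y))%:E)%E); last first.
  by move=> x _; rewrite fineK//; exact: integrable_fin_num (ih1 x).
rewrite [in RHS](eq_integral (fun y => \int[m1]_x (h (x, y))%:E)%E); last first.
  by move=> y _; rewrite fineK//; exact: integrable_fin_num (ih2 y).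
by rewrite (Fubini ih).
Qed.

(** Fubini for a bounded kernel between two integrable functions. The adjunction
    between the Fourier transform and its inverse and the regularised inversion
    formula are both of this form. *)
Lemma cint_swap (f : T1 -> R[i]) (k : T1 * T2 -> R[i]) (g : T2 -> R[i]) (M : R) :
  cintegrable m1 setT f -> cintegrable m2 setT g -> cmeasurable setT k ->
  (forall z, norm1c (k z) <= M) ->
  cint m1 setT (fun x => f x * cint m2 setT (fun y => k (x, y) * g y)) =
  cint m2 setT (fun y => g y * cint m1 setT (fun x => k (x, y) * f x)).
Proof.
move=> fi gi mk kM.
have mf := cintegrable_measurable fi.
have mg := cintegrable_measurable gi.
have mk1 x : cmeasurable setT (fun y => k (x, y)).
  by case: mk => k1 k2; split; [apply: (measurableT_comp k1)|apply: (measurableT_comp k2)].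
have mk2 y : cmeasurable setT (fun x => k (x, y)).
  by case: mk => k1 k2; split; [apply: (measurableT_comp k1)|apply: (measurableT_comp k2)].
have ikg x : cintegrable m2 setT (fun y => k (x, y) * g y).
  by apply: (cintegrableM_bounded measurableT gi (mk1 x) (M := M)).
have ikf y : cintegrable m1 setT (fun x => k (x, y) * f x).
  by apply: (cintegrableM_bounded measurableT fi (mk2 y) (M := M)).
pose h (z : T1 * T2) := f z.1 * (k z * g z.2).
have h1 x : cintegrable m2 setT (fun y => h (x, y)) by exact: (cintegrableZ measurableT (f x) (ikg x)).
have h2 y : cintegrable m1 setT (fun x => h (x, y)).
  have := cintegrableZ measurableT (g y) (ikf y).
  by congr (cintegrable _ _ _); apply/funext => x; rewrite /h/=; ring.
have mh : cmeasurable setT h.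
  case: mf => f1 f2; case: mg => g1 g2.
  apply: cmeasurableM; last apply: cmeasurableM => //.
    by split; [exact: (measurableT_comp f1)|exact: (measurableT_comp f2)].
  by split; [exact: (measurableT_comp g1)|exact: (measurableT_comp g2)].
have hi : cintegrable (m1 \x m2)%E setT h.
  apply: (le_cintegrable _ (g := fun z => M * (norm1c (f z.1) * norm1c (g z.2)))) => //.
    move=> z _; apply: le_trans (norm1cM _ _) _.
    rewrite mulrCA ler_wpM2l ?norm1c_ge0//; apply: le_trans (norm1cM _ _) _.
    by rewrite ler_wpM2r ?norm1c_ge0.
  apply: RintegrableZl => //.
  by apply: (@integrable_prod (fun x => norm1c (f x)) (fun x => norm1c (g x))); exact: cintegrable_norm1c.
transitivity (cint m1 setT (fun x => cint m2 setT (fun y => h (x, y)))).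
  by apply: eq_cint => x _; rewrite -(cintZ measurableT (f x) (ikg x)).
transitivity (cint m2 setT (fun y => cint m1 setT (fun x => h (x, y)))); last first.
  apply: eq_cint => y _; rewrite -(cintZ measurableT (g y) (ikf y)).
  by apply: eq_cint => x _; rewrite /h/=; ring.
case: hi => hr hi; rewrite /cint /=; congr (_ +i* _).
  by apply: (Rfubini hr) => [x|y]; [case: (h1 x)|case: (h2 y)].
by apply: (Rfubini hi) => [x|y]; [case: (h1 x)|case: (h2 y)].
Qed.

End complex_fubini.

(** * Affine substitutions and products over coordinates *)

Section affine_line.
Context (R : realType) (a c : R) (c0 : 0 < c).
Let phi (t : measurableTypeR R) : measurableTypeR R := a + c * t.

Let mphi : measurable_fun setT phi.
Proof. by apply: measurable_funD => //; exact: measurable_funM. Qed.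

Let phi_mixin := isMeasurableFun.Build _ _ _ _ _ mphi.
Let phi_mfun : {mfun _ >-> _} := HB.pack phi phi_mixin.

(* Both sides are measures that agree on half-open intervals. *)
Let lebesgue_affine A : measurable A ->
  lebesgue_measure A = (c%:E * (@lebesgue_measure R) (phi @^-1` A))%E.
Proof.
move=> mA; pose c' := NngNum (ltW c0).
have := @lebesgue_measure_unique R (mscale c' (pushforward lebesgue_measure phi_mfun)).
apply => // _ [[u v] _ <-] /=.
rewrite /mscale/= /pushforward.
rewrite (_ : phi_mfun @^-1` _ = `](u - a) / c, (v - a) / c]%classic); last first.
  apply/seteqP; split => t /=; rewrite !in_itv/= /phi.
    by rewrite ltr_pdivrMr// ler_pdivlMr// => /andP[? ?]; apply/andP; split; lra.
  by rewrite ltr_pdivrMr// ler_pdivlMr// => /andP[? ?]; apply/andP; split; lra.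
rewrite !lebesgue_measure_itv/= !lte_fin ltr_pM2r ?invr_gt0// ltrD2r.
case: ifPn => uv; last by rewrite mule0.
by rewrite -!EFinB -EFinM; congr EFin; field; rewrite gt_eqF.
Qed.

Lemma ge0_integral_affine (f : R -> \bar R) : measurable_fun setT f ->
  (forall x, (0 <= f x)%E) ->
  (c%:E * \int[lebesgue_measure]_t f (a + c * t)%R = \int[lebesgue_measure]_t f t)%E.
Proof.
move=> mf f0; pose c' := NngNum (ltW c0).
rewrite [RHS](@eq_measure_integral _ _ _ _
    (mscale c' (pushforward lebesgue_measure phi_mfun))); last first.
  by move=> A mA _; rewrite /= /mscale/=; exact: lebesgue_affine.
rewrite ge0_integral_mscale//=; congr (_ * _)%E.
by rewrite ge0_integral_pushforward.
Qed.

End affine_line.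

Section rV_integral.
Context (R : realType).
Local Notation lam := (lebesgue_rV R).

Lemma ge0_integral_rVS n (f : 'rV[R]_n.+1 -> \bar R) : measurable_fun setT f ->
  (forall x, 0 <= f x)%E ->
  (\int[lam n.+1]_x f x =
   \int[lebesgue_measure]_t \int[lam n]_v f (cons_rV (t, v)))%E.
Proof.
move=> mf f0; rewrite /= ge0_integral_pushforward//=; last exact: measurable_cons_rV.
rewrite preimage_setT fubini_tonelli1//.
by apply: measurableT_comp => //; exact: measurable_cons_rV.
Qed.

Lemma measurable_cons_slice n d (T : measurableType d) (f : 'rV[R]_n.+1 -> T) t :
  measurable_fun setT f -> measurable_fun setT (fun v => f (cons_rV (t, v))).
Proof.
move=> mf; apply: measurableT_comp => //.
apply: (measurableT_comp (@measurable_cons_rV R n)).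
exact: pair1_measurable.
Qed.

Lemma cons_rV0 n t (v : 'rV[R]_n) : cons_rV (t, v) ord0 ord0 = t.
Proof. by have := cons_rVK (t, v); rewrite /uncons_rV => -[]. Qed.

Lemma cons_rVS n t (v : 'rV[R]_n) i : cons_rV (t, v) ord0 (lift ord0 i) = v ord0 i.
Proof.
have := cons_rVK (t, v); rewrite /uncons_rV => -[_ /rowP/(_ i)]; rewrite mxE => <-.
by congr (cons_rV _ _ _); apply/val_inj.
Qed.

Lemma cons_rVD n t s (v w : 'rV[R]_n) :
  cons_rV (t, v) + cons_rV (s, w) = cons_rV (t + s, v + w).
Proof.
apply/rowP => i; rewrite [LHS]mxE.
by case: (unliftP ord0 i) => [j|] ->; rewrite ?cons_rV0 // !cons_rVS mxE.
Qed.

Lemma cons_rVZ n c t (v : 'rV[R]_n) : c *: cons_rV (t, v) = cons_rV (c * t, c *: v).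
Proof.
apply/rowP => i; rewrite [LHS]mxE.
by case: (unliftP ord0 i) => [j|] ->; rewrite ?cons_rV0 // !cons_rVS mxE.
Qed.

Lemma uncons_rVK n (x : 'rV[R]_n.+1) : cons_rV (uncons_rV x) = x.
Proof.
apply/rowP => i; rewrite /uncons_rV; case: (unliftP ord0 i) => [j|] ->.
  by rewrite cons_rVS mxE; congr (x _ _); apply/val_inj.
by rewrite cons_rV0.
Qed.

Lemma measurable_affine n (a : 'rV[R]_n) (c : R) :
  measurable_fun setT (fun x : 'rV[R]_n => a + c *: x).
Proof.
apply: measurable_fun_rV => i.
rewrite (_ : _ \o _ = fun x => a ord0 i + c * rV_coord i x); last first.
  by apply/funext => x; rewrite /rV_coord/= !mxE.
by apply: measurable_funD => //; apply: measurable_funM => //; exact: measurable_rV_coord.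
Qed.

(** By induction on the dimension: Tonelli splits off one coordinate, on which
    the substitution is one-dimensional and contributes one factor c. *)
Lemma ge0_integral_rV_affine n (a : 'rV[R]_n) (c : R) (c0 : 0 < c)
    (f : 'rV[R]_n -> \bar R) : measurable_fun setT f -> (forall x, 0 <= f x)%E ->
  ((c ^+ n)%:E * \int[lam n]_x f (a + c *: x)%R = \int[lam n]_x f x)%E.
Proof.
elim: n a f => [a f mf f0|n ih a f mf f0].
  rewrite expr0 mul1e; apply: eq_integral => x _.
  by rewrite [in RHS](thinmx0 x) [X in f X]thinmx0.
rewrite !ge0_integral_rVS//; last first.
  by apply: measurableT_comp => //; exact: measurable_affine.
case: (uncons_rV a) (uncons_rVK a) => s b <-.
rewrite -[RHS](ge0_integral_affine s c0)//; last 2 first.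
- have mfc : measurable_fun setT (fun z => f (@cons_rV R n z)).
    by apply: measurableT_comp => //; exact: measurable_cons_rV.
  exact: (measurable_fun_fubini_tonelli_F (m2 := lam n) _ mfc (fun z => f0 _)).
- by move=> x; exact: integral_ge0.
rewrite exprS EFinM -muleA; congr (_ * _)%E.
rewrite -ge0_integralZl//; last 3 first.
- have mfc : measurable_fun setT (fun z => f (cons_rV (s, b) + c *: @cons_rV R n z)).
    apply: measurableT_comp => //.
    by apply: (measurableT_comp (measurable_affine _ _)); exact: measurable_cons_rV.
  exact: (measurable_fun_fubini_tonelli_F (m2 := lam n) _ mfc (fun z => f0 _)).
- by move=> x _; exact: integral_ge0.
- by rewrite lee_fin exprn_ge0// ltW.
apply: eq_integral => t _.
rewrite -[RHS](ih b)//; last exact: (measurable_cons_slice _ mf).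
congr (_ * _)%E; apply: eq_integral => v _.
by rewrite cons_rVZ cons_rVD.
Qed.

Lemma measurable_rV_prod n (g : R -> R) : measurable_fun setT g ->
  measurable_fun setT (fun x : 'rV[R]_n => \prod_(i < n) g (x ord0 i)).
Proof.
move=> mg; apply: measurable_prod => i _.
by apply: (measurableT_comp mg); exact: (measurable_rV_coord i).
Qed.

Lemma ge0_integral_prod n (g : R -> R) : measurable_fun setT g ->
  (forall x, 0 <= g x) ->
  (\int[lam n]_x (\prod_(i < n) g (x ord0 i))%:E =
   \prod_(i < n) \int[lebesgue_measure]_t (g t)%:E)%E.
Proof.
move=> mg g0.
have prod0 m (x : 'rV[R]_m) : (0 <= (\prod_(i < m) g (x ord0 i))%:E)%E.
  by rewrite lee_fin; apply: prodr_ge0 => i _.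
elim: n => [|n ih].
  rewrite big_ord0; under eq_integral do rewrite big_ord0.
  by rewrite integral_cst//= mul1e diracT.
rewrite ge0_integral_rVS//; last by apply/measurable_EFinP; exact: measurable_rV_prod.
rewrite big_ord_recl -ih.
rewrite -ge0_integralZr//; last 3 first.
- exact/measurable_EFinP.
- by move=> t _; rewrite lee_fin.
- exact: integral_ge0.
apply: eq_integral => t _; rewrite -ge0_integralZl//; last 2 first.
- by apply/measurable_EFinP; exact: measurable_rV_prod.
- by rewrite lee_fin.
apply: eq_integral => v _; rewrite big_ord_recl cons_rV0 -EFinM.
by congr (_ * _)%:E; apply: eq_bigr => i _; rewrite cons_rVS.
Qed.

End rV_integral.

(** * Borel sets and bounded sets of row vectors *)

Section rV_topology_measurable.
Context (R : realType) (n : nat).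

Lemma measurable_rV_ball (q : 'rV[R]_n) (r : R) : measurable (ball q r).
Proof.
have [r0|r0] := ltP 0 r; last first.
  rewrite (_ : ball q r = set0)//; apply/seteqP; split => // x [].
  by rewrite ltNge r0.
rewrite (_ : ball q r = \bigcap_(i in [set` index_enum 'I_n])
    (rV_coord i @^-1` (ball (q ord0 i) r))); last first.
  apply/seteqP; split => [x [_ qx] i _ /=|x qx]; first exact: qx.
  by split => // i j; rewrite (ord1 i); apply: (qx j); rewrite /= mem_index_enum.
rewrite bigcap_seq; apply: bigsetI_measurable => i _.
rewrite -[X in measurable X]setTI; apply: measurable_rV_coord => //.
exact: measurable_ball.
Qed.

(** The balls of the norm of 'rV[R]_n are cubes, hence products of intervals,
    and an open set is the union of the cubes with rational centre and rational
    radius that it contains. *)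
Lemma open_measurable_rV (U : set 'rV[R]_n) : open U -> measurable U.
Proof.
move=> oU.
pose B (q : 'rV[rat]_n * rat) : set 'rV[R]_n := ball (\row_i ratr (q.1 ord0 i) : 'rV[R]_n) (ratr q.2).
pose F q := if `[< B q `<=` U >] then B q else set0.
rewrite (_ : U = \bigcup_q F q).
  apply: countable_bigcupT_measurable; first exact: countableP.
  move=> q.
  by rewrite /F; case: ifP => // _; exact: measurable_rV_ball.
apply/seteqP; split => [x Ux|x [q _]]; last first.
  by rewrite /F; case: ifPn => // /asboolP; apply.
have /nbhs_ballP[e /= e0 xe] : nbhs x U by exact: open_nbhs_nbhs.
have [r /itvP r0e] : exists r : rat, ratr r \in `]0, (e / 2)[.
  by apply: rat_in_itvoo; rewrite divr_gt0.
have r0 : 0 < ratr r :> R by rewrite r0e.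
have /choice[f fx] : forall i, exists q : rat, ratr q \in `](x ord0 i - ratr r), (x ord0 i + ratr r)[.
  by move=> i; apply: rat_in_itvoo; lra.
pose q : 'rV[rat]_n * rat := (\row_i f i, r).
have xq i : `|x ord0 i - ratr (f i)| < ratr r.
  by have := fx i; rewrite in_itv/= ltr_distlC => /andP[? ?]; apply/andP; split; lra.
exists q => //; rewrite /F; case: ifPn => [_|/asboolPn nsub]; last first.
  exfalso; apply: nsub => y [_ qy]; apply: xe; split => // i j; rewrite (ord1 i).
  have := qy ord0 j; have := xq j; rewrite /ball/= !mxE => h1 h2.
  have := ler_distD (ratr (f j)) (x ord0 j) (y ord0 j).
  have : ratr r < e / 2 by rewrite r0e.
  by lra.
by split => // i j; rewrite (ord1 i) !mxE /ball/= distrC.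
Qed.

Lemma continuous_measurable_rV (f : 'rV[R]_n -> R) : continuous f -> measurable_fun setT f.
Proof.
move=> cf; apply: (measurability _ (RGenOInfty.measurableE R)) => //.
move=> /= _ [_ [a ->] <-]; rewrite setTI; apply: open_measurable_rV.
apply: open_comp => [x _|]; [exact: cf|exact: interval_open].
Qed.

(** A bounded set lies in a cube [-K, K]^n, whose indicator is a product over
    the coordinates. *)
Lemma bounded_measurable_lty (A : set 'rV[R]_n) : measurable A -> bounded_set A ->
  (lebesgue_rV R n A < +oo)%E.
Proof.
move=> mA [M [_ bA]]; pose K := Num.max 1 (M + 1).
have AK x i : A x -> `|x ord0 i| <= K.
  move=> Ax; apply: (@le_trans _ _ `|x|).
    by rewrite /Num.norm/= mx_normrE; exact: (le_bigmax _ (fun i => `|x i.1 i.2|) (ord0, i)).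
  by apply: bA => //; rewrite lt_max ltrDl ltr01 orbT.
pose g : R -> R := \1_(`[-K, K]%classic).
have mg : measurable_fun setT g by exact: measurable_indic.
have g0 x : 0 <= g x by rewrite /g indicE.
apply: (@le_lt_trans _ _ (\int[lebesgue_rV R n]_x (\prod_(i < n) g (x ord0 i))%:E)%E).
  rewrite -[A in leLHS]setIT -integral_indic//; apply: ge0_le_integral => //.
  - exact/measurable_EFinP.
  - by apply/measurable_EFinP; exact: measurable_rV_prod.
  - move=> x _; rewrite lee_fin indicE; case: (boolP (x \in A)) => [|_]; last by rewrite prodr_ge0.
    rewrite inE => Ax; rewrite big1// => i _.
    by rewrite /g indicE mem_set//= in_itv/= -ler_norml AK.
rewrite ge0_integral_prod// (eq_bigr (fun=> (2 * K)%:E)); last first.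
  move=> i _; rewrite /g integral_indic// setIT/= lebesgue_measure_itv/= lte_fin.
  have K0 : 0 < K by rewrite lt_max ltr01.
  by rewrite ifT; [rewrite -EFinB; congr EFin; lra|lra].
by rewrite prodEFin ltry.
Qed.

End rV_topology_measurable.

Section rV_affine_integrable.
Context (R : realType) (n : nat) (a : 'rV[R]_n) (c : R) (c0 : 0 < c).
Local Notation lam := (lebesgue_rV R n).

Lemma integrable_rV_affine (f : 'rV[R]_n -> R) : lam.-integrable setT (EFin \o f) ->
  lam.-integrable setT (EFin \o (fun x => f (a + c *: x))).
Proof.
move=> /integrableP[mf foo]; apply/integrableP; split.
  by apply: (measurableT_comp mf); exact: measurable_affine.
have mf' : measurable_fun setT (fun x => `|(EFin \o f) x|%E) by exact: measurableT_comp.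
have := ge0_integral_rV_affine a c0 mf' (fun=> abse_ge0 _).
move=> aff; move: foo; rewrite -aff /=.
case: (\int[_]_x _)%E => [r _|h|//]; first by rewrite ltry.
by move: h; rewrite gt0_muley ?lte_fin ?exprn_gt0.
Qed.

Lemma Rintegral_rV_affine (f : 'rV[R]_n -> R) : lam.-integrable setT (EFin \o f) ->
  c ^+ n * \int[lam]_x f (a + c *: x) = \int[lam]_x f x.
Proof.
move=> fi; have fi' := integrable_rV_affine fi.
have mf : measurable_fun setT (EFin \o f) by exact: measurable_int fi.
apply: EFin_inj; rewrite EFinM /Rintegral !fineK; do ?exact: integrable_fin_num.
rewrite [in LHS]integralE [in RHS]integralE.
rewrite muleBr//; last first.
  by apply: fin_num_adde_defr; exact: (integrable_pos_fin_num _ fi').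
congr (_ - _)%E.
  have := ge0_integral_rV_affine a c0 (measurable_funepos mf) (fun=> funepos_ge0 _ _).
  by move=> <-; congr (_ * _)%E; apply: eq_integral => x _; rewrite !funeposE.
have := ge0_integral_rV_affine a c0 (measurable_funeneg mf) (fun=> funeneg_ge0 _ _).
by move=> <-; congr (_ * _)%E; apply: eq_integral => x _; rewrite !funenegE.
Qed.

End rV_affine_integrable.

(** * An integrable weight *)

Section cauchy_weight.
Context (R : realType).

Lemma integralT_oneDsqr :
  (\int[@lebesgue_measure R]_t (oneDsqr t)^-1%:E = pi%:E)%E.
Proof.
rewrite (@ge0_symfun_integralT R (fun t => (oneDsqr t)^-1)).
- rewrite (_ : [set x | _] = `[0, +oo[%classic); last first.
    by apply/seteqP; split => x/=; rewrite in_itv/= andbT.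
  by rewrite integral0y_oneDsqr -EFinM mulrCA divff// mulr1.
- by move=> x; rewrite invr_ge0.
- exact: continuous_oneDsqrV.
- by move=> x/=; rewrite /oneDsqr sqrrN.
Qed.

(** A product of one-dimensional weights, so that its integral is explicit in
    every dimension. Its inverse dominates 1 + |x|^2, hence a function below the
    square of the weight remains integrable after multiplication by |x|. *)
Definition cauchy_weight n (x : 'rV[R]_n) : R := \prod_(i < n) (oneDsqr (x ord0 i))^-1.

Lemma measurable_oneDsqrV : measurable_fun setT (fun t : R => (oneDsqr t)^-1).
Proof. by apply: continuous_measurable_fun; exact: continuous_oneDsqrV. Qed.

Lemma measurable_cauchy_weight n : measurable_fun setT (@cauchy_weight n).
Proof. exact: (measurable_rV_prod measurable_oneDsqrV). Qed.

Lemma cauchy_weight_gt0 n (x : 'rV[R]_n) : 0 < cauchy_weight x.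
Proof. by apply: prodr_gt0 => i _; rewrite invr_gt0. Qed.

Lemma integral_cauchy_weight n :
  (\int[lebesgue_rV R n]_x (cauchy_weight x)%:E = (pi ^+ n)%:E)%E.
Proof.
rewrite (ge0_integral_prod n (g := fun t => (oneDsqr t)^-1)); last 2 first.
- exact: measurable_oneDsqrV.
- by move=> x; rewrite invr_ge0.
by under eq_bigr do rewrite integralT_oneDsqr; rewrite prodEFin prodr_const card_ord.
Qed.

Lemma integrable_cauchy_weight n :
  (lebesgue_rV R n).-integrable setT (EFin \o @cauchy_weight n).
Proof.
apply/integrableP; split; first by apply/measurable_EFinP; exact: measurable_cauchy_weight.
rewrite (eq_integral (EFin \o @cauchy_weight n)); last first.
  by move=> x _ /=; rewrite ger0_norm// ltW// cauchy_weight_gt0.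
by rewrite integral_cauchy_weight ltry.
Qed.

End cauchy_weight.

(** * The volume of the unit ball *)

Section ball_volume.
Context (R : realType) (n : nat).
Local Notation lam := (lebesgue_rV R n).
Local Notation leb := (@lebesgue_measure R).

Lemma dot_ge0 (x : 'rV[R]_n) : 0 <= dot x x.
Proof. by apply: sumr_ge0 => i _; rewrite -expr2 sqr_ge0. Qed.

Lemma euclid_norm_ge0 (x : 'rV[R]_n) : 0 <= euclid_norm x.
Proof. exact: sqrtr_ge0. Qed.

Lemma euclid_normZ c (x : 'rV[R]_n) : 0 <= c -> euclid_norm (c *: x) = c * euclid_norm x.
Proof.
move=> c0; rewrite /euclid_norm (_ : dot _ _ = c ^+ 2 * dot x x).
  by rewrite sqrtrM ?sqr_ge0// sqrtr_sqr ger0_norm.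
by rewrite /dot mulr_sumr; apply: eq_bigr => i _; rewrite !mxE expr2; ring.
Qed.

Lemma measurable_dot : measurable_fun setT (fun z : 'rV[R]_n * 'rV[R]_n => dot z.1 z.2).
Proof.
apply: measurable_sum => i; apply: measurable_funM.
  by apply: (measurableT_comp (measurable_rV_coord i)).
by apply: (measurableT_comp (measurable_rV_coord i)).
Qed.

Lemma measurable_euclid_norm : measurable_fun setT (@euclid_norm R n).
Proof.
apply: measurableT_comp.
  by apply: continuous_measurable_fun; exact: sqrt_continuous.
apply: measurable_sum => i.
by apply: measurable_funM; exact: (measurable_rV_coord i).
Qed.

Definition euclid_ball (r : R) : set 'rV[R]_n := [set x | euclid_norm x < r].

Lemma measurable_euclid_ball r : measurable (euclid_ball r).
Proof.
rewrite (_ : euclid_ball r = @euclid_norm R n @^-1` `]-oo, r[).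
  by rewrite -[X in measurable X]setTI; apply: measurable_euclid_norm.
by apply/seteqP; split => x /=; rewrite in_itv.
Qed.

Lemma euclid_ball_scale r : 0 < r ->
  lam (euclid_ball r) = ((r ^+ n)%:E * lam (euclid_ball 1))%E.
Proof.
move=> r0.
have <- : (\int[lam]_x (\1_(euclid_ball r) x)%:E = lam (euclid_ball r))%E.
  by rewrite integral_indic ?setIT//; exact: measurable_euclid_ball.
rewrite -(ge0_integral_rV_affine 0 r0); last 2 first.
- by apply/measurable_EFinP; apply: measurable_indic; exact: measurable_euclid_ball.
- by move=> x; rewrite lee_fin indicE.
congr (_ * _)%E.
rewrite -[euclid_ball 1 in RHS]setIT -integral_indic//; last exact: measurable_euclid_ball.
apply: eq_integral => x _; rewrite add0r !indicE; congr (_%:R%:E); congr nat_of_bool.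
have rx : (euclid_norm (r *: x) < r) = (euclid_norm x < 1).
  by rewrite euclid_normZ ?(ltW r0)// gtr_pMr.
by apply/idP/idP; rewrite !inE /euclid_ball/= rx.
Qed.

(** Tonelli on the set of pairs (x, t) with |x| < rho t, whose slices at fixed t
    are balls. This evaluates integrals of radial functions without polar
    coordinates: w t = exp (- t) with rho t = sqrt t gives the Gaussian, and w t
    = 1 with rho t = t on ]0, r[ gives max(0, r - |x|). *)
Lemma layer_cake (D : set R) (mD : measurable D) (w rho : R -> R) :
  measurable_fun setT w -> measurable_fun setT rho ->
  (forall t, D t -> 0 <= w t) -> (forall t, D t -> 0 < rho t) ->
  (\int[lam]_x \int[leb]_(t in D `&` [set t | (euclid_norm x < rho t)%R]) (w t)%:E =
   (\int[leb]_(t in D) (w t * rho t ^+ n)%:E) * lam (euclid_ball 1))%E.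
Proof.
move=> mw mrho w0 rho0.
pose f (z : 'rV[R]_n * measurableTypeR R) : \bar R :=
  (w z.2 * \1_D z.2 * \1_[set z : 'rV[R]_n * measurableTypeR R | euclid_norm z.1 < rho z.2] z)%:E.
have mS : measurable [set z : 'rV[R]_n * measurableTypeR R | euclid_norm z.1 < rho z.2].
  have mlt : measurable_fun setT (fun z : 'rV[R]_n * measurableTypeR R => euclid_norm z.1 < rho z.2).
    apply: measurable_fun_ltr.
      by apply: (measurableT_comp measurable_euclid_norm).
    by apply: (measurableT_comp mrho).
  have := mlt measurableT [set true] I; rewrite setTI.
  by congr measurable; apply/seteqP; split => z /=.
have mf : measurable_fun setT f.
  apply/measurable_EFinP; apply: measurable_funM; last exact: measurable_indic.
  apply: measurable_funM; first by apply: (measurableT_comp mw).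
  by apply: (measurableT_comp (measurable_indic mD)).
have f0 z : (0 <= f z)%E.
  rewrite lee_fin /f !indicE; case: (boolP (z.2 \in D)) => [|_]; rewrite ?mulr0 ?mul0r// inE => Dz.
  by rewrite mulr1 mulr_ge0// w0.
transitivity (\int[lam]_x \int[leb]_t f (x, t))%E.
  apply: eq_integral => x _; rewrite integral_mkcond; apply: eq_integral => t _.
  rewrite patchE /f /= !indicE in_setI.
  have -> : (t \in [set t0 | (euclid_norm x < rho t0)%R]) = (euclid_norm x < rho t)%R.
    by apply/idP/idP; rewrite inE.
  have -> : ((x, t) \in [set z : 'rV[R]_n * measurableTypeR R | euclid_norm z.1 < rho z.2]) =
      (euclid_norm x < rho t)%R.
    by apply/idP/idP; rewrite inE.
  by case: (t \in D); case: (_ < _); rewrite /= ?mulr1 ?mulr0 ?mul0r.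
rewrite fubini_tonelli//.
rewrite -ge0_integralZr//; last 2 first.
- by apply/measurable_EFinP; apply: measurable_funTS; apply: measurable_funM => //; exact: measurable_funX.
- by move=> t Dt; rewrite lee_fin mulr_ge0 ?w0// exprn_ge0// ltW// rho0.
rewrite [RHS]integral_mkcond; apply: eq_integral => t _; rewrite patchE.
case: ifPn => Dt; last first.
  apply: integral0_eq => x _; by rewrite /f /= !indicE (negbTE Dt) mulr0 mul0r.
rewrite inE in Dt.
transitivity (\int[lam]_x ((w t)%:E * (\1_(euclid_ball (rho t)) x)%:E))%E.
  apply: eq_integral => x _; rewrite /f/= !indicE mem_set//= mulr1 -EFinM.
  by congr (_ * (nat_of_bool _)%:R)%:E; apply/idP/idP; rewrite !inE.
rewrite ge0_integralZl//; last 2 first.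
- by apply/measurable_EFinP; apply: measurable_indic; exact: measurable_euclid_ball.
- by rewrite lee_fin w0.
rewrite integral_indic ?setIT//; last exact: measurable_euclid_ball.
by apply: (etrans (congr1 (mule (w t)%:E) (euclid_ball_scale (rho0 _ Dt)))); rewrite muleA -EFinM.
Qed.

Lemma integral_expRN (a : R) :
  (\int[leb]_(t in `[a, +oo[) (expR (- t))%:E = (expR (- a))%:E)%E.
Proof.
rewrite (@ge0_continuous_FTC2y R (fun t => expR (- t)) (fun t => - expR (- t)) a 0).
- by rewrite EFinN oppeK add0e.
- by move=> x _; exact: expR_ge0.
- apply: continuous_subspaceT => x; apply: continuous_comp; first exact: opp_continuous.
  exact: continuous_expR.
- by rewrite -oppr0; apply: cvgN; exact: cvgr_expR.
- by move=> x _; exact: ex_derive.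
- apply: cvg_at_right_filter; apply: cvgN; apply: (continuous_comp (f := -%R)); first exact: opp_continuous.
  exact: continuous_expR.
- by move=> x _; rewrite derive1E derive_val mulrN mulr1 opprK.
Qed.

End ball_volume.

(** An infinite factor makes a product of non-negative extended reals equal to 0
    or to +oo. *)
Lemma mule_fin_num_factors (R : realType) (x y : \bar R) (c : R) :
  (0 <= x)%E -> (0 <= y)%E -> 0 < c -> (x * y = c%:E)%E ->
  x \is a fin_num /\ y \is a fin_num.
Proof.
move=> + + c0; case: x => [x| |]; case: y => [y| |] //=; rewrite ?lee_fin.
- rewrite le_eqVlt => /orP[/eqP <-|x0] _; last by rewrite gt0_muley// lte_fin.
  by rewrite mul0e => -[] c00; move: c0; rewrite -c00 ltxx.
- move=> _; rewrite le_eqVlt => /orP[/eqP <-|y0]; last by rewrite gt0_mulye// lte_fin.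
  by rewrite mule0 => -[] c00; move: c0; rewrite -c00 ltxx.
Qed.

Section ball_volume_gamma.
Context (R : realType) (n : nat).
Local Notation lam := (lebesgue_rV R n).
Local Notation leb := (@lebesgue_measure R).

(** The Gaussian is a product over the coordinates; integrating it by layers as
    well, in J_ball, yields the volume of the ball. *)
Lemma integral_gauss_rV :
  (\int[lam]_x (expR (- dot x x))%:E = (Num.sqrt pi ^+ n)%:E)%E.
Proof.
have mg : measurable_fun setT (@gauss_fun R).
  by apply: continuous_measurable_fun; exact: continuous_gauss_fun.
transitivity (\int[lam]_x (\prod_(i < n) gauss_fun (x ord0 i))%:E)%E.
  apply: eq_integral => x _; congr EFin; rewrite /dot -sumrN expR_sum.
  by apply: eq_bigr => i _; rewrite /gauss_fun expr2.
rewrite (ge0_integral_prod n mg); last by move=> x; exact: gauss_fun_ge0.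
by under eq_bigr do rewrite integralT_gauss; rewrite prodEFin prodr_const card_ord.
Qed.

Let J := (\int[leb]_(t in `]0%R, +oo[) (expR (- t) * Num.sqrt t ^+ n)%:E)%E.

Let J_ball : (J * lam (euclid_ball 1) = (Num.sqrt pi ^+ n)%:E)%E.
Proof.
rewrite -integral_gauss_rV /J.
have mexp : measurable_fun setT (fun t : R => expR (- t)).
  by apply: measurableT_comp => //.
have msqrt : measurable_fun setT (@Num.sqrt R).
  by apply: continuous_measurable_fun; exact: sqrt_continuous.
rewrite -[LHS](layer_cake _ _ mexp msqrt)//; last first.
  by move=> t /=; rewrite in_itv/= andbT sqrtr_gt0.
apply: eq_integral => x _.
rewrite (_ : _ `&` _ = `]dot x x, +oo[%classic); last first.
  apply/seteqP; split => t /=; rewrite !in_itv/= !andbT.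
    by move=> [t0]; rewrite /euclid_norm ltr_sqrt.
  by move=> xt; have t0 := le_lt_trans (dot_ge0 x) xt; rewrite /euclid_norm ltr_sqrt.
rewrite integral_itv_obnd_cbnd ?integral_expRN//.
by apply/measurable_EFinP; exact: measurable_funTS.
Qed.

Let J0 : (0 <= J)%E.
Proof.
by apply: integral_ge0 => t _; rewrite lee_fin mulr_ge0 ?expR_ge0// exprn_ge0// sqrtr_ge0.
Qed.

Let sqrt_pi_gt0 : 0 < Num.sqrt pi ^+ n :> R.
Proof. by rewrite exprn_gt0// sqrtr_gt0 pi_gt0. Qed.

Let J_fin : J \is a fin_num /\ lam (euclid_ball 1) \is a fin_num.
Proof. exact: (mule_fin_num_factors J0 (measure_ge0 _ _) sqrt_pi_gt0 J_ball). Qed.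

Definition ball_vol : R := fine (lam (euclid_ball 1)).

Lemma Gamma_ball_vol : Gamma (1 + n%:R / 2) * ball_vol = Num.sqrt pi ^+ n.
Proof.
have [Jf bf] := J_fin.
apply: EFin_inj; rewrite -J_ball EFinM /ball_vol (fineK bf); congr (_ * _)%E.
rewrite -[RHS](fineK Jf) /Gamma /Rintegral; congr (fine _)%:E.
apply: eq_integral => t; rewrite inE/= in_itv/= andbT => t0; congr EFin.
rewrite mulrC (_ : 1 + _ - 1 = 2^-1 * n%:R); last by field.
by rewrite powRrM powR12_sqrt ?(ltW t0)// powR_mulrn// sqrtr_ge0.
Qed.

Lemma ball_vol_gt0 : 0 < ball_vol.
Proof.
rewrite lt_neqAle fine_ge0// andbT; apply/eqP => b0.
by have := Gamma_ball_vol; rewrite -b0 mulr0 => /esym/eqP; rewrite gt_eqF.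
Qed.

(** The height max(0, r - |x|) is the length of the set of t in ]0, r[ with |x|
    < t. *)
Lemma integral_tent (r : R) : 0 < r ->
  (\int[lam]_x (Num.max 0 (r - euclid_norm x))%:E =
   (ball_vol * r ^+ n.+1 / n.+1%:R)%:E)%E.
Proof.
move=> r0.
have -> : (ball_vol * r ^+ n.+1 / n.+1%:R)%:E =
    ((\int[leb]_(t in `]0%R, r[) (1 * t ^+ n)%:E) * lam (euclid_ball 1))%E.
  rewrite -(fineK J_fin.2) -/ball_vol.
  rewrite (_ : (\int[_]_(t in _) _)%E = (r ^+ n.+1 / n.+1%:R)%:E); last first.
    have mX (A : set R) : measurable_fun A (fun t : R => (t ^+ n)%:E).
      by apply/measurable_EFinP; exact: exprn_measurable.
    transitivity (\int[leb]_(t in `[0%R, r]) (t ^+ n)%:E)%E.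
      rewrite [RHS]integral_itv_bndoo; last exact: mX.
      by apply: eq_integral => t _; rewrite mul1r.
    rewrite (@continuous_FTC2 _ (fun t => t ^+ n) (fun t => n.+1%:R^-1 * t ^+ n.+1) 0 r)//.
    - by rewrite expr0n mulr0 sube0 mulrC.
    - by apply: continuous_subspaceT => x; exact: exprn_continuous.
    - have cF : continuous (fun t : R => n.+1%:R^-1 * t ^+ n.+1).
        by move=> x; apply: cvgM; [exact: cvg_cst|exact: exprn_continuous].
      split.
      + by move=> x _; apply: derivableM; [exact: derivable_cst|exact: exprn_derivable].
      + by apply: cvg_at_right_filter; exact: cF.
      + by apply: cvg_at_left_filter; exact: cF.
    - move=> x _; rewrite derive1E deriveMl; last exact: exprn_derivable.
      by rewrite exp_derive /GRing.scale/= mulr1 mulrA mulVf ?mul1r// pnatr_eq0.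
  by rewrite -EFinM; congr EFin; field.
rewrite -(layer_cake _ _ (w := fun=> 1) (rho := id))//; last by move=> t /=; rewrite in_itv/= => /andP[].
apply: eq_integral => x _.
rewrite (_ : _ `&` _ = `]euclid_norm x, r[%classic); last first.
  apply/seteqP; split => t /=; rewrite !in_itv/=.
    by move=> [/andP[_ ->] ->].
  by move=> /andP[xt ->]; rewrite xt (le_lt_trans (euclid_norm_ge0 x) xt).
rewrite integral_cst//= mul1e lebesgue_measure_itv/= lte_fin -EFinB.
by case: ltP => xr; rewrite ?lt_def; congr EFin; rewrite /Order.max/=; case: ltP; lra.
Qed.

Lemma measurable_tent (r : R) :
  measurable_fun setT (fun x : 'rV[R]_n => Num.max 0 (r - euclid_norm x)).
Proof.
apply: measurable_maxr; first exact: measurable_cst.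
by apply: measurable_funB; [exact: measurable_cst|exact: measurable_euclid_norm].
Qed.

Lemma integrable_tent (r : R) : 0 < r ->
  lam.-integrable setT (EFin \o (fun x => Num.max 0 (r - euclid_norm x))).
Proof.
move=> r0; apply/integrableP; split; first by apply/measurable_EFinP; exact: measurable_tent.
under eq_integral do rewrite /= ger0_norm ?le_max ?lexx//.
by rewrite integral_tent// ltry.
Qed.

Lemma Rintegral_tent (r : R) : 0 < r ->
  \int[lam]_x Num.max 0 (r - euclid_norm x) = ball_vol * r ^+ n.+1 / n.+1%:R.
Proof. by move=> r0; rewrite /Rintegral integral_tent. Qed.

End ball_volume_gamma.

(** * The transform of a product of exponentials *)

Section poisson_line.
Context (R : realType) (e : R) (e0 : 0 < e).
Local Notation leb := (@lebesgue_measure R).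

(* The factor 1 + cos, and not cos alone, keeps the integrand non-negative: the
   fundamental theorem of calculus on a half-line and Tonelli's theorem then
   apply with no prior integrability. *)
Let half a z : (\int[leb]_(t in `[0%R, +oo[) (expR (- (e * t)) * (1 + cos (a + t * z)))%:E =
  (e^-1 + (e * cos a - z * sin a) / (e ^+ 2 + z ^+ 2))%:E)%E.
Proof.
have ez0 : e ^+ 2 + z ^+ 2 != 0.
  by rewrite gt_eqF// ltr_wpDr ?sqr_ge0// exprn_gt0.
have e_neq0 : e != 0 by rewrite gt_eqF.
pose F (t : R) := expR (- (e * t)) *
  (- e^-1 + (z * sin (a + t * z) - e * cos (a + t * z)) / (e ^+ 2 + z ^+ 2)).
have dF (x : R) : is_derive x (1 : R) F (expR (- (e * x)) * (1 + cos (a + x * z))).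
  have d1 : is_derive x (1 : R) (fun t : R => - (e * t)) (- e).
    by apply: is_derive_eq; rewrite /GRing.scale/= mulr1.
  have d2 : is_derive x (1 : R) (fun t : R => a + t * z) z.
    by apply: is_derive_eq; rewrite /GRing.scale/=; ring.
  have d3 : is_derive x (1 : R) (fun t : R => expR (- (e * t))) (- e * expR (- (e * x))).
    apply: is_derive_eq; rewrite /GRing.scale/=; ring.
  have d4 : is_derive x (1 : R) (fun t : R => sin (a + t * z)) (z * cos (a + x * z)).
    apply: is_derive_eq; rewrite /GRing.scale/=; ring.
  have d5 : is_derive x (1 : R) (fun t : R => cos (a + t * z)) (- z * sin (a + x * z)).
    apply: is_derive_eq; rewrite /GRing.scale/=; ring.
  rewrite /F; apply: is_derive_eq; rewrite /GRing.scale/=.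
  field. by rewrite ez0 e_neq0.
have cF : continuous F.
  move=> x; apply: differentiable_continuous; apply/derivable1_diffP.
  exact: (@ex_derive _ _ _ _ _ _ _ (dF x)).
rewrite (@ge0_continuous_FTC2y R (fun t => expR (- (e * t)) * (1 + cos (a + t * z))) F 0 0).
- rewrite sub0e /F !mulr0 !mul0r oppr0 expR0 addr0 mul1r -EFinN; congr EFin.
  by field; rewrite ez0.
- move=> x _; rewrite mulr_ge0 ?expR_ge0//; have := cos_geN1 (a + x * z); lra.
- apply: continuous_subspaceT => x; apply: cvgM.
    apply: continuous_comp; last exact: continuous_expR.
    by apply: cvgN; apply: cvgM => //; exact: cvg_cst.
  apply: cvgD; first exact: cvg_cst.
  apply: continuous_comp; last exact: continuous_cos.
  by apply: cvgD; [exact: cvg_cst|apply: cvgM => //; exact: cvg_cst].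
- have ex : expR (- (e * t)) @[t --> +oo] --> (0 : R).
    have et : e * t @[t --> +oo] --> +oo by apply: (gt0_cvgMry e0); exact: cvg_id.
    exact: (cvg_comp _ _ et (@cvgr_expR R)).
  pose K := e^-1 + (`|z| + e) / (e ^+ 2 + z ^+ 2).
  apply: (@squeeze_cvgr _ _ _ _ (fun t => - (expR (- (e * t)) * K)) (fun t => expR (- (e * t)) * K)).
  + near=> t; rewrite -ler_norml /F normrM ger0_norm ?expR_ge0// ler_wpM2l ?expR_ge0//.
    apply: le_trans (ler_normD _ _) _; rewrite normrN ger0_norm ?invr_ge0 ?(ltW e0)//.
    rewrite lerD2l normrM [X in _ * X]ger0_norm ?invr_ge0 ?addr_ge0 ?sqr_ge0//.
    rewrite ler_wpM2r ?invr_ge0 ?addr_ge0 ?sqr_ge0//.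
    apply: le_trans (ler_normB _ _) _; rewrite !normrM (ger0_norm (ltW e0)).
    apply: lerD.
      by rewrite ler_piMr// ler_norml sin_geN1 sin_le1.
    by rewrite ler_piMr ?(ltW e0)// ler_norml cos_geN1 cos_le1.
  + by rewrite -[X in _ --> X]oppr0 -(mul0r K); apply: cvgN; apply: cvgM => //; exact: cvg_cst.
  + by rewrite -(mul0r K); apply: cvgM => //; exact: cvg_cst.
- by move=> x _; exact: (@ex_derive _ _ _ _ _ _ _ (dF x)).
- by apply: cvg_at_right_filter; exact: cF.
- by move=> x _; rewrite derive1E; exact: (@derive_val _ _ _ _ _ _ _ (dF x)).
Unshelve. all: by end_near. Qed.

Definition exp_weight (t : R) : R := expR (- (e * `|t|)).
(** The Fourier transform of exp_weight, up to normalisation. *)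
Definition poisson (z : R) : R := 2 * e / (e ^+ 2 + z ^+ 2).

Lemma exp_weight_ge0 t : 0 <= exp_weight t. Proof. exact: expR_ge0. Qed.

Lemma exp_weight_le1 t : exp_weight t <= 1.
Proof. by rewrite /exp_weight expR_le1 oppr_le0 mulr_ge0// ltW. Qed.

Lemma continuous_exp_weight : continuous exp_weight.
Proof.
move=> x; apply: continuous_comp; last exact: continuous_expR.
by apply: cvgN; apply: cvgM; [exact: cvg_cst|exact: norm_continuous].
Qed.

Lemma integral_exp_weight_cos a z :
  (\int[leb]_t (exp_weight t * (1 + cos (a + t * z)))%:E =
   (2 / e + cos a * poisson z)%:E)%E.
Proof.
have ez0 : e ^+ 2 + z ^+ 2 != 0.
  by rewrite gt_eqF// ltr_wpDr ?sqr_ge0// exprn_gt0.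
pose f t := exp_weight t * (1 + cos (a + t * z)).
have f0 t : 0 <= f t.
  rewrite /f mulr_ge0 ?exp_weight_ge0//; have := cos_geN1 (a + t * z); lra.
have cf : continuous f.
  move=> x; apply: cvgM; first exact: continuous_exp_weight.
  apply: cvgD; first exact: cvg_cst.
  apply: continuous_comp; last exact: continuous_cos.
  by apply: cvgD; [exact: cvg_cst|apply: cvgM => //; exact: cvg_cst].
have mf (A : set R) : measurable_fun A (EFin \o f).
  by apply/measurable_EFinP; apply: measurable_funTS; exact: continuous_measurable_fun.
have -> : [set: measurableTypeR R] = `]-oo, 0%R[ `|` `[0%R, +oo[.
  by rewrite -setCitvr setUC setUv.
rewrite ge0_integral_setU//=; last 3 first.
- exact: mf.
- by move=> x _; rewrite lee_fin; exact: f0.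
- apply/disj_setPS => t [] /=; rewrite !in_itv/= andbT => t0.
  by rewrite leNgt t0.
rewrite integral_itv_bndo_bndc; last exact: mf.
rewrite -{1}(@oppr0 R) ge0_integration_by_substitutionNy//; last 2 first.
- exact: continuous_subspaceT.
- by move=> x _; exact: f0.
transitivity ((\int[leb]_(t in `[0%R, +oo[) (expR (- (e * t)) * (1 + cos (a + t * (- z))))%:E) +
  \int[leb]_(t in `[0%R, +oo[) (expR (- (e * t)) * (1 + cos (a + t * z)))%:E)%E.
  congr (_ + _)%E; apply: eq_integral => t; rewrite inE/= in_itv/= andbT => t0.
    by rewrite /exp_weight normrN ger0_norm// mulNr mulrN.
  by rewrite /exp_weight ger0_norm.
rewrite !half -EFinD sqrrN /poisson; congr EFin.
by field; rewrite ez0 gt_eqF.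
Qed.

End poisson_line.

Section poisson_rV.
Context (R : realType) (e : R) (e0 : 0 < e).
Local Notation leb := (@lebesgue_measure R).
Local Notation lam := (lebesgue_rV R).

(** The damping exp(- e (|xi_1| + ... + |xi_d|)), rather than exp(- e |xi|): its
    transform is a product of one-dimensional Poisson kernels. *)
Definition exp_weight_rV n (xi : 'rV[R]_n) : R := \prod_(i < n) exp_weight e (xi ord0 i).
Definition poisson_rV n (z : 'rV[R]_n) : R := \prod_(i < n) poisson e (z ord0 i).

Lemma measurable_exp_weight_rV n : measurable_fun setT (@exp_weight_rV n).
Proof.
apply: measurable_rV_prod; apply: continuous_measurable_fun.
exact: continuous_exp_weight.
Qed.

Lemma exp_weight_rV_ge0 n (xi : 'rV[R]_n) : 0 <= exp_weight_rV xi.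
Proof. by apply: prodr_ge0 => i _; exact: exp_weight_ge0. Qed.

Lemma exp_weight_rV_le1 n (xi : 'rV[R]_n) : exp_weight_rV xi <= 1.
Proof.
by apply: prodr_ile1 => i _; rewrite exp_weight_ge0 exp_weight_le1.
Qed.

Lemma poisson_ge0 z : 0 <= poisson e z.
Proof. by rewrite /poisson divr_ge0 ?addr_ge0 ?sqr_ge0// mulr_ge0// ltW. Qed.

Lemma poisson_le z : poisson e z <= 2 / e.
Proof.
rewrite /poisson ler_pdivrMr ?ltr_wpDr ?sqr_ge0 ?exprn_gt0//.
rewrite (_ : 2 / e * (e ^+ 2 + z ^+ 2) = 2 * e + 2 / e * z ^+ 2); last by field; rewrite gt_eqF.
by rewrite lerDl mulr_ge0 ?sqr_ge0// divr_ge0// ltW.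
Qed.

Lemma measurable_dotr n (z : 'rV[R]_n) : measurable_fun setT (fun xi : 'rV[R]_n => dot xi z).
Proof.
by apply: measurable_sum => i; apply: measurable_funM => //; exact: (measurable_rV_coord i).
Qed.

Lemma measurable_cos : measurable_fun setT (@cos R).
Proof. by apply: continuous_measurable_fun; exact: continuous_cos. Qed.

Lemma measurable_sin : measurable_fun setT (@sin R).
Proof. by apply: continuous_measurable_fun; exact: continuous_sin. Qed.

Let mcos n a (z : 'rV[R]_n) : measurable_fun setT (fun xi : 'rV[R]_n => cos (a + dot xi z)).
Proof.
apply: (measurableT_comp measurable_cos); apply: measurable_funD; first exact: measurable_cst.
exact: measurable_dotr.
Qed.

Lemma dot_cons n t (v : 'rV[R]_n) s (w : 'rV[R]_n) :
  dot (cons_rV (t, v)) (cons_rV (s, w)) = (t : R) * (s : R) + dot v w.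
Proof.
rewrite /dot big_ord_recl !cons_rV0; congr (_ + _).
by apply: eq_bigr => i _; rewrite !cons_rVS.
Qed.

Lemma integral_exp_weight_rV_cos n a (z : 'rV[R]_n) :
  (\int[lam n]_xi (exp_weight_rV xi * (1 + cos (a + dot xi z)))%:E =
   ((2 / e) ^+ n + cos a * poisson_rV z)%:E)%E.
Proof.
have m1cos m b (w : 'rV[R]_m) : measurable_fun setT
    (fun xi : 'rV[R]_m => exp_weight_rV xi * (1 + cos (b + dot xi w))).
  apply: measurable_funM; first exact: measurable_exp_weight_rV.
  by apply: measurable_funD => //; exact: mcos.
have ge0 m b (w xi : 'rV[R]_m) : 0 <= exp_weight_rV xi * (1 + cos (b + dot xi w)).
  by rewrite mulr_ge0 ?exp_weight_rV_ge0//; have := cos_geN1 (b + dot xi w); lra.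
elim: n a z => [|n ih] a z.
  rewrite integral_dirac //=; last by apply/measurable_EFinP; exact: (m1cos 0%N).
  rewrite diracT mul1e /exp_weight_rV /poisson_rV /dot !big_ord0 expr0.
  by rewrite mul1r addr0 mulr1.
rewrite ge0_integral_rVS; last 2 first.
- by apply/measurable_EFinP; exact: m1cos.
- by move=> x; rewrite lee_fin.
case: (uncons_rV z) (uncons_rVK z) => s w <- {z}.
have P_le : poisson_rV w <= (2 / e) ^+ n.
  rewrite /poisson_rV -[X in (2 / e) ^+ X]card_ord -prodr_const.
  by apply: ler_prod => i _; rewrite poisson_ge0 poisson_le.
have P_ge0 : 0 <= poisson_rV w by apply: prodr_ge0 => i _; exact: poisson_ge0.
(* The inner integral is (2 / e) ^+ n + cos (a + t s) P with P := poisson_rV w. It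
   is split as ((2 / e) ^+ n - P) + P (1 + cos (a + t s)), where both terms are
   non-negative as P <= (2 / e) ^+ n; the phase pi / 2 at frequency 0 writes the
   constant 1 in the form that the one-dimensional formula covers. *)
transitivity (\int[leb]_t
   ((((2 / e) ^+ n - poisson_rV w) * (exp_weight e t * (1 + cos (pi / 2 + t * 0))))%:E +
    (poisson_rV w * (exp_weight e t * (1 + cos (a + t * (s : R)))))%:E))%E.
  apply: eq_integral => t _.
  under eq_integral => v _.
    rewrite dot_cons addrA.
    rewrite (_ : exp_weight_rV (cons_rV (t, v)) = exp_weight e t * exp_weight_rV v); last first.
      rewrite /exp_weight_rV big_ord_recl cons_rV0; congr (_ * _).
      by apply: eq_bigr => i _; rewrite cons_rVS.
    rewrite -mulrA EFinM.
    over.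
  rewrite ge0_integralZl//; last 3 first.
  - by apply/measurable_EFinP; exact: m1cos.
  - by move=> v _; rewrite lee_fin; exact: ge0.
  - by rewrite lee_fin exp_weight_ge0.
  rewrite ih -EFinM -EFinD mulr0 addr0 cos_pihalf; congr EFin; ring.
have mexpcos b u : measurable_fun setT (fun t => exp_weight e t * (1 + cos (b + t * u))).
  apply: measurable_funM.
    apply: continuous_measurable_fun; exact: continuous_exp_weight.
  apply: measurable_funD => //; apply: (measurableT_comp measurable_cos).
  by apply: measurable_funD => //; exact: measurable_funM.
have expcos_ge0 b t : 0 <= exp_weight e t * (1 + cos b).
  by rewrite mulr_ge0 ?exp_weight_ge0//; have := cos_geN1 b; lra.
rewrite ge0_integralD//; last 4 first.
- by move=> t _; rewrite lee_fin mulr_ge0// subr_ge0.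
- by apply/measurable_EFinP; apply: measurable_funM => //; exact: mexpcos.
- by move=> t _; rewrite lee_fin mulr_ge0.
- by apply/measurable_EFinP; apply: measurable_funM => //; exact: mexpcos.
under eq_integral do rewrite EFinM.
rewrite ge0_integralZl//; last 3 first.
- by apply/measurable_EFinP; exact: mexpcos.
- by move=> t _; rewrite lee_fin.
- by rewrite lee_fin subr_ge0.
under [X in (_ + X)%E]eq_integral do rewrite EFinM.
rewrite ge0_integralZl//; last 2 first.
- by apply/measurable_EFinP; exact: mexpcos.
- by move=> t _; rewrite lee_fin.
rewrite !integral_exp_weight_cos// cos_pihalf mul0r addr0 -!EFinM -EFinD.
rewrite {3}/poisson_rV big_ord_recl cons_rV0.
rewrite (eq_bigr (fun i => poisson e (w ord0 i))); last by move=> i _; rewrite cons_rVS.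
by rewrite -/(poisson_rV w) exprS; congr EFin; ring.
Qed.

End poisson_rV.

(** * Smooth functions that vanish outside a ball *)

Section real_dominated_convergence.
Context (R : realType) d (T : measurableType d) (mu : {measure set T -> \bar R}).

Lemma Rdominated_cvg (f_ : nat -> T -> R) (f g : T -> R) :
  (forall n, measurable_fun setT (f_ n)) ->
  (forall x, f_ n x @[n --> \oo] --> f x) ->
  mu.-integrable setT (EFin \o g) -> (forall n x, `|f_ n x| <= g x) ->
  (\int[mu]_x f_ n x) @[n --> \oo] --> \int[mu]_x f x.
Proof.
move=> mf_ f_f ig fg.
have mf : measurable_fun setT f by apply: (measurable_fun_cvg mf_) => x _; exact: f_f.
have fgx x : `|f x| <= g x.
  have /cvg_lim <- // : `|f_ n x| @[n --> \oo] --> `|f x| by exact: cvg_norm.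
  apply: limr_le; first by apply: is_cvg_norm; apply: cvgP (f_f x).
  by apply: nearW => n; exact: fg.
have intf : mu.-integrable setT (EFin \o f) by apply: le_Rintegrable ig.
have := @dominated_cvg _ T R mu setT measurableT (fun n => EFin \o f_ n) (EFin \o f) (EFin \o g).
have -> : (\int[mu]_x (EFin \o f) x)%E = (\int[mu]_x f x)%:E.
  by rewrite /Rintegral fineK//; exact: integrable_fin_num.
move=> h; apply: fine_cvg; apply: h => //.
- by move=> n; exact/measurable_EFinP.
- by move=> x _ /=; apply: cvg_EFin; [exact: nearW|exact: f_f].
- by move=> n x _ /=; rewrite lee_fin.
Qed.

End real_dominated_convergence.

Section real_test_functions.
Context (R : realType) (d : nat).
Local Notation V := 'rV[R]_d.
Local Notation lam := (lebesgue_rV R d).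
Implicit Types g h : V -> R.

(** Compact support enters the Fourier transform as vanishing outside a ball, a
    condition that partial derivatives visibly preserve. *)
Definition real_test g : Prop :=
  smooth g /\ exists M : R, forall x, M < `|x| -> g x = 0.

Lemma real_test_continuous g : real_test g -> continuous g.
Proof. by move=> [/(_ [::])[]]. Qed.

Lemma smooth_lin (a b : R) g h : smooth g -> smooth h ->
  smooth (fun x => a * g x + b * h x).
Proof.
move=> sg sh.
have E s : foldr (@partial R d) (fun x => a * g x + b * h x) s =
    (fun x => a * foldr (@partial R d) g s x + b * foldr (@partial R d) h s x).
  elim: s => //= i s ->; apply/funext => x.
  have [_ /(_ i x) dg] := sg s; have [_ /(_ i x) dh] := sh s.
  rewrite /partial (@deriveD _ _ _ (fun x => a * foldr (@partial R d) g s x) (fun x => b * foldr (@partial R d) h s x)).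
  - by rewrite !deriveMl.
  - by apply: (@derivableM _ _ (fun=> a)); [exact: derivable_cst|exact: dg].
  - by apply: (@derivableM _ _ (fun=> b)); [exact: derivable_cst|exact: dh].
move=> s; have [cg dg] := sg s; have [ch dh] := sh s; rewrite E; split.
  move=> x.
  exact: (cvgD (cvgM (@cvg_cst _ a _ _ _) (cg x)) (cvgM (@cvg_cst _ b _ _ _) (ch x))).
move=> i x; apply: (@derivableD _ _ _ (fun x => a * foldr (@partial R d) g s x) (fun x => b * foldr (@partial R d) h s x)).
- by apply: (@derivableM _ _ (fun=> a)); [exact: derivable_cst|exact: dg].
- by apply: (@derivableM _ _ (fun=> b)); [exact: derivable_cst|exact: dh].
Qed.

Lemma smooth_partial i g : smooth g -> smooth (partial i g).
Proof. by move=> sg s; have := sg (rcons s i); rewrite foldr_rcons. Qed.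

Lemma real_test_partial i g : real_test g -> real_test (partial i g).
Proof.
move=> [sg [M gM]]; split; first exact: smooth_partial.
exists M => x Mx.
have : {near x, g =1 cst 0}.
  have : \forall y \near x, M < `|y|.
    have := @norm_continuous _ _ x; move/cvgrPdist_lt => /(_ (`|x| - M)).
    rewrite subr_gt0 => /(_ Mx); apply: filterS => y.
    by move=> /ltr_normlW; lra.
  by apply: filterS => y /gM.
by move=> /near_eq_derive; rewrite /partial => ->; rewrite derive_cst.
Qed.

Lemma real_test_bounded g : real_test g -> exists C, forall x, `|g x| <= C.
Proof.
move=> rg; have cg := real_test_continuous rg; case: rg => _ [M gM].
pose B : set V := [set x | `|x| <= M].
have cB : compact B.
  apply: bounded_closed_compact.
    by exists M; split; [exact: num_real|move=> N MN x /= xM; exact: le_trans xM (ltW MN)].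
  apply: (@closed_comp _ _ (fun x : V => `|x|) [set y | y <= M]); last exact: closed_le.
  by move=> x _; exact: norm_continuous.
have : compact (g @` B).
  by apply: continuous_compact => //; exact: continuous_subspaceT.
move=> /compact_bounded[C [_ bC]].
exists (`|C| + 1) => x; have [xM|Mx] := leP `|x| M.
  by apply: bC; [rewrite ltr_pwDr// ler_norm|exists x].
by rewrite gM// normr0 addr_ge0.
Qed.

Lemma integrable_norm_le (M : R) :
  lam.-integrable setT (EFin \o (\1_[set x : V | `|x| <= M] : V -> R)).
Proof.
have mB : measurable [set x : V | `|x| <= M].
  rewrite -(setCK [set x : V | `|x| <= M]); apply: measurableC; apply: open_measurable_rV.
  rewrite openC; apply: (@closed_comp _ _ (fun x : V => `|x|) [set y | y <= M]); last exact: closed_le.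
  by move=> x _; exact: norm_continuous.
apply/integrableP; split; first by apply/measurable_EFinP; exact: measurable_indic.
rewrite (eq_integral (fun x => (\1_[set x : V | `|x| <= M] x)%:E)); last first.
  by move=> x _ /=; rewrite ger0_norm// indicE.
rewrite integral_indic// setIT; apply: bounded_measurable_lty => //.
by exists M; split; [exact: num_real|move=> N MN x /= xM; exact: le_trans xM (ltW MN)].
Qed.

Lemma bounded_support_integrable (f : V -> R) (C M : R) : measurable_fun setT f ->
  (forall x, `|f x| <= C) -> (forall x, M < `|x| -> f x = 0) ->
  lam.-integrable setT (EFin \o f).
Proof.
move=> mf fC fM.
apply: (@le_Rintegrable _ _ _ _ _ measurableT _ (fun x => C * \1_[set x : V | `|x| <= M] x)) => //.
  move=> x _; rewrite indicE; have [xM|Mx] := leP `|x| M.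
    by rewrite mem_set// mulr1.
  by rewrite fM// memNset ?mulr0 ?normr0//= leNgt Mx.
by apply: RintegrableZl => //; exact: integrable_norm_le.
Qed.

Lemma real_test_integrable g : real_test g -> lam.-integrable setT (EFin \o g).
Proof.
move=> rg; have [C gC] := real_test_bounded rg.
have cg := real_test_continuous rg; case: rg => _ [M gM].
by apply: (bounded_support_integrable (C := C) (M := M)) => //; exact: continuous_measurable_rV.
Qed.

Lemma is_derive_line g (x v : V) (t : R) : derivable g (x + t *: v) v ->
  is_derive t (1 : R) (fun s => g (x + s *: v)) ('D_v g (x + t *: v)).
Proof.
rewrite /derivable /derive => dg.
have E : (fun h : R => h^-1 *: (((fun s : R => g (x + s *: v)) \o shift t) (h *: (1 : R)) -
    (fun s => g (x + s *: v)) t)) =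
  (fun h : R => h^-1 *: ((g \o shift (x + t *: v)) (h *: v) - g (x + t *: v))).
  apply/funext => h /=; congr (_ *: (g _ - _)).
  by rewrite -[h *: (1 : R)]/(h * 1) mulr1 scalerDl addrCA.
by split; rewrite /derivable /derive E.
Qed.

(** The mean value theorem along the axis; the bound dominates the difference
    quotients when a derivative is taken under the integral. *)
Lemma real_test_increment g i : real_test g -> exists C, forall x (h : R), 0 < h ->
  `|g (x + h *: delta_mx ord0 i) - g x| <= C * h.
Proof.
move=> rg; have [C gC] := real_test_bounded (real_test_partial i rg).
have [/(_ [::])[_ /= /(_ i) dg] _] := rg.
exists C => x h h0; pose v : V := delta_mx ord0 i.
pose f s := g (x + s *: v).
have df s : is_derive s (1 : R) f (partial i g (x + s *: v)).
  exact: is_derive_line.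
have cf : continuous f.
  move=> s; apply: differentiable_continuous; apply/derivable1_diffP.
  exact: (@ex_derive _ _ _ _ _ _ _ (df s)).
have [c _] := MVT h0 (fun s _ => df s) (continuous_subspaceT cf).
rewrite /f scale0r addr0 subr0 => ->.
by rewrite normrM (ger0_norm (ltW h0)) ler_wpM2r// ltW.
Qed.

End real_test_functions.

(** * Decay of the cosine transform *)

Section cos_transform.
Context (R : realType) (d : nat).
Local Notation V := 'rV[R]_d.
Local Notation lam := (lebesgue_rV R d).
Implicit Types g h : V -> R.

Lemma cos_lipschitz (x y : R) : `|cos x - cos y| <= `|x - y|.
Proof.
wlog xy : x y / y <= x => [hw|].
  by have [|/ltW] := leP y x; first exact: hw; rewrite distrC (distrC x); exact: hw.
have [c _ ->] := MVT_segment xy (fun c _ => is_derive_cos c) (continuous_subspaceT (@continuous_cos R)).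
by rewrite normrM ler_piMl// normrN ler_norml sin_geN1 sin_le1.
Qed.

Lemma difference_quotient_cvg (f : R -> R) (x df : R) : is_derive x (1 : R) f df ->
  (harmonic n)^-1 * (f (x + harmonic n) - f x) @[n --> \oo] --> df.
Proof.
move=> [dfx <-]; have h0 : @harmonic R @ \oo --> (0 : R)^'.
  move=> P /= P0.
  apply: (@filterS _ \oo _ (harmonic @^-1` [set x : R | x != 0 -> P x])); last exact: cvg_harmonic P0.
  by move=> n /=; apply; rewrite invr_eq0 pnatr_eq0.
have := cvg_comp _ _ h0 dfx; apply: cvg_trans; apply: near_eq_cvg; near=> n.
by rewrite /= /GRing.scale/= mulr1 [n.+1%:R^-1 + x]addrC.
Unshelve. all: by end_near. Qed.

(** The phase a lets a single family of real integrals contain both the cosine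
    and the sine transform: differentiation of g shifts the phase by a quarter
    turn. *)
Definition cos_transform (a : R) g (xi : V) : R :=
  \int[lam]_x (cos (a + dot xi x) * g x).

Lemma dotD (xi x y : V) : dot xi (x + y) = dot xi x + dot xi y.
Proof. by rewrite /dot -big_split; apply: eq_bigr => i _; rewrite mxE mulrDr. Qed.

Lemma dotZ (xi x : V) c : dot xi (c *: x) = c * dot xi x.
Proof. by rewrite /dot mulr_sumr; apply: eq_bigr => i _; rewrite mxE; ring. Qed.

Lemma dot_delta (xi : V) j : dot xi (delta_mx ord0 j) = xi ord0 j.
Proof.
rewrite /dot (bigD1 j)//= big1 => [|i ij]; first by rewrite mxE !eqxx mulr1 addr0.
by rewrite mxE (negbTE ij) andbF mulr0.
Qed.

Lemma dotC (x y : V) : dot x y = dot y x.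
Proof. by rewrite /dot; apply: eq_bigr => i _; rewrite mulrC. Qed.

Lemma measurable_dotl (xi : V) : measurable_fun setT (dot xi).
Proof.
have -> : dot xi = (fun x => dot x xi) by apply/funext => x; rewrite dotC.
exact: measurable_dotr.
Qed.

Lemma measurable_cos_dot a (xi : V) : measurable_fun setT (fun x : V => cos (a + dot xi x)).
Proof.
apply: (measurableT_comp (@measurable_cos R)); apply: measurable_funD => //.
exact: measurable_dotl.
Qed.

Lemma norm_cos_le1 (x : R) : `|cos x| <= 1.
Proof. by rewrite ler_norml cos_geN1 cos_le1. Qed.

Lemma integrable_cosM a (xi : V) (f : V -> R) : lam.-integrable setT (EFin \o f) ->
  lam.-integrable setT (EFin \o (fun x => cos (a + dot xi x) * f x)).
Proof.
move=> fi; apply: (@le_Rintegrable _ _ _ _ _ measurableT _ (fun x => `|f x|)).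
- apply: measurable_funM; first exact: measurable_cos_dot.
  by apply/measurable_EFinP; exact: measurable_int fi.
- by move=> x _; rewrite normrM ler_piMl// norm_cos_le1.
- exact: integrable_norm.
Qed.

(** Integration by parts, in discrete form: the substitution x + h e_j moves the
    difference quotient from g (the integrals A) to the cosine (the integrals
    B), and dominated convergence passes to the limit on both sides. *)
Lemma cos_transform_partial a g j (xi : V) : real_test g ->
  cos_transform a (partial j g) xi = xi ord0 j * cos_transform (a - pi / 2) g xi.
Proof.
move=> rg; pose v : V := delta_mx ord0 j.
have ig := real_test_integrable rg.
have mg : measurable_fun setT g by apply: continuous_measurable_rV; exact: real_test_continuous.
pose h n : R := @harmonic R n.
have h0 n : 0 < h n by rewrite /h /= invr_gt0.
have h1 n : h n <= 1 by rewrite /h /= invf_le1// ler1n.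
pose A n x := cos (a + dot xi x) * ((h n)^-1 * (g (x + h n *: v) - g x)).
pose B n x := ((h n)^-1 * (cos (a + dot xi x - h n * xi ord0 j) - cos (a + dot xi x))) * g x.
have igv n : lam.-integrable setT (EFin \o (fun x => g (x + h n *: v))).
  have := integrable_rV_affine (h n *: v) ltr01 ig.
  by apply: eq_integrable => // x _ /=; rewrite scale1r addrC.
have AB n : \int[lam]_x A n x = \int[lam]_x B n x.
  transitivity ((h n)^-1 * (\int[lam]_x (cos (a + dot xi x) * g (x + h n *: v)) -
      \int[lam]_x (cos (a + dot xi x) * g x))).
    rewrite -RintegralB//; do ?exact: integrable_cosM.
    rewrite -RintegralZl//; last by apply: RintegrableB => //; exact: integrable_cosM.
    by apply: eq_Rintegral => x _; rewrite /A; ring.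
  pose F x := cos (a - h n * xi ord0 j + dot xi x) * g x.
  have -> : \int[lam]_x (cos (a + dot xi x) * g (x + h n *: v)) = \int[lam]_x F x.
    have iF : lam.-integrable setT (EFin \o F) by exact: integrable_cosM.
    rewrite -(Rintegral_rV_affine (h n *: v) ltr01 iF) expr1n mul1r.
    apply: eq_Rintegral => x _; rewrite /F scale1r dotD dotZ dot_delta.
    by rewrite [h n *: v + x]addrC; congr (cos _ * _); ring.
  rewrite -RintegralB//; do ?exact: integrable_cosM.
  rewrite -RintegralZl//; last by apply: RintegrableB => //; exact: integrable_cosM.
  apply: eq_Rintegral => x _; rewrite /B /F mulrBr [a - _ + _]addrAC; ring.
have cA : (\int[lam]_x A n x) @[n --> \oo] --> cos_transform a (partial j g) xi.
  have [C gC] := real_test_increment j rg.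
  have [M gM] := rg.2.
  apply: (@Rdominated_cvg _ _ _ _ _ _ (fun x => C * \1_[set x : V | `|x| <= M + 1] x)).
  - move=> n; apply: measurable_funM; first exact: measurable_cos_dot.
    apply: measurable_funM => //; apply: measurable_funB => //.
    by apply/measurable_EFinP; exact: measurable_int (igv n).
  - move=> x; apply: cvgM; first exact: cvg_cst.
    have [/(_ [::])[_ /= /(_ j) dg] _] := rg.
    have := difference_quotient_cvg (@is_derive_line R d g x v 0 (dg _)).
    by rewrite scale0r addr0; under eq_fun do rewrite add0r.
  - by apply: RintegrableZl => //; exact: integrable_norm_le.
  - move=> n x; have C0 : 0 <= C.
      have := gC 0 1 ltr01; rewrite mulr1; exact: le_trans.
    rewrite /A normrM; apply: (@le_trans _ _ (1 * `|(h n)^-1 * (g (x + h n *: v) - g x)|)).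
      by rewrite ler_wpM2r// norm_cos_le1.
    rewrite mul1r indicE; have [xM|xM] := leP `|x| (M + 1).
      rewrite mem_set//= mulr1 normrM ger0_norm ?invr_ge0 ?(ltW (h0 n))//.
      by rewrite ler_pdivrMl// mulrC; exact: gC.
    have Mx : M < `|x| by apply: lt_trans xM; rewrite ltrDl.
    have Mxv : M < `|x + h n *: v|.
      have : `|h n *: v| <= 1.
        rewrite normrZ ger0_norm ?(ltW (h0 n))//; apply: (le_trans _ (h1 n)).
        rewrite ler_piMr ?(ltW (h0 n))// /Num.norm/= mx_normrE.
        apply: bigmax_le => // i _; rewrite mxE; case: (_ && _) => /=; by rewrite ?normr1 ?normr0.
      have := ler_normB (x + h n *: v) (h n *: v); rewrite addrK; lra.
    by rewrite (gM _ Mx) (gM _ Mxv) subrr mulr0 normr0 mulr_ge0.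
have cB : (\int[lam]_x B n x) @[n --> \oo] --> xi ord0 j * cos_transform (a - pi / 2) g xi.
  rewrite -RintegralZl//; last exact: integrable_cosM.
  apply: (@Rdominated_cvg _ _ _ _ _ _ (fun x => `|xi ord0 j| * `|g x|)).
  - move=> n; apply: measurable_funM => //; apply: measurable_funM => //.
    apply: measurable_funB; last exact: measurable_cos_dot.
    by under eq_fun do rewrite addrAC; exact: measurable_cos_dot.
  - move=> x; rewrite mulrA; apply: cvgM; last exact: cvg_cst.
    pose f s := cos (a + dot xi x - s * xi ord0 j).
    have df : is_derive (0 : R) (1 : R) f (xi ord0 j * cos (a - pi / 2 + dot xi x)).
      rewrite /f; apply: is_derive_eq; rewrite /GRing.scale/= !mul0r subr0.
      rewrite [a - _ + _]addrAC cosBpihalf; ring.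
    have := difference_quotient_cvg df.
    by rewrite {2}/f mul0r subr0; under eq_fun do rewrite add0r.
  - by apply: RintegrableZl => //; exact: integrable_norm.
  - move=> n x; rewrite /B normrM ler_wpM2r// normrM ger0_norm ?invr_ge0 ?(ltW (h0 n))//.
    rewrite ler_pdivrMl//; apply: le_trans (cos_lipschitz _ _) _.
    by rewrite addrC addKr normrN normrM ger0_norm ?(ltW (h0 n)).
have EAB : (fun n => \int[lam]_x A n x) = (fun n => \int[lam]_x B n x) by exact/funext.
by rewrite EAB in cA; exact: (cvg_unique _ cA cB).
Qed.

(** Two derivatives along the axis j multiply the transform by xi_j^2 and shift
    the phase by pi, so that every index of s gains a factor 1 + xi_j^2. The
    induction changes the phase, which is why C has to serve all phases at once.
    *)
Lemma cos_transform_decay (s : seq 'I_d) g : real_test g -> exists C : R, forall a (xi : V),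
  (\prod_(j <- s) oneDsqr (xi ord0 j)) * `|cos_transform a g xi| <= C.
Proof.
elim: s g => [|j s ih] g rg.
  exists (\int[lam]_x `|g x|) => a xi; rewrite big_nil mul1r.
  have ig := real_test_integrable rg.
  apply: le_trans (le_normr_Rintegral _ _) _ => //; first exact: integrable_cosM.
  apply: le_Rintegral => //.
  - by apply: integrable_norm; exact: integrable_cosM.
  - exact: integrable_norm.
  - by move=> x _; rewrite normrM ler_piMl// norm_cos_le1.
have rg2 := real_test_partial j (real_test_partial j rg).
have [C1 h1] := ih _ rg; have [C2 h2] := ih _ rg2.
exists (C1 + C2) => a xi; rewrite big_cons.
have -> : oneDsqr (xi ord0 j) * \prod_(j0 <- s) oneDsqr (xi ord0 j0) * `|cos_transform a g xi| =
  (\prod_(j0 <- s) oneDsqr (xi ord0 j0)) * `|cos_transform a g xi| +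
  (\prod_(j0 <- s) oneDsqr (xi ord0 j0)) * `|cos_transform (a + pi) (partial j (partial j g)) xi|.
  rewrite cos_transform_partial; last exact: real_test_partial.
  rewrite cos_transform_partial//.
  rewrite (_ : a + pi - pi / 2 - pi / 2 = a); last by lra.
  rewrite mulrA normrM -expr2 (ger0_norm (sqr_ge0 _)) /oneDsqr; ring.
by apply: lerD; [exact: h1|exact: h2].
Qed.

(** Every axis is used twice. One power of the weight pays for a multiplier of
    linear growth, the other one for integrability. *)
Lemma cos_transform_weight_decay g : real_test g -> exists C : R, 0 <= C /\ forall a xi,
  `|cos_transform a g xi| <= C * (cauchy_weight xi) ^+ 2.
Proof.
move=> rg; have [C hC] := cos_transform_decay (index_enum 'I_d ++ index_enum 'I_d) rg.
have W0 (xi : V) : 0 < cauchy_weight xi by exact: cauchy_weight_gt0.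
have E (xi : V) : \prod_(j <- index_enum 'I_d ++ index_enum 'I_d) oneDsqr (xi ord0 j) =
    (cauchy_weight xi ^+ 2)^-1.
  by rewrite big_cat /= /cauchy_weight prodfV expr2 invfM invrK.
exists C; split.
  by apply: le_trans (hC 0 0); rewrite E mulr_ge0// invr_ge0 sqr_ge0.
move=> a xi; have := hC a xi; rewrite E mulrC ler_pdivrMr ?exprn_gt0//.
Qed.

End cos_transform.

(** * The Fourier transform of a test function *)

Section fourier_test.
Context (R : realType) (d : nat).
Local Notation V := 'rV[R]_d.
Local Notation lam := (lebesgue_rV R d).
Implicit Types phi psi : V -> R[i].

Definition complex_test phi : Prop :=
  real_test (fun x => complex.Re (phi x)) /\ real_test (fun x => complex.Im (phi x)).

Lemma complex_test_integrable phi : complex_test phi -> cintegrable lam setT phi.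
Proof. by move=> [r1 r2]; split; exact: real_test_integrable. Qed.

Lemma norm1c_expi (t : R) : norm1c (expi t) <= 2.
Proof.
rewrite /norm1c /expi /=; have := norm_cos_le1 t.
have : `|sin t| <= 1 by rewrite ler_norml sin_geN1 sin_le1.
lra.
Qed.

Lemma expiD (s t : R) : expi (s + t) = expi s * expi t.
Proof. by apply: complexP; rewrite !ReImE /= ?cosD ?sinD; ring. Qed.

Lemma expiN (t : R) : expi (- t) = Num.conj (expi t).
Proof. by apply: complexP; rewrite ?RecJ ?ImcJ /= ?cosN ?sinN. Qed.

Lemma cmeasurable_expi d' (T : measurableType d') (f : T -> R) :
  measurable_fun setT f -> cmeasurable setT (fun x => expi (f x)).
Proof.
move=> mf; split => /=.
  by apply: (measurableT_comp (@measurable_cos R)).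
by apply: (measurableT_comp (@measurable_sin R)).
Qed.

Lemma cmeasurable_expiN_dot : cmeasurable setT (fun z : V * V => expi (- dot z.1 z.2)).
Proof. by apply: cmeasurable_expi; apply: measurableT_comp => //; exact: measurable_dot. Qed.

Definition fourier_factor : R := (2 * pi) `^ (- (d%:R / 2)).

Lemma fourier_factorE : fourier_factor * fourier_factor = ((2 * pi) ^+ d)^-1.
Proof.
have p0 : 0 < 2 * pi :> R by rewrite mulr_gt0// pi_gt0.
rewrite /fourier_factor -powRD; last by apply/implyP => _; rewrite gt_eqF.
by rewrite -opprD -splitr powRN powR_mulrn// ltW.
Qed.

Lemma fourier_factor_gt0 : 0 < fourier_factor.
Proof. by rewrite powR_gt0// mulr_gt0// pi_gt0. Qed.

Lemma cmeasurable_fourier phi : complex_test phi -> cmeasurable setT (fourier phi).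
Proof.
move=> tp; have [mp1 mp2] := cintegrable_measurable (complex_test_integrable tp).
rewrite /fourier; apply: cmeasurableM; first exact: cmeasurable_cst.
apply: (@cmeasurable_param R _ _ _ _ lam (fun z : V * V => expi (- dot z.1 z.2) * phi z.2)).
apply: cmeasurableM; first exact: cmeasurable_expiN_dot.
by split; [apply: (measurableT_comp mp1)|apply: (measurableT_comp mp2)].
Qed.

(** The real and the imaginary part are combinations of cosine transforms with
    phases 0 and - pi / 2. *)
Lemma fourier_decay phi : complex_test phi -> exists C : R, forall xi,
  norm1c (fourier phi xi) <= C * cauchy_weight xi ^+ 2.
Proof.
move=> tp; have [r1 r2] := tp.
have [C1 [C10 h1]] := cos_transform_weight_decay r1.
have [C2 [C20 h2]] := cos_transform_weight_decay r2.
have i1 := real_test_integrable r1; have i2 := real_test_integrable r2.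
exists (fourier_factor * ((C1 + C2) + (C2 + C1))) => xi.
have cE x : cos (- dot xi x) = cos (0 + dot xi x) by rewrite cosN add0r.
have sE x : sin (- dot xi x) = - cos (- (pi / 2) + dot xi x).
  by rewrite sinN addrC cosBpihalf.
pose I := cintegral setT (fun x => expi (- dot xi x) * phi x).
have reE : complex.Re I = cos_transform 0 (fun x => complex.Re (phi x)) xi +
    cos_transform (- (pi / 2)) (fun x => complex.Im (phi x)) xi.
  transitivity (\int[lam]_x complex.Re (expi (- dot xi x) * phi x)) => //.
  rewrite /cos_transform -RintegralD//; do ?exact: integrable_cosM.
  apply: eq_Rintegral => x _; rewrite RecM.
  rewrite [complex.Re (expi _)]cE [complex.Im (expi _)]sE; ring.
have imE : complex.Im I = cos_transform 0 (fun x => complex.Im (phi x)) xi -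
    cos_transform (- (pi / 2)) (fun x => complex.Re (phi x)) xi.
  transitivity (\int[lam]_x complex.Im (expi (- dot xi x) * phi x)) => //.
  rewrite /cos_transform -RintegralB//; do ?exact: integrable_cosM.
  apply: eq_Rintegral => x _; rewrite ImcM.
  rewrite [complex.Re (expi _)]cE [complex.Im (expi _)]sE; ring.
rewrite /fourier -/fourier_factor -/I /norm1c RecM ImcM reE imE.
rewrite [complex.Re _%:C]/= [complex.Im _%:C]/= !mul0r subr0 addr0.
rewrite !normrM (ger0_norm (ltW fourier_factor_gt0)) -mulrDr -mulrA.
rewrite ler_wpM2l ?(ltW fourier_factor_gt0)// (mulrDl (C1 + C2)).
apply: lerD.
  by apply: le_trans (ler_normD _ _) _; rewrite (mulrDl C1); apply: lerD.
by apply: le_trans (ler_normB _ _) _; rewrite (mulrDl C2); apply: lerD.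
Qed.

Lemma cauchy_weight_le1 (xi : V) : cauchy_weight xi <= 1.
Proof.
apply: prodr_ile1 => i _; have h := oneDsqr_ge1 (xi ord0 i).
by rewrite invr_ge0 (le_trans ler01 h) /= invf_le1// (lt_le_trans ltr01 h).
Qed.

Lemma ler_sum_prod1D (I : Type) (s : seq I) (a : I -> R) : (forall i, 0 <= a i) ->
  1 + \sum_(i <- s) a i <= \prod_(i <- s) (1 + a i).
Proof.
move=> a0; elim: s => [|i s ih]; first by rewrite !big_nil addr0.
rewrite !big_cons; have s0 : 0 <= \sum_(j <- s) a j by exact: sumr_ge0.
apply: (@le_trans _ _ ((1 + a i) * (1 + \sum_(j <- s) a j))).
  by have := mulr_ge0 (a0 i) s0; lra.
by rewrite ler_wpM2l// addr_ge0.
Qed.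

(** The product of the 1 + xi_j^2 is at least 1 + |xi|^2, and a number P >= 1
    with |xi|^2 <= P also satisfies |xi| <= P. *)
Lemma euclid_norm_weight (xi : V) : euclid_norm xi * cauchy_weight xi <= 1.
Proof.
have W0 := cauchy_weight_gt0 xi.
rewrite -ler_pdivlMr// mul1r.
have P1 : 1 <= (cauchy_weight xi)^-1 by rewrite invf_ge1// cauchy_weight_le1.
have dP : 1 + dot xi xi <= (cauchy_weight xi)^-1.
  rewrite /cauchy_weight prodfV invrK /dot.
  by apply: ler_sum_prod1D => i; rewrite -expr2 sqr_ge0.
rewrite /euclid_norm -[leRHS]ger0_norm ?(le_trans _ P1)// -sqrtr_sqr.
apply: ler_wsqrtr; rewrite expr2; apply: (@le_trans _ _ (cauchy_weight xi)^-1).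
  by apply: le_trans dP; rewrite lerDr.
by rewrite ler_peMl// (le_trans _ P1).
Qed.

(** The multipliers m = 1 and m = |xi| are those of the scalar product and of
    the form. *)
Lemma cintegrable_weight_fourier (m : V -> R) phi : complex_test phi ->
  measurable_fun setT m -> (forall xi, `|m xi| * cauchy_weight xi <= 1) ->
  cintegrable lam setT (fun xi => (m xi)%:C * fourier phi xi).
Proof.
move=> tp mm m1; have [C hC] := fourier_decay tp.
apply: (le_cintegrable _ (g := fun xi => C * cauchy_weight xi)) => //.
- apply: cmeasurableM; last exact: cmeasurable_fourier.
  exact: cmeasurable_real.
- move=> xi _; have W0 := cauchy_weight_gt0 xi.
  apply: le_trans (norm1cM _ _) _.
  have -> : norm1c (m xi)%:C = `|m xi| by rewrite /norm1c /= normr0 addr0.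
  apply: (@le_trans _ _ (`|m xi| * (C * cauchy_weight xi ^+ 2))); first by rewrite ler_wpM2l.
  have C0 : 0 <= C.
    by have := le_trans (norm1c_ge0 _) (hC xi); rewrite pmulr_lge0// exprn_gt0.
  rewrite (_ : _ * _ = (`|m xi| * cauchy_weight xi) * (C * cauchy_weight xi)); last by ring.
  by rewrite ler_piMl// mulr_ge0// ltW.
- by apply: RintegrableZl => //; exact: integrable_cauchy_weight.
Qed.

(** Fubini: the kernel of fourier_inv is the conjugate of the kernel of fourier.
    *)
Lemma fourier_adjoint (D : set V) phi (f : V -> R[i]) : complex_test phi ->
  (forall x, ~ D x -> phi x = 0) -> cintegrable lam setT f ->
  L2dot D phi (fourier_inv f) = cint lam setT (fun xi => Num.conj (fourier phi xi) * f xi).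
Proof.
move=> tp pD fi; have phii := complex_test_integrable tp.
rewrite /L2dot -[LHS]/(cint lam D _) cint_setT; last first.
  by move=> x /pD ->; apply: complexP; rewrite !ReImE /= ?oppr0 !mul0r ?subr0 ?addr0.
pose k (z : V * V) := expi (dot z.2 z.1).
have mk : cmeasurable setT k.
  apply: cmeasurable_expi.
  have -> : (fun z : V * V => dot z.2 z.1) = (fun z => dot z.1 z.2).
    by apply/funext => z; rewrite dotC.
  exact: measurable_dot.
have k2 z : norm1c (k z) <= 2 by exact: norm1c_expi.
have jphii := cintegrable_conj measurableT phii.
have swap := cint_swap (cintegrableZ measurableT fourier_factor%:C jphii) fi mk k2.
transitivity (cint lam setT (fun x => (fourier_factor%:C * Num.conj (phi x)) *
    cint lam setT (fun y => k (x, y) * f y))).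
  by apply: eq_cint => x _; rewrite /fourier_inv -/fourier_factor mulrCA mulrA.
rewrite swap; apply: eq_cint => xi _.
have mk1 : cmeasurable setT (fun x => k (x, xi)).
  exact: (cmeasurable_expi (measurable_dotl xi)).
have ikj : cintegrable lam setT (fun x => k (x, xi) * Num.conj (phi x)).
  exact: (cintegrableM_bounded measurableT jphii mk1 (fun x _ => k2 (x, xi))).
have mN : measurable_fun setT (fun x => - dot xi x).
  exact: (measurableT_comp (@oppr_measurable R setT) (measurable_dotl xi)).
have ik : cintegrable lam setT (fun x => expi (- dot xi x) * phi x).
  exact: (cintegrableM_bounded measurableT phii (cmeasurable_expi mN) (fun x _ => norm1c_expi _)).
have jE : Num.conj (fourier phi xi) =
    fourier_factor%:C * cint lam setT (fun x => k (x, xi) * Num.conj (phi x)).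
  transitivity (Num.conj (fourier_factor%:C * cint lam setT (fun x => expi (- dot xi x) * phi x))).
    by [].
  rewrite conjcM conj_real -(cint_conj measurableT ik); congr (_ * _).
  by apply: eq_cint => x _; rewrite conjcM expiN conjCK.
rewrite jE mulrC -(cintZ measurableT _ ikj); congr (_ * _).
by apply: eq_cint => x _; rewrite mulrCA.
Qed.

End fourier_test.

(** * Fourier inversion *)

Section fourier_inversion.
Context (R : realType) (d : nat).
Local Notation V := 'rV[R]_d.
Local Notation lam := (lebesgue_rV R d).
Implicit Types phi psi : V -> R[i].

Lemma integral_exp_weight_rV e : 0 < e ->
  (\int[lam]_xi (exp_weight_rV e xi)%:E = ((2 / e) ^+ d)%:E)%E.
Proof.
move=> e0; have := integral_exp_weight_rV_cos (n := d) e0 (pi / 2) 0.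
rewrite cos_pihalf mul0r addr0 => <-; apply: eq_integral => xi _.
rewrite (_ : dot xi 0 = 0); first by rewrite addr0 cos_pihalf addr0 mulr1.
by rewrite /dot big1// => i _; rewrite mxE mulr0.
Qed.

Lemma integrable_exp_weight_rV e : 0 < e ->
  lam.-integrable setT (EFin \o @exp_weight_rV R e d).
Proof.
move=> e0; apply/integrableP; split.
  by apply/measurable_EFinP; exact: measurable_exp_weight_rV.
rewrite (eq_integral (EFin \o @exp_weight_rV R e d)); last first.
  by move=> x _ /=; rewrite ger0_norm// exp_weight_rV_ge0.
by rewrite integral_exp_weight_rV ?ltry.
Qed.

Lemma Rintegral_cos_exp_weight e a (z : V) : 0 < e ->
  \int[lam]_xi (cos (a + dot xi z) * exp_weight_rV e xi) = cos a * poisson_rV e z.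
Proof.
move=> e0; have iw := integrable_exp_weight_rV e0.
have ic : lam.-integrable setT (EFin \o (fun xi => cos (a + dot xi z) * exp_weight_rV e xi)).
  by under eq_fun do rewrite dotC; exact: integrable_cosM.
have h : \int[lam]_xi (exp_weight_rV e xi + cos (a + dot xi z) * exp_weight_rV e xi) =
    (2 / e) ^+ d + cos a * poisson_rV e z.
  rewrite /Rintegral -[RHS]/(fine _%:E) -integral_exp_weight_rV_cos//; congr fine.
  by apply: eq_integral => xi _; congr EFin; ring.
move: h; rewrite RintegralD// [X in X + _ = _](_ : _ = (2 / e) ^+ d).
  by move/addrI.
by rewrite /Rintegral integral_exp_weight_rV.
Qed.

Lemma cint_expi_exp_weight e (z : V) : 0 < e ->
  cint lam setT (fun xi => expi (dot xi z) * (exp_weight_rV e xi)%:C) = (poisson_rV e z)%:C.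
Proof.
move=> e0; apply: complexP.
  transitivity (\int[lam]_xi (cos (0 + dot xi z) * exp_weight_rV e xi)).
    by apply: eq_Rintegral => xi _; rewrite RecM /= mulr0 subr0 add0r.
  by rewrite Rintegral_cos_exp_weight// cos0 mul1r.
transitivity (\int[lam]_xi (cos (- (pi / 2) + dot xi z) * exp_weight_rV e xi)).
  by apply: eq_Rintegral => xi _; rewrite ImcM /= mulr0 add0r [- _ + _]addrC cosBpihalf.
by rewrite Rintegral_cos_exp_weight// cosN cos_pihalf mul0r.
Qed.

Lemma poisson_rV_scale e (t : V) : 0 < e ->
  e ^+ d * poisson_rV e (- (e *: t)) = 2 ^+ d * cauchy_weight t.
Proof.
move=> e0; have prodE (c : R) : c ^+ d = \prod_(i < d) c by rewrite prodr_const card_ord.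
rewrite /poisson_rV /cauchy_weight !prodE -!big_split /=; apply: eq_bigr => i _.
rewrite !mxE /poisson sqrrN exprMn /oneDsqr.
have h1 : 1 + t ord0 i ^+ 2 != 0 by rewrite gt_eqF// ltr_pwDl// sqr_ge0.
by field; rewrite h1 gt_eqF// ltr_pwDl ?sqr_ge0// exprn_gt0.
Qed.

(** The substitution y = x + e t turns the family of kernels into the fixed
    weight cauchy_weight. *)
Lemma poisson_smoothing e (g : V -> R) x : 0 < e -> lam.-integrable setT (EFin \o g) ->
  \int[lam]_y (g y * poisson_rV e (x - y)) =
  2 ^+ d * \int[lam]_t (g (x + e *: t) * cauchy_weight t).
Proof.
move=> e0 gi.
have mg : measurable_fun setT g by apply/measurable_EFinP; exact: measurable_int gi.
have iF : lam.-integrable setT (EFin \o (fun y => g y * poisson_rV e (x - y))).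
  apply: (@le_Rintegrable _ _ _ _ _ measurableT _ (fun y => (2 / e) ^+ d * `|g y|)).
  - apply: measurable_funM => //; apply: measurable_prod => i _.
    have mi : measurable_fun setT (fun y : V => (x - y) ord0 i).
      under eq_fun do rewrite !mxE.
      by apply: measurable_funB => //; exact: (measurable_rV_coord i).
    apply: (measurableT_comp (f := poisson e) _ mi).
    apply: measurable_funM => //; apply: continuous_measurable_fun => u.
    apply: cvgV; first by rewrite gt_eqF// ltr_pwDl ?sqr_ge0// exprn_gt0.
    by apply: cvgD; [exact: cvg_cst|exact: exprn_continuous].
  - move=> y _; rewrite normrM mulrC ler_wpM2r// ger0_norm; last first.
      by apply: prodr_ge0 => i _; exact: poisson_ge0.
    rewrite (_ : (2 / e) ^+ d = \prod_(i < d) (2 / e)); last by rewrite prodr_const card_ord.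
    by apply: ler_prod => i _; rewrite poisson_ge0//= poisson_le.
  - by apply: RintegrableZl => //; exact: integrable_norm.
rewrite -(Rintegral_rV_affine x e0 iF).
have iP := integrable_rV_affine x e0 iF.
have PE t : e ^+ d * (g (x + e *: t) * poisson_rV e (x - (x + e *: t))) =
    2 ^+ d * (g (x + e *: t) * cauchy_weight t).
  by rewrite opprD addNKr mulrCA poisson_rV_scale// mulrCA.
have iW : lam.-integrable setT (EFin \o (fun t => g (x + e *: t) * cauchy_weight t)).
  have := RintegrableZl measurableT (2 ^- d * e ^+ d) iP.
  apply: eq_integrable => // t _ /=; congr EFin.
  by rewrite -mulrA PE mulrA mulVf ?mul1r// expf_neq0// pnatr_eq0.
by rewrite -!RintegralZl//; apply: eq_Rintegral => t _; exact: PE.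
Qed.

Lemma poisson_approximation (g : V -> R) (x : V) : real_test g ->
  \int[lam]_t (g (x + harmonic n *: t) * cauchy_weight t) @[n --> \oo] --> g x * pi ^+ d.
Proof.
move=> rg; have [C gC] := real_test_bounded rg.
have cg := real_test_continuous rg.
have mg : measurable_fun setT g by exact: continuous_measurable_rV.
have -> : g x * pi ^+ d = \int[lam]_t (g x * cauchy_weight t).
  rewrite RintegralZl//; last exact: integrable_cauchy_weight.
  by rewrite /Rintegral integral_cauchy_weight.
apply: (@Rdominated_cvg _ _ _ _ _ _ (fun t => C * cauchy_weight t)).
- move=> n; apply: measurable_funM; last exact: measurable_cauchy_weight.
  by apply: (measurableT_comp mg); exact: measurable_affine.
- move=> t; apply: cvgM; last exact: cvg_cst.
  have : x + harmonic n *: t @[n --> \oo] --> x.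
    rewrite -[X in _ --> X]addr0 -(scale0r t); apply: cvgD; first exact: cvg_cst.
    by apply: cvgZr_tmp; exact: cvg_harmonic.
  by move=> h; apply: (cvg_comp _ _ h); exact: cg.
- by apply: RintegrableZl => //; exact: integrable_cauchy_weight.
- move=> n t; rewrite normrM ler_pM// ger0_norm ?(ltW (cauchy_weight_gt0 _))//.
Qed.

Lemma cint_dominated_cvg d' (T : measurableType d') (mu : {measure set T -> \bar R})
    (f_ : nat -> T -> R[i]) (f : T -> R[i]) (g : T -> R) :
  (forall n, cmeasurable setT (f_ n)) ->
  (forall x, ccvg (f_ ^~ x) (f x)) ->
  mu.-integrable setT (EFin \o g) -> (forall n x, norm1c (f_ n x) <= g x) ->
  ccvg (fun n => cint mu setT (f_ n)) (cint mu setT f).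
Proof.
move=> mf f_f ig fg; split.
  apply: (@Rdominated_cvg _ _ _ _ _ _ g) => //.
  - by move=> n; exact: (mf n).1.
  - by move=> x; exact: (f_f x).1.
  - by move=> n x; exact: le_trans (ler_Re_norm1c _) (fg _ _).
apply: (@Rdominated_cvg _ _ _ _ _ _ g) => //.
- by move=> n; exact: (mf n).2.
- by move=> x; exact: (f_f x).2.
- by move=> n x; exact: le_trans (ler_Im_norm1c _) (fg _ _).
Qed.

Lemma ccvg_unique (u : nat -> R[i]) a b : ccvg u a -> ccvg u b -> a = b.
Proof. by move=> [a1 a2] [b1 b2]; apply: complexP; [exact: cvg_unique a1 b1|exact: cvg_unique a2 b2]. Qed.

Lemma ccvgZ (u : nat -> R[i]) a c : ccvg u a -> ccvg (fun n => c * u n) (c * a).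
Proof.
move=> [u1 u2]; split.
  under eq_fun do rewrite RecM; rewrite RecM.
  by apply: cvgB; apply: cvgM => //; exact: cvg_cst.
under eq_fun do rewrite ImcM; rewrite ImcM.
by apply: cvgD; apply: cvgM => //; exact: cvg_cst.
Qed.

Lemma ccvg_realM (a_ : nat -> R) (a : R) (z : R[i]) : a_ n @[n --> \oo] --> a ->
  ccvg (fun n => (a_ n)%:C * z) (a%:C * z).
Proof.
move=> aa; split.
  rewrite (_ : (fun n => _) = (fun n => a_ n * complex.Re z)).
    by rewrite RecM /= mul0r subr0; apply: cvgM => //; exact: cvg_cst.
  by apply/funext => n; rewrite RecM /= mul0r subr0.
rewrite (_ : (fun n => _) = (fun n => a_ n * complex.Im z)).
  by rewrite ImcM /= mul0r addr0; apply: cvgM => //; exact: cvg_cst.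
by apply/funext => n; rewrite ImcM /= mul0r addr0.
Qed.

(** The integral damped by exp_weight_rV e has two limits as e tends to 0. The
    damping tends to 1 boundedly, which gives the left-hand side; and Fubini
    turns the damped integral into an average of phi against Poisson kernels
    around x, which gives the right-hand side. *)
Theorem fourier_inversion phi : complex_test phi ->
  forall x, fourier_inv (fourier phi) x = phi x.
Proof.
move=> tp x; have [r1 r2] := tp; have phii := complex_test_integrable tp.
pose e n : R := harmonic n.
have e0 n : 0 < e n by rewrite /e /= invr_gt0.
pose u n := fourier_inv (fun xi => (exp_weight_rV (e n) xi)%:C * fourier phi xi) x.
have intf : cintegrable lam setT (fourier phi).
  rewrite (_ : fourier phi = fun xi => (1 : R)%:C * fourier phi xi).
    apply: (@cintegrable_weight_fourier R d (fun=> 1) phi tp); first exact: measurable_cst.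
    by move=> xi; rewrite normr1 mul1r cauchy_weight_le1.
  by apply/funext => xi; rewrite rmorph1 mul1r.
have mf := cintegrable_measurable intf.
have mexpi (z : V) : cmeasurable setT (fun xi : V => expi (dot xi z)).
  by apply: cmeasurable_expi; exact: measurable_dotr.
have u1 : ccvg u (fourier_inv (fourier phi) x).
  apply: ccvgZ; apply: (@cint_dominated_cvg _ _ _ _ _ (fun xi => 2 * norm1c (fourier phi xi))).
  - move=> n; apply: cmeasurableM => //; apply: cmeasurableM => //.
    by apply: cmeasurable_real; exact: measurable_exp_weight_rV.
  - move=> xi; apply: ccvgZ.
    have w1 : exp_weight_rV (e n) xi @[n --> \oo] --> (1 : R).
      have -> : (1 : R) = exp_weight_rV 0 xi.
        by rewrite /exp_weight_rV big1// => i _; rewrite /exp_weight mul0r oppr0 expR0.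
      apply: (cvg_comp (fun n => e n) (fun s => exp_weight_rV s xi) (@cvg_harmonic R)).
      apply: cvg_big => [|i _]; first by move=> [a b]; exact: mul_continuous.
      apply: continuous_comp; last exact: continuous_expR.
      by apply: cvgN; apply: cvgM; [exact: cvg_id|exact: cvg_cst].
    by rewrite -[X in ccvg _ X]mul1r -[1]/((1 : R)%:C); exact: ccvg_realM.
  - by apply: RintegrableZl => //; exact: cintegrable_norm1c.
  - move=> n xi; apply: le_trans (norm1cM _ _) _; apply: ler_pM; do ?exact: norm1c_ge0.
      exact: norm1c_expi.
    apply: le_trans (norm1cM _ _) _; rewrite ler_piMl ?norm1c_ge0//.
    by rewrite /norm1c /= normr0 addr0 ger0_norm ?exp_weight_rV_le1 ?exp_weight_rV_ge0.
have uE n : u n = (pi ^- d)%:C *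
    ((\int[lam]_t (complex.Re (phi (x + e n *: t)) * cauchy_weight t)) +i*
     (\int[lam]_t (complex.Im (phi (x + e n *: t)) * cauchy_weight t))).
  pose w xi := expi (dot xi x) * (exp_weight_rV (e n) xi)%:C : R[i].
  have wi : cintegrable lam setT w.
    apply: (cintegrableM_bounded measurableT (f := fun xi => (exp_weight_rV (e n) xi)%:C) _ (mexpi x) (M := 2)).
      split; first exact: integrable_exp_weight_rV.
      exact: integrable0.
    by move=> xi _; exact: norm1c_expi.
  have swap := cint_swap wi phii (@cmeasurable_expiN_dot R d) (fun z => norm1c_expi _).
  have uP : u n = (fourier_factor R d * fourier_factor R d)%:C *
      cint lam setT (fun y => phi y * (poisson_rV (e n) (x - y))%:C).
    rewrite /u /fourier_inv -/(fourier_factor R d) realcM -mulrA; congr (_ * _).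
    pose J xi := cint lam setT (fun y => expi (- dot xi y) * phi y).
    have fJ xi : fourier phi xi = (fourier_factor R d)%:C * J xi by [].
    have wf : cintegrable lam setT (fun xi => w xi * fourier phi xi).
      apply: (cintegrableM_bounded measurableT intf (M := 2)).
        exact: cintegrable_measurable wi.
      move=> xi _; apply: le_trans (norm1cM _ _) _.
      rewrite -[leRHS]mulr1; apply: ler_pM; do ?exact: norm1c_ge0.
        exact: norm1c_expi.
      by rewrite /norm1c /= normr0 addr0 ger0_norm ?exp_weight_rV_le1 ?exp_weight_rV_ge0.
    have wJ : cintegrable lam setT (fun xi => w xi * J xi).
      have -> : (fun xi => w xi * J xi) =
          (fun xi => ((fourier_factor R d)^-1)%:C * (w xi * fourier phi xi)).
        apply/funext => xi; rewrite fJ.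
        transitivity (((fourier_factor R d)^-1 * fourier_factor R d)%:C * (w xi * J xi)).
          by rewrite (mulVf (lt0r_neq0 (fourier_factor_gt0 R d))) mul1r.
        by rewrite realcM; ring.
      exact: (cintegrableZ measurableT _ wf).
    transitivity (cint lam setT (fun xi => (fourier_factor R d)%:C * (w xi * J xi))).
      by apply: eq_cint => xi _; rewrite fJ /w; ring.
    rewrite (cintZ measurableT _ wJ).
    rewrite swap; congr (_ * _); apply: eq_cint => y _; congr (_ * _).
    rewrite -(cint_expi_exp_weight _ (e0 n)); apply: eq_cint => xi _ /=.
    rewrite /w mulrA -expiD; congr (expi _ * _).
    by rewrite dotD -[- y]scaleN1r dotZ mulN1r addrC.
  rewrite uP fourier_factorE.
  have -> : cint lam setT (fun y => phi y * (poisson_rV (e n) (x - y))%:C) =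
    (\int[lam]_y (complex.Re (phi y) * poisson_rV (e n) (x - y))) +i*
    (\int[lam]_y (complex.Im (phi y) * poisson_rV (e n) (x - y))).
    congr (_ +i* _); apply: eq_Rintegral => y _.
      by rewrite RecM /= mulr0 subr0.
    by rewrite ImcM /= mulr0 add0r.
  rewrite (poisson_smoothing x (e0 n) (real_test_integrable r1)).
  rewrite (poisson_smoothing x (e0 n) (real_test_integrable r2)).
  apply: complexP; rewrite ?RecM ?ImcM /= !mul0r ?subr0 ?addr0 mulrA; congr (_ * _).
    by rewrite exprMn invfM mulrAC mulVf ?mul1r// expf_neq0// pnatr_eq0.
  by rewrite exprMn invfM mulrAC mulVf ?mul1r// expf_neq0// pnatr_eq0.
have p0 : pi ^+ d != 0 :> R by rewrite expf_neq0// gt_eqF// pi_gt0.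
apply: (ccvg_unique u1).
have -> : phi x = (pi ^- d)%:C * ((complex.Re (phi x) * pi ^+ d) +i* (complex.Im (phi x) * pi ^+ d)).
  apply: complexP; rewrite ?RecM ?ImcM /= !mul0r ?subr0 ?addr0.
    by rewrite mulrCA mulVf// mulr1.
  by rewrite mulrCA mulVf// mulr1.
rewrite (funext uE); apply: ccvgZ; split.
  exact: (poisson_approximation (x := x) r1).
exact: (poisson_approximation (x := x) r2).
Qed.

End fourier_inversion.

(** * Non-negative hermitian forms *)

Section psd_forms.
Context (R : realType) (V : lmodType R[i]).
Implicit Types (S : V -> Prop) (B : V -> V -> R[i]) (u v w : V).

(** Subspaces are predicates, since L^2(Omega) and the test functions are given
    as predicates on functions. *)
Definition linear_subset S : Prop :=
  S 0 /\ forall (a : R[i]) u v, S u -> S v -> S (a *: u + v).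

(** The form is conjugate-linear in its first argument, as L2dot is. The
    conditions are restricted to S because integrals that diverge have junk
    values. *)
Definition psd_form S B : Prop :=
  [/\ forall (a : R[i]) u v w, S u -> S v -> S w -> B w (a *: u + v) = a * B w u + B w v,
      forall u v, S u -> S v -> B u v = Num.conj (B v u) &
      forall u, S u -> 0 <= complex.Re (B u u)].

Definition seminorm B u : R := Num.sqrt (complex.Re (B u u)).

Context (S : V -> Prop) (B : V -> V -> R[i]).
Context (subS : linear_subset S) (psdB : psd_form S B).

Lemma linear_subsetD u v : S u -> S v -> S (u + v).
Proof. by case: subS => _ h Su Sv; have := h 1 u v Su Sv; rewrite scale1r. Qed.

Lemma linear_subsetZ a u : S u -> S (a *: u).
Proof. by case: subS => S0 h Su; have := h a u 0 Su S0; rewrite addr0. Qed.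

Lemma linear_subsetN u : S u -> S (- u).
Proof. by move=> Su; rewrite -scaleN1r; exact: linear_subsetZ. Qed.

Lemma linear_subsetB u v : S u -> S v -> S (u - v).
Proof. by move=> Su Sv; apply: linear_subsetD => //; exact: linear_subsetN. Qed.

Lemma linear_subset_sum I (s : seq I) (c : I -> R[i]) (w : I -> V) :
  (forall i, S (w i)) -> S (\sum_(i <- s) c i *: w i).
Proof.
move=> Sw; elim: s => [|i s ih]; first by rewrite big_nil; case: subS.
by rewrite big_cons; case: subS => _; apply.
Qed.

Lemma psd_linD u v w : S u -> S v -> S w -> B w (u + v) = B w u + B w v.
Proof. by case: psdB => l _ _ Su Sv Sw; have := l 1 u v w Su Sv Sw; rewrite scale1r mul1r. Qed.

Lemma psd_lin0 w : S w -> B w 0 = 0.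
Proof.
move=> Sw; have S0 := subS.1; have := psd_linD S0 S0 Sw; rewrite addr0.
by move/eqP; rewrite -subr_eq0 opprD addrA subrr add0r oppr_eq0 => /eqP.
Qed.

Lemma psd_linZ a u w : S u -> S w -> B w (a *: u) = a * B w u.
Proof.
move=> Su Sw; have S0 := subS.1; case: psdB => l _ _.
by have := l a u 0 w Su S0 Sw; rewrite addr0 psd_lin0// addr0.
Qed.

Lemma psd_linN u w : S u -> S w -> B w (- u) = - B w u.
Proof. by move=> Su Sw; rewrite -scaleN1r psd_linZ// mulN1r. Qed.

Lemma psd_linB u v w : S u -> S v -> S w -> B w (u - v) = B w u - B w v.
Proof. by move=> Su Sv Sw; rewrite psd_linD ?psd_linN//; exact: linear_subsetN. Qed.

Lemma psd_sym u v : S u -> S v -> B u v = Num.conj (B v u).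
Proof. by case: psdB => _ h _; exact: h. Qed.

Lemma psd_conjD u v w : S u -> S v -> S w -> B (u + v) w = B u w + B v w.
Proof.
move=> Su Sv Sw; rewrite psd_sym ?psd_linD//; last exact: linear_subsetD.
by rewrite rmorphD /= -!psd_sym.
Qed.

Lemma psd_conjZ a u w : S u -> S w -> B (a *: u) w = Num.conj a * B u w.
Proof.
move=> Su Sw; rewrite psd_sym ?psd_linZ//; last exact: linear_subsetZ.
by rewrite rmorphM /= -psd_sym.
Qed.

Lemma psd_conjB u v w : S u -> S v -> S w -> B (u - v) w = B u w - B v w.
Proof.
move=> Su Sv Sw; rewrite psd_sym ?psd_linB//; last exact: linear_subsetB.
by rewrite rmorphB /= -!psd_sym.
Qed.

Lemma psd_ge0 u : S u -> 0 <= complex.Re (B u u).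
Proof. by case: psdB => _ _; apply. Qed.

Lemma psd_real u : S u -> complex.Im (B u u) = 0.
Proof.
move=> Su; have /(congr1 (@complex.Im R)) := psd_sym Su Su; rewrite ImcJ; lra.
Qed.

Lemma psd_diagE u : S u -> B u u = (complex.Re (B u u))%:C.
Proof. by move=> Su; apply: complexP => //=; exact: psd_real. Qed.

Lemma seminorm_ge0 u : 0 <= seminorm B u.
Proof. exact: sqrtr_ge0. Qed.

Lemma seminorm_sqr u : S u -> seminorm B u ^+ 2 = complex.Re (B u u).
Proof. by move=> Su; rewrite sqr_sqrtr// psd_ge0. Qed.

Let quadratic_discriminant (A s D : R) : 0 <= A -> 0 <= s -> 0 <= D ->
  (forall t, 0 <= A + 2 * t * s + t ^+ 2 * (s * D)) -> s <= A * D.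
Proof.
move=> A0 s0 D0 h; have [->|sn0] := eqVneq s 0; first exact: mulr_ge0.
have sp : 0 < s by rewrite lt_neqAle eq_sym sn0.
have [D00|Dn0] := eqVneq D 0.
  have := h (- (A + 1) / (2 * s)); rewrite D00 !mulr0 addr0.
  rewrite (_ : 2 * _ * s = - (A + 1)); last by field.
  lra.
have Dp : 0 < D by rewrite lt_neqAle eq_sym Dn0.
have := h (- D^-1).
rewrite (_ : _ + _ = (A * D - s) / D); last by field.
by rewrite ler_pdivlMr// mul0r subr_ge0.
Qed.

(** The form is non-negative at u + t conj(b) v for every real t, where b = B u
    v; this is a quadratic polynomial in t with coefficients B u u, 2 |b|^2 and
    |b|^2 B v v. *)
Lemma cauchy_schwarz u v : S u -> S v ->
  complex.Re (B u v) ^+ 2 + complex.Im (B u v) ^+ 2 <=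
  complex.Re (B u u) * complex.Re (B v v).
Proof.
move=> Su Sv; apply: quadratic_discriminant; do ?exact: psd_ge0.
  by rewrite addr_ge0 ?sqr_ge0.
move=> t; set b := B u v.
pose c : R[i] := t%:C * Num.conj b.
have Scv : S (c *: v) by exact: linear_subsetZ.
have Suv := linear_subsetD Su Scv.
have := psd_ge0 Suv.
rewrite psd_conjD ?psd_linD// !psd_conjZ ?psd_linZ//.
rewrite (psd_sym Sv Su) -/b (psd_diagE Sv) (psd_diagE Su).
rewrite /c !ReImE /=; set x := complex.Re b; set y := complex.Im b.
set A := complex.Re (B u u); set D := complex.Re (B v v).
by congr (0 <= _); ring.
Qed.

Lemma seminorm_cs u v : S u -> S v -> norm1c (B u v) <= 2 * (seminorm B u * seminorm B v).
Proof.
move=> Su Sv; have := cauchy_schwarz Su Sv.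
rewrite -!seminorm_sqr// -exprMn; set m := seminorm B u * seminorm B v => h.
have m0 : 0 <= m by rewrite mulr_ge0// seminorm_ge0.
have bnd (x y : R) : x ^+ 2 + y ^+ 2 <= m ^+ 2 -> `|x| <= m.
  move=> xy; rewrite -(@ler_pXn2r _ 2)// ?nnegrE// -normrX ger0_norm ?sqr_ge0//.
  by have := sqr_ge0 y; lra.
have h1 := bnd _ _ h; rewrite addrC in h; have h2 := bnd _ _ h.
by rewrite /norm1c; lra.
Qed.

Lemma seminormD u v : S u -> S v -> seminorm B (u + v) <= seminorm B u + seminorm B v.
Proof.
move=> Su Sv; have Suv := linear_subsetD Su Sv.
rewrite -(@ler_pXn2r _ 2)// ?nnegrE ?addr_ge0 ?seminorm_ge0//.
rewrite sqrrD !seminorm_sqr// psd_conjD ?psd_linD// (psd_sym Sv Su) !ReImE.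
have := cauchy_schwarz Su Sv; rewrite -!seminorm_sqr// -exprMn.
set m := seminorm B u * seminorm B v => h.
have m0 : 0 <= m by rewrite mulr_ge0// seminorm_ge0.
have : complex.Re (B u v) <= m.
  apply: le_trans (ler_norm _) _.
  rewrite -(@ler_pXn2r _ 2)// ?nnegrE// -normrX ger0_norm ?sqr_ge0//.
  by have := sqr_ge0 (complex.Im (B u v)); lra.
by lra.
Qed.

Lemma seminormZ a u : S u -> seminorm B (a *: u) = Num.sqrt (complex.Re a ^+ 2 + complex.Im a ^+ 2) * seminorm B u.
Proof.
move=> Su; rewrite /seminorm -sqrtrM; last by rewrite addr_ge0 ?sqr_ge0.
rewrite psd_conjZ ?psd_linZ//; last exact: linear_subsetZ.
by rewrite (psd_diagE Su) !ReImE /=; congr Num.sqrt; ring.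
Qed.

End psd_forms.

Section complex_limits.
Context (R : realType).
Implicit Types (u : nat -> R[i]).

Lemma ccvg_dist0 u a (r : nat -> R) : (forall n, norm1c (u n - a) <= r n) ->
  r n @[n --> \oo] --> 0 -> ccvg u a.
Proof.
move=> ur r0.
have sq (x : nat -> R) (l : R) : (forall n, `|x n - l| <= r n) -> x n @[n --> \oo] --> l.
  move=> xr; apply/cvgrPdist_le => e e0.
  move/cvgrPdist_le : r0 => /(_ e e0); apply: filterS => n; rewrite sub0r normrN => rn.
  by rewrite distrC (le_trans (xr n))// (le_trans _ rn)// ler_norm.
split; apply: sq => n; apply: le_trans (ur n).
  by have := ler_Re_norm1c (u n - a); rewrite RecD RecN.
by have := ler_Im_norm1c (u n - a); rewrite ImcD ImcN.
Qed.

Lemma ccvgD u v a b : ccvg u a -> ccvg v b -> ccvg (fun n => u n + v n) (a + b).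
Proof.
move=> [u1 u2] [v1 v2]; split.
  by under eq_fun do rewrite RecD; rewrite RecD; exact: cvgD.
by under eq_fun do rewrite ImcD; rewrite ImcD; exact: cvgD.
Qed.

Lemma ccvg_conj u a : ccvg u a -> ccvg (fun n => Num.conj (u n)) (Num.conj a).
Proof.
move=> [u1 u2]; split; first by under eq_fun do rewrite RecJ; rewrite RecJ.
by under eq_fun do rewrite ImcJ; rewrite ImcJ; exact: cvgN.
Qed.

End complex_limits.

(** * The closure of the form of a symmetric operator *)

Section form_closure.
Context (R : realType) (V : lmodType R[i]).
Context (H D : V -> Prop) (h q : V -> V -> R[i]).
Context (subH : linear_subset H) (subD : linear_subset D) (DH : forall u, D u -> H u).
Context (psdh : psd_form H h) (psdq : psd_form D q).
Context (q_bounded : forall u, D u -> exists K : R,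
  forall v, D v -> norm1c (q v u) <= K * seminorm h v).
Implicit Types (u v w : V) (F G : nat -> V).
Local Notation Nh := (seminorm h).
Local Notation Nq := (seminorm q).

Definition form_limit F u : Prop :=
  [/\ forall n, D (F n), Nh (F n - u) @[n --> \oo] --> 0 &
      forall e : R, 0 < e -> exists N : nat, forall m n, (N <= m)%N -> (N <= n)%N ->
        Nq (F m - F n) < e].

Lemma form_limit_lin a F G u v : H u -> H v -> form_limit F u -> form_limit G v ->
  form_limit (fun n => a *: F n + G n) (a *: u + v).
Proof.
move=> Hu Hv [DF Fu cF] [DG Gv cG].
pose A := Num.sqrt (complex.Re a ^+ 2 + complex.Im a ^+ 2).
have A0 : 0 <= A by exact: sqrtr_ge0.
split.
- by move=> n; exact: subD.2.
- have lim0 : A * Nh (F n - u) + Nh (G n - v) @[n --> \oo] --> 0.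
    rewrite -[X in _ --> X](addr0 0) -[X in _ --> X + _](mulr0 A).
    by apply: cvgD => //; apply: cvgM => //; exact: cvg_cst.
  apply: (squeeze_cvgr _ (@cvg_cst _ 0 _ _ _) lim0); apply: nearW => n.
  rewrite seminorm_ge0/=.
  have HF : H (F n - u) by apply: (linear_subsetB subH) => //; exact: DH.
  have HG : H (G n - v) by apply: (linear_subsetB subH) => //; exact: DH.
  rewrite (_ : _ - _ = a *: (F n - u) + (G n - v)); last first.
    by rewrite scalerBr addrACA opprD.
  apply: le_trans (seminormD subH psdh _ HG) _; first exact: (linear_subsetZ subH).
  by rewrite (seminormZ subH psdh).
- move=> e e0.
  have e1 : 0 < e / (2 * (A + 1)) by rewrite divr_gt0// mulr_gt0// ltr_wpDl.
  have [N1 h1] := cF _ e1.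
  have e2 : 0 < e / 2 by rewrite divr_gt0.
  have [N2 h2] := cG _ e2.
  exists (maxn N1 N2) => m n; rewrite !geq_max => /andP[m1 m2] /andP[n1 n2].
  have DFm : D (F m - F n) by exact: (linear_subsetB subD).
  have DGm : D (G m - G n) by exact: (linear_subsetB subD).
  rewrite (_ : _ - _ = a *: (F m - F n) + (G m - G n)); last first.
    by rewrite scalerBr addrACA opprD.
  apply: le_lt_trans (seminormD subD psdq _ DGm) _; first exact: (linear_subsetZ subD).
  rewrite (seminormZ subD psdq)// -/A.
  have k1 := h1 m n m1 n1; have k2 := h2 m n m2 n2.
  have : A * Nq (F m - F n) <= e / 2.
    apply: (@le_trans _ _ ((A + 1) * (e / (2 * (A + 1))))).
      by apply: ler_pM => //; [exact: seminorm_ge0|rewrite lerDl|exact: ltW].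
    rewrite (_ : (A + 1) * (e / (2 * (A + 1))) = e / 2)//.
    by field; rewrite gt_eqF// ltr_wpDl.
  by lra.
Qed.

Lemma form_limit_bounded F u : form_limit F u -> exists M : R, forall n, Nq (F n) <= M.
Proof.
move=> [DF _ cF]; have [N hN] := cF 1 ltr01.
pose M0 := \sum_(i < N.+1) Nq (F i).
have M00 (n : nat) : (n <= N)%N -> Nq (F n) <= M0.
  move=> nN; rewrite /M0 (bigD1 (Ordinal (nN : (n < N.+1)%N)))//= lerDl.
  by apply: sumr_ge0 => i _; exact: seminorm_ge0.
exists (M0 + 1) => n; have [nN|Nn] := leqP n N.
  by rewrite (le_trans (M00 _ nN))// lerDl.
have := hN n N (ltnW Nn) (leqnn _); have := M00 N (leqnn _).
have := seminormD subD psdq (linear_subsetB subD (DF n) (DF N)) (DF N); rewrite subrK.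
by lra.
Qed.

(** The form is closable: q (F n) (F n) is the sum of q (F n - F m) (F n), which
    is small for large n and m since F is Cauchy for q and bounded, and of q (F
    m) (F n), which tends to 0 with m since q (.) (F n) is h-bounded. *)
Lemma form_limit0 F : form_limit F 0 -> Nq (F n) @[n --> \oo] --> 0.
Proof.
move=> FF; have [M FM] := form_limit_bounded FF; have [DF F0 cF] := FF.
have M0 : 0 <= M by apply: le_trans (FM 0%N); exact: seminorm_ge0.
suff sq (e : R) : 0 < e -> exists N : nat, forall n, (N <= n)%N -> Nq (F n) ^+ 2 <= e.
  apply/cvgrPdist_le => e e0; have [N hN] := sq (e ^+ 2) (exprn_gt0 _ e0).
  exists N => // n /= Nn; rewrite sub0r normrN ger0_norm ?seminorm_ge0//.
  by rewrite -(@ler_pXn2r _ 2)// ?nnegrE ?seminorm_ge0 ?(ltW e0)//; exact: hN.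
move=> e0; have e1 : 0 < e / (2 * M + 1) by rewrite divr_gt0// ltr_wpDl// mulr_ge0.
have [N hN] := cF _ e1; exists N => n Nn.
rewrite (seminorm_sqr psdq)//.
have [K hK] := q_bounded (DF n).
have lim : 2 * (M * (e / (2 * M + 1))) + K * Nh (F m - 0) @[m --> \oo] --> 2 * (M * (e / (2 * M + 1))).
  rewrite -[X in _ --> X]addr0 -[X in _ --> _ + X](mulr0 K).
  by apply: cvgD; [exact: cvg_cst|apply: cvgM => //; exact: cvg_cst].
have le1 : complex.Re (q (F n) (F n)) <= 2 * (M * (e / (2 * M + 1))).
  rewrite -(cvg_lim _ lim)//; apply: limr_ge; first by apply: cvgP lim.
  exists N => // m /= Nm.
  have -> : q (F n) (F n) = q (F n - F m) (F n) + q (F m) (F n).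
    by rewrite (psd_conjB subD psdq)// subrK.
  rewrite RecD subr0; apply: lerD.
    apply: le_trans (ler_norm _) _; apply: le_trans (ler_Re_norm1c _) _.
    apply: le_trans (seminorm_cs subD psdq (linear_subsetB subD (DF n) (DF m)) (DF n)) _.
    rewrite ler_wpM2l// mulrC; apply: ler_pM; do ?exact: seminorm_ge0.
      exact: FM.
    by apply: ltW; exact: hN.
  apply: le_trans (ler_norm _) _; apply: le_trans (ler_Re_norm1c _) _; exact: hK.
apply: (le_trans le1); rewrite !mulrA ler_pdivrMr ?ltr_wpDl ?mulr_ge0//.
by rewrite mulrDr mulr1 [e * _]mulrC lerDl ltW.
Qed.

Lemma form_limit_unique F G u : H u -> form_limit F u -> form_limit G u ->
  Nq (F n - G n) @[n --> \oo] --> 0.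
Proof.
move=> Hu FF GG; apply: (form_limit0 (F := fun n => F n - G n)).
have := form_limit_lin (- 1) Hu Hu GG FF; rewrite scaleN1r addNr.
by congr form_limit; apply/funext => n; rewrite scaleN1r addrC.
Qed.

Lemma scalar_product_cvg F G u v : H u -> H v -> (forall n, H (F n)) -> (forall n, H (G n)) ->
  Nh (F n - u) @[n --> \oo] --> 0 -> Nh (G n - v) @[n --> \oo] --> 0 ->
  ccvg (fun n => h (F n) (G n)) (h u v).
Proof.
move=> Hu Hv HF HG Fu Gv.
have HFu n : H (F n - u) by exact: (linear_subsetB subH).
have HGv n : H (G n - v) by exact: (linear_subsetB subH).
apply: (ccvg_dist0 (r := fun n => 2 * (Nh (F n - u) * Nh (G n - v)) +
    (2 * (Nh (F n - u) * Nh v) + 2 * (Nh u * Nh (G n - v))))) => [n|].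
  have -> : h (F n) (G n) - h u v = h (F n - u) (G n - v) + (h (F n - u) v + h u (G n - v)).
    rewrite !(psd_linB subH psdh)// !(psd_conjB subH psdh)//; ring.
  apply: le_trans (norm1cD _ _) _; apply: lerD; first exact: (seminorm_cs subH psdh).
  by apply: le_trans (norm1cD _ _) _; apply: lerD; exact: (seminorm_cs subH psdh).
rewrite (_ : (0 : R) = 2 * (0 * 0) + (2 * (0 * Nh v) + 2 * (Nh u * 0))); last by ring.
apply: cvgD; first by apply: cvgM; [exact: cvg_cst|exact: cvgM].
apply: cvgD; apply: cvgM; do ?exact: cvg_cst; apply: cvgM => //; exact: cvg_cst.
Qed.

(** By Cauchy-Schwarz, q is continuous along bounded sequences with respect to
    its own seminorm, in which two approximations of the same vector have the
    same limit by closability. *)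
Lemma closed_form_unique F F' G G' u v z : H u -> H v ->
  form_limit F u -> form_limit F' u -> form_limit G v -> form_limit G' v ->
  ccvg (fun n => q (F n) (G n)) z -> ccvg (fun n => q (F' n) (G' n)) z.
Proof.
move=> Hu Hv Fu Fu' Gv Gv' cz.
have [M FM] := form_limit_bounded Fu'; have [K GK] := form_limit_bounded Gv.
have lF := form_limit_unique Hu Fu' Fu; have lG := form_limit_unique Hv Gv' Gv.
have [DF _ _] := Fu; have [DF' _ _] := Fu'; have [DG _ _] := Gv; have [DG' _ _] := Gv'.
have d0 : ccvg (fun n => q (F' n) (G' n) - q (F n) (G n)) 0.
  apply: (ccvg_dist0 (r := fun n => 2 * (Nq (F' n - F n) * K) + 2 * (M * Nq (G' n - G n)))) => [n|].
    have -> : q (F' n) (G' n) - q (F n) (G n) - 0 = q (F' n - F n) (G n) + q (F' n) (G' n - G n).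
      have DFF := linear_subsetB subD (DF' n) (DF n).
      by rewrite (psd_linB subD psdq)// (psd_conjB subD psdq)//; ring.
    apply: le_trans (norm1cD _ _) _; apply: lerD.
      apply: le_trans (seminorm_cs subD psdq (linear_subsetB subD (DF' n) (DF n)) (DG n)) _.
      by rewrite ler_wpM2l// ler_wpM2l// seminorm_ge0.
    apply: le_trans (seminorm_cs subD psdq (DF' n) (linear_subsetB subD (DG' n) (DG n))) _.
    by rewrite ler_wpM2l// ler_wpM2r// seminorm_ge0.
  rewrite (_ : (0 : R) = 2 * (0 * K) + 2 * (M * 0)); last by ring.
  by apply: cvgD; apply: cvgM; do ?exact: cvg_cst; apply: cvgM => //; exact: cvg_cst.
have := ccvgD d0 cz; rewrite add0r.
by congr ccvg; apply/funext => n; rewrite subrK.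
Qed.

Definition form_dom u : Prop := H u /\ exists F, form_limit F u.

Definition closure_form u v z : Prop :=
  exists F G, [/\ form_limit F u, form_limit G v & ccvg (fun n => q (F n) (G n)) z].

Definition form_eigen (lam : R) u : Prop :=
  form_dom u /\ forall v, form_dom v -> closure_form v u (lam%:C * h v u).

Lemma form_eigen_cvg lam u v F G : form_eigen lam u -> form_dom v ->
  form_limit F v -> form_limit G u ->
  ccvg (fun n => q (F n) (G n)) (lam%:C * h v u).
Proof.
move=> [[Hu _] eu] dv Fv Gu; have [F' [G' [Fv' Gu' c]]] := eu v dv.
have [Hv _] := dv.
exact: (closed_form_unique Hv Hu Fv' Fv Gu' Gu c).
Qed.

Lemma form_eigen_lin lam a u v : form_eigen lam u -> form_eigen lam v ->
  form_eigen lam (a *: u + v).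
Proof.
move=> eu ev; have [[Hu [F Fu]] _] := eu; have [[Hv [G Gv]] _] := ev.
have lin := form_limit_lin a Hu Hv Fu Gv.
split; first by split; [exact: subH.2|exists (fun n => a *: F n + G n)].
move=> w dw; have [Hw [W Ww]] := dw.
exists W, (fun n => a *: F n + G n); split => //.
have c1 := form_eigen_cvg eu dw Ww Fu; have c2 := form_eigen_cvg ev dw Ww Gv.
have := ccvgD (ccvgZ a c1) c2.
have -> : lam%:C * h w (a *: u + v) = a * (lam%:C * h w u) + lam%:C * h w v.
  by rewrite (psd_linD psdh) ?(psd_linZ subH psdh)//; [ring|exact: (linear_subsetZ subH)].
congr ccvg; apply/funext => n; have [DF _ _] := Fu; have [DG _ _] := Gv; have [DW _ _] := Ww.
by rewrite (psd_linD psdq) ?(psd_linZ subD psdq)//; exact: (linear_subsetZ subD).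
Qed.

(** The limit of q (F n) (G n) along approximations of u and v is mu h u v by
    the equation for v and lam h u v by the conjugate of the equation for u. *)
Lemma form_eigen_orthogonal lam mu u v : form_eigen lam u -> form_eigen mu v ->
  lam != mu -> h u v = 0.
Proof.
move=> eu ev lm; have [du _] := eu; have [dv _] := ev.
have [Hu [F Fu]] := du; have [Hv [G Gv]] := dv.
have c1 := form_eigen_cvg ev du Fu Gv.
have := ccvg_conj (form_eigen_cvg eu dv Gv Fu).
have -> : (fun n => Num.conj (q (G n) (F n))) = (fun n => q (F n) (G n)).
  apply/funext => n; have [DF _ _] := Fu; have [DG _ _] := Gv.
  by rewrite -(psd_sym psdq).
rewrite conjcM conj_real -(psd_sym psdh)// => /(ccvg_unique c1) /eqP.
rewrite -subr_eq0 -mulrBl mulf_eq0 => /orP[|/eqP//].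
rewrite subr_eq0 => /eqP /complexI /esym/eqP.
by rewrite (negbTE lm).
Qed.

End form_closure.

(** * Orthonormal eigenvectors and their approximation *)

(** The matrix has more rows than columns, so its left kernel is not zero. *)
Lemma homogeneous_solution (K : fieldType) m n (A : 'I_n -> 'I_m -> K) : (m < n)%N ->
  exists c : 'I_n -> K, (exists i, c i != 0) /\ forall j, \sum_i c i * A i j = 0.
Proof.
move=> mn; pose M := \matrix_(i, j) A i j.
have : kermx M != 0.
  rewrite -mxrank_eq0 mxrank_ker subn_eq0 -ltnNge.
  by apply: leq_ltn_trans (rank_leq_col M) mn.
move=> /rowV0Pn[c ck c0]; exists (fun i => c ord0 i); split.
  by move/rV0Pn : c0.
move=> j; have /sub_kermxP/rowP/(_ j) := ck; rewrite !mxE => cM.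
by rewrite -[RHS]cM; apply: eq_bigr => i _; rewrite /M mxE.
Qed.

Section orthonormal_eigenvectors.
Context (R : realType) (V : lmodType R[i]).
Context (H D : V -> Prop) (h q : V -> V -> R[i]).
Context (subH : linear_subset H) (subD : linear_subset D) (DH : forall u, D u -> H u).
Context (psdh : psd_form H h) (psdq : psd_form D q).
Context (q_bounded : forall u, D u -> exists K : R,
  forall v, D v -> norm1c (q v u) <= K * seminorm h v).
Local Notation Nh := (seminorm h).
Local Notation eigen := (form_eigen H D h q).

Definition form_free n (w : 'I_n -> V) : Prop :=
  forall c : 'I_n -> R[i], complex.Re (h (\sum_(i < n) c i *: w i) (\sum_(i < n) c i *: w i)) = 0 ->
    forall i, c i = 0.

Context (beta : nat -> R).
Context (multiplicity : forall (lam : R) (n : nat),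
  (exists j : 'I_n -> nat, injective j /\ forall i, beta (j i) = lam) ->
  exists w : 'I_n -> V, (forall i, eigen lam (w i)) /\ form_free w).

(** By induction: let lam = beta m, and let p be the number of l < m with beta l
    = lam. The value lam occurs at p + 1 indices up to m, so its eigenspace
    contains p + 1 free vectors; a non-trivial combination of them is orthogonal
    to the p vectors already chosen in this eigenspace, and it is orthogonal to
    the others because their eigenvalues differ. *)
Lemma orthonormal_eigenvectors m : exists u : nat -> V,
  (forall l, (l < m)%N -> eigen (beta l) (u l)) /\
  forall l l', (l < m)%N -> (l' < m)%N -> h (u l) (u l') = (l == l')%:R.
Proof.
elim: m => [|m [u [eu ou]]]; first by exists (fun=> 0).
pose lam := beta m.
pose s := [seq l <- iota 0 m | beta l == lam].
pose n := (size s).+1.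
have us : uniq (rcons s m).
  rewrite rcons_uniq filter_uniq ?iota_uniq// andbT mem_filter mem_iota add0n ltnn.
  by rewrite !andbF.
have sz : size (rcons s m) = n by rewrite size_rcons.
have [w [ew fw]] : exists w : 'I_n -> V, (forall i, eigen lam (w i)) /\ form_free w.
  apply: multiplicity; exists (fun i => nth 0%N (rcons s m) i); split.
    move=> i j /eqP; rewrite nth_uniq ?sz// => /eqP; exact: val_inj.
  move=> i; have : nth 0%N (rcons s m) i \in rcons s m by rewrite mem_nth// sz.
  by rewrite mem_rcons inE => /orP[/eqP ->//|]; rewrite mem_filter => /andP[/eqP].
have Hw i : H (w i) by have [[]] := ew i.
have [c [[i0 ci0] cs]] := homogeneous_solution
  (fun (i : 'I_n) (j : 'I_(size s)) => h (u (nth 0%N s j)) (w i)) (ltnSn _).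
pose v := \sum_i c i *: w i.
have eigen0 : eigen lam 0.
  have := form_eigen_lin subH subD DH psdh psdq q_bounded (- 1) (ew i0) (ew i0).
  by rewrite scaleN1r addNr.
have ev : eigen lam v.
  rewrite /v; elim: (index_enum _) => [|i r ih]; first by rewrite big_nil.
  rewrite big_cons; exact: (form_eigen_lin subH subD DH psdh psdq q_bounded).
have Hv : H v by case: ev => -[].
have Hu l : (l < m)%N -> H (u l) by move=> /eu[[]].
have v0 : 0 < complex.Re (h v v).
  rewrite lt_neqAle (psd_ge0 psdh)// andbT; apply/eqP => /esym /fw /(_ i0).
  by move/eqP : ci0.
have hsum l : H (u l) -> h (u l) v = \sum_i c i * h (u l) (w i).
  move=> Hul; rewrite /v.
  elim: (index_enum _) => [|i r ih]; first by rewrite !big_nil (psd_lin0 subH psdh).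
  rewrite !big_cons (psd_linD psdh) ?(psd_linZ subH psdh) ?ih//.
    exact: (linear_subsetZ subH).
  exact: (linear_subset_sum subH).
have uv l : (l < m)%N -> h (u l) v = 0.
  move=> lm; have [ll|ll] := eqVneq (beta l) lam; last first.
    exact: (form_eigen_orthogonal subH subD DH psdh psdq q_bounded (eu _ lm) ev).
  have ls : l \in s by rewrite mem_filter ll eqxx mem_iota add0n lm.
  rewrite hsum; last exact: Hu.
  have := cs (Ordinal (etrans (index_mem l s) ls)).
  by rewrite /= nth_index.
pose a : R[i] := ((Nh v)^-1)%:C.
have Nv : 0 < Nh v by rewrite sqrtr_gt0.
pose u' l := if l == m then a *: v else u l.
have Hav : H (a *: v) by exact: (linear_subsetZ subH).
have uav l : (l < m)%N -> h (u l) (a *: v) = 0.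
  by move=> lm; rewrite (psd_linZ subH psdh) ?uv ?mulr0//; exact: Hu.
exists u'; split.
  move=> l; rewrite ltnS leq_eqVlt => /orP[/eqP ->|lm]; last first.
    by rewrite /u' (ltn_eqF lm); exact: eu.
  rewrite /u' eqxx.
  have := form_eigen_lin subH subD DH psdh psdq q_bounded a ev eigen0.
  by rewrite addr0.
have aa : h (a *: v) (a *: v) = 1.
  rewrite (psd_conjZ subH psdh) ?(psd_linZ subH psdh)// (psd_diagE psdh Hv).
  rewrite -(seminorm_sqr psdh Hv) /a conj_real -!realcM.
  by rewrite (_ : _ * _ = 1)//; field; rewrite gt_eqF.
move=> l l'; rewrite !ltnS leq_eqVlt => /orP[/eqP ->|lm].
  rewrite leq_eqVlt => /orP[/eqP ->|l'm]; first by rewrite /u' eqxx aa.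
  rewrite /u' eqxx (ltn_eqF l'm) (gtn_eqF l'm).
  by rewrite (psd_sym psdh) ?uav ?conj0// ?rmorph0//; exact: Hu.
rewrite leq_eqVlt => /orP[/eqP ->|l'm]; rewrite /u' (ltn_eqF lm).
  by rewrite eqxx uav.
by rewrite (ltn_eqF l'm) ou.
Qed.

(** Every u l is a limit in the form sense of vectors of D, and h and q converge
    along these sequences to their values at the limits; only finitely many
    conditions are involved, so that all of them hold from some index on. *)
Lemma almost_orthonormal_test_vectors k (e : R) : 0 < e ->
  exists f : nat -> V, [/\ forall l, (l < k)%N -> D (f l),
    forall l l', (l < k)%N -> (l' < k)%N -> norm1c (h (f l) (f l') - (l == l')%:R) <= e &
    forall l, (l < k)%N -> complex.Re (q (f l) (f l)) <= beta l + e].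
Proof.
move=> e0; have [u [eu ou]] := orthonormal_eigenvectors k.
have /choice[F hF] : forall l, exists F : nat -> V, (l < k)%N -> form_limit D h q F (u l).
  move=> l; have [lk|lk] := boolP (l < k)%N; last by exists (fun=> 0).
  by have [[_ [F FF]] _] := eu l lk; exists F.
have near_small (z : nat -> R[i]) (a : R[i]) : ccvg z a ->
    \forall n \near \oo, norm1c (z n - a) <= e.
  move=> [z1 z2]; have e2 : 0 < e / 2 by rewrite divr_gt0.
  move/cvgrPdist_le : z1 => /(_ _ e2); move/cvgrPdist_le : z2 => /(_ _ e2).
  apply: filterS2 => n; rewrite /norm1c RecD RecN ImcD ImcN => h1 h2.
  by rewrite [X in `|X| + _](_ : _ = - (complex.Re a - complex.Re (z n))) ?normrN;
    [rewrite [X in _ + `|X|](_ : _ = - (complex.Im a - complex.Im (z n))) ?normrN; lra|ring].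
have Hu l : (l < k)%N -> H (u l) by move=> /eu[[]].
have hlim l l' : (l < k)%N -> (l' < k)%N ->
    \forall n \near \oo, norm1c (h (F l n) (F l' n) - (l == l')%:R) <= e.
  move=> lk lk'; apply: near_small; rewrite -ou//.
  have [DF Fu _] := hF l lk; have [DF' Fu' _] := hF l' lk'.
  apply: (scalar_product_cvg subH psdh (Hu _ lk) (Hu _ lk')) => // n; exact: DH.
have qlim l : (l < k)%N -> \forall n \near \oo, complex.Re (q (F l n) (F l n)) <= beta l + e.
  move=> lk; have [du _] := eu l lk.
  have := form_eigen_cvg subH subD DH psdh psdq q_bounded (eu l lk) du (hF l lk) (hF l lk).
  rewrite ou// eqxx mulr1 => /near_small; apply: filterS => n hn.
  have := le_trans (ler_Re_norm1c _) hn; rewrite RecD RecN /= => /ler_normlW; lra.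
have : \forall n \near \oo, forall l : 'I_k, (forall l' : 'I_k,
    norm1c (h (F l n) (F l' n) - (l == l' :> nat)%:R) <= e) /\
    complex.Re (q (F l n) (F l n)) <= beta l + e.
  have hlim' (l : 'I_k) : \forall n \near \oo, forall l' : 'I_k,
      norm1c (h (F l n) (F l' n) - (l == l' :> nat)%:R) <= e.
    by apply: filter_forall => l'; exact: (hlim l l' (ltn_ord l) (ltn_ord l')).
  apply: filter_forall => l; apply: filterI; last exact: (qlim l (ltn_ord l)).
  exact: hlim'.
move=> [N _ /(_ N (leqnn N)) hN].
exists (fun l => F l N); split.
- by move=> l lk; have [DF _ _] := hF l lk.
- by move=> l l' lk lk'; have [h1 _] := hN (Ordinal lk); exact: (h1 (Ordinal lk')).
- by move=> l lk; have [_ h2] := hN (Ordinal lk).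
Qed.

End orthonormal_eigenvectors.

(** * The form on test functions as a Fourier integral *)

Section L2_form.
Context (R : realType) (d : nat) (Omega : set 'rV[R]_d) (mO : measurable Omega).
Local Notation V := ('rV[R]_d -> R[i]).
Local Notation lam := (lebesgue_rV R d).
Implicit Types u v phi psi : V.

Definition sqmod (z : R[i]) : R := complex.Re z ^+ 2 + complex.Im z ^+ 2.

Lemma sqmod_ge0 z : 0 <= sqmod z.
Proof. by rewrite addr_ge0 ?sqr_ge0. Qed.

Lemma conj_mulE (z : R[i]) : Num.conj z * z = (sqmod z)%:C.
Proof. by apply: complexP; rewrite !ReImE /= /sqmod; ring. Qed.

Lemma norm1c_conj (z : R[i]) : norm1c (Num.conj z) = norm1c z.
Proof. by rewrite /norm1c RecJ ImcJ normrN. Qed.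

Lemma norm1c_sqr_le (z : R[i]) : norm1c z ^+ 2 <= 2 * sqmod z.
Proof.
rewrite /norm1c /sqmod sqrrD -(real_normK (num_real (complex.Re z))).
rewrite -(real_normK (num_real (complex.Im z))).
have := sqr_ge0 (`|complex.Re z| - `|complex.Im z|); rewrite sqrrB; lra.
Qed.

Lemma L2P u : L2 Omega u <->
  cmeasurable Omega u /\ lam.-integrable Omega (EFin \o (fun x => sqmod (u x))).
Proof.
have sq0 x : `|sqmod (u x)| = sqmod (u x) by rewrite ger0_norm// sqmod_ge0.
split=> [[u1 u2 uoo]|[[u1 u2] /integrableP[_ uoo]]].
  split=> //; apply/integrableP; split.
    by apply/measurable_EFinP; apply: measurable_funD; exact: measurable_funX.
  by under eq_integral do rewrite /= sq0.
by split=> //; move: uoo; under eq_integral do rewrite /= sq0.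
Qed.

Lemma L2dot_integrable u v : L2 Omega u -> L2 Omega v ->
  cintegrable lam Omega (fun x => Num.conj (u x) * v x).
Proof.
move=> /L2P[mu iu] /L2P[mv iv].
apply: (le_cintegrable mO (g := fun x => sqmod (u x) + sqmod (v x))).
- by apply: cmeasurableM => //; exact: cmeasurable_conj.
- move=> x _; apply: le_trans (norm1cM _ _) _; rewrite norm1c_conj.
  have := norm1c_sqr_le (u x); have := norm1c_sqr_le (v x).
  have := sqr_ge0 (norm1c (u x) - norm1c (v x)); rewrite sqrrB; lra.
- exact: RintegrableD.
Qed.

Lemma L2_linear : @linear_subset R V (L2 Omega).
Proof.
split.
  apply/L2P; split; first exact: cmeasurable_cst.
  have := integrable0 lam Omega.
  apply: eq_integrable => // x _ /=.
  by rewrite /sqmod /= expr0n addr0.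
move=> a u v /L2P[mu iu] /L2P[mv iv]; apply/L2P.
have mauv : cmeasurable Omega (a *: u + v : V).
  by apply: cmeasurableD => //; apply: cmeasurableM => //; exact: cmeasurable_cst.
split => //; apply: (le_Rintegrable mO (g := fun x => 2 * (sqmod a * sqmod (u x)) + 2 * sqmod (v x))).
- by case: mauv => ? ?; apply: measurable_funD; exact: measurable_funX.
- move=> x _; rewrite ger0_norm ?sqmod_ge0// -[(a *: u + v) x]/(a * u x + v x).
  rewrite /sqmod !ReImE; set A := complex.Re a; set B := complex.Im a.
  set X := complex.Re (u x); set Y := complex.Im (u x).
  set P := complex.Re (v x); set Q := complex.Im (v x).
  have := sqr_ge0 (A * X - B * Y - P); have := sqr_ge0 (A * Y + B * X - Q).
  lra.
- by apply: RintegrableD => //; apply: RintegrableZl => //; exact: RintegrableZl.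
Qed.

Lemma L2dot_diag u : L2dot Omega u u = (\int[lam]_(x in Omega) sqmod (u x))%:C.
Proof.
rewrite -cint_real; apply: eq_cint => x _; exact: conj_mulE.
Qed.

Lemma L2dot_psd : @psd_form R V (L2 Omega) (L2dot Omega).
Proof.
split.
- move=> a u v w Hu Hv Hw.
  rewrite -[L2dot Omega w u]/(cint lam Omega (fun x => Num.conj (w x) * u x)).
  rewrite -[L2dot Omega w v]/(cint lam Omega (fun x => Num.conj (w x) * v x)).
  have iu := L2dot_integrable Hw Hu; have iv := L2dot_integrable Hw Hv.
  rewrite -(cintZ mO a iu) -(cintD mO (cintegrableZ mO a iu) iv).
  apply: eq_cint => x _; rewrite -[(a *: u + v) x]/(a * u x + v x); ring.
- move=> u v Hu Hv.
  rewrite -[L2dot Omega v u]/(cint lam Omega (fun x => Num.conj (v x) * u x)).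
  rewrite -(cint_conj mO (L2dot_integrable Hv Hu)).
  by apply: eq_cint => x _; rewrite conjcM conjCK mulrC.
- by move=> u Hu; rewrite L2dot_diag /=; apply: Rintegral_ge0 => x _; exact: sqmod_ge0.
Qed.

Lemma L2sqnormE u : L2 Omega u -> L2sqnorm Omega u = (complex.Re (L2dot Omega u u))%:E.
Proof.
move=> /L2P[_ iu]; rewrite L2dot_diag /= /Rintegral fineK//.
exact: integrable_fin_num iu.
Qed.

Lemma test_function_complex_test phi : test_function Omega phi -> complex_test phi.
Proof.
move=> [s1 s2 /compact_bounded[M [_ bM]] _].
have z x : `|M| + 1 < `|x| -> phi x = 0.
  move=> Mx; apply/eqP; rewrite -(negbK (phi x == 0)); apply/negP => px.
  have : Defs.support phi x by exact: (@subset_closure _ [set y | phi y != 0] x px).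
  move/(bM (`|M| + 1)); rewrite ltr_pwDr ?ler_norm// => /(_ isT) /(lt_le_trans Mx).
  by rewrite ltxx.
by split; split => //; exists (`|M| + 1) => x /z ->.
Qed.

Lemma test_function_out phi x : test_function Omega phi -> ~ Omega x -> phi x = 0.
Proof.
move=> [_ _ _ sO] Ox; apply/eqP; rewrite -(negbK (phi x == 0)); apply/negP => px.
by apply: Ox; apply: sO; exact: (@subset_closure _ [set y | phi y != 0] x px).
Qed.

Lemma test_function_linear : @linear_subset R V (test_function Omega).
Proof.
split.
  have s0 : smooth (fun _ : 'rV[R]_d => 0 : R).
    have E s : foldr (@partial R d) (fun=> 0) s = (fun=> 0).
      by elim: s => //= i s ->; apply/funext => x; rewrite /partial derive_cst.
    move=> s; rewrite E; split; first by move=> x; exact: cst_continuous.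
    by move=> i x; exact: derivable_cst.
  have E : Defs.support (0 : V) = set0.
    rewrite /Defs.support (_ : [set x | _] = set0) ?closure0//.
    by apply/seteqP; split => // x /=; rewrite eqxx.
  by split => //; rewrite E//; exact: compact0.
move=> a u v tu tv; have [u1 u2 u3 u4] := tu; have [v1 v2 v3 v4] := tv.
have sub : Defs.support (a *: u + v : V) `<=` Defs.support u `|` Defs.support v.
  rewrite /Defs.support -closureU; apply: closure_subset => x /=.
  have [ux|ux] := eqVneq (u x) 0; last by left.
  by rewrite -[(a *: u + v) x]/(a * u x + v x) ux mulr0 add0r => vx; right.
split.
- have s1 := smooth_lin (complex.Re a) (- complex.Im a) u1 u2.
  have := smooth_lin 1 1 s1 v1; congr smooth; apply/funext => x.
  by rewrite -[(a *: u + v) x]/(a * u x + v x) !ReImE; ring.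
- have s1 := smooth_lin (complex.Re a) (complex.Im a) u2 u1.
  have := smooth_lin 1 1 s1 v2; congr smooth; apply/funext => x.
  by rewrite -[(a *: u + v) x]/(a * u x + v x) !ReImE; ring.
- apply: (subclosed_compact _ (compactU u3 v3) sub); exact: closed_closure.
- by move=> x /sub [/u4|/v4].
Qed.

Lemma test_function_L2 phi : test_function Omega phi -> L2 Omega phi.
Proof.
move=> /test_function_complex_test tp; have [r1 r2] := tp.
have [m1 m2] := cintegrable_measurable (complex_test_integrable tp).
have sqi (g : 'rV[R]_d -> R) : real_test g -> lam.-integrable setT (EFin \o (fun x => g x ^+ 2)).
  move=> rg; have [C gC] := real_test_bounded rg; have ig := real_test_integrable rg.
  have mg : measurable_fun setT g by apply/measurable_EFinP; exact: measurable_int ig.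
  apply: (le_Rintegrable measurableT (g := fun x => C * `|g x|)).
  - exact: measurable_funX.
  - by move=> x _; rewrite expr2 normrM ler_wpM2r.
  - by apply: RintegrableZl => //; exact: integrable_norm.
apply/L2P; split; first by split; exact: measurable_funTS.
apply: (integrableS measurableT) => //.
by apply: RintegrableD => //; exact: sqi.
Qed.

Lemma fourier_lin a phi psi : complex_test phi -> complex_test psi ->
  forall xi, fourier (a *: phi + psi : V) xi = a * fourier phi xi + fourier psi xi.
Proof.
move=> tp tq xi.
have ik f : complex_test f -> cintegrable lam setT (fun x => expi (- dot xi x) * f x).
  move=> tf; have mN : measurable_fun setT (fun x => - dot xi x).
    exact: (measurableT_comp (@oppr_measurable R setT) (measurable_dotl xi)).
  exact: (cintegrableM_bounded measurableT (complex_test_integrable tf) (cmeasurable_expi mN)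
    (fun x _ => norm1c_expi _)).
pose J f := cint lam setT (fun x => expi (- dot xi x) * f x).
have fJ f : fourier f xi = (fourier_factor R d)%:C * J f by [].
have JJ : J (a *: phi + psi) = a * J phi + J psi.
  rewrite /J -(cintZ measurableT a (ik _ tp)).
  rewrite -(cintD measurableT (cintegrableZ measurableT a (ik _ tp)) (ik _ tq)).
  apply: eq_cint => x _; rewrite -[(a *: phi + psi) x]/(a * phi x + psi x); ring.
by rewrite !fJ JJ; ring.
Qed.

(** The sesquilinear form of the Fourier multiplier with symbol m. *)
Definition fourier_form (m : 'rV[R]_d -> R) phi psi : R[i] :=
  cint lam setT (fun xi => Num.conj (fourier phi xi) * ((m xi)%:C * fourier psi xi)).

Lemma sqrt_form_fourier phi psi : test_function Omega phi -> test_function Omega psi ->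
  sqrt_form Omega phi psi = fourier_form (@euclid_norm R d) phi psi.
Proof.
move=> tp tq; apply: fourier_adjoint.
- exact: test_function_complex_test.
- by move=> x; exact: test_function_out.
- apply: cintegrable_weight_fourier; first exact: test_function_complex_test.
    exact: measurable_euclid_norm.
  by move=> xi; rewrite ger0_norm ?euclid_norm_ge0// euclid_norm_weight.
Qed.

(** Plancherel's identity. Inversion writes psi as an inverse transform, to
    which the adjunction applies. *)
Lemma L2dot_fourier phi psi : test_function Omega phi -> test_function Omega psi ->
  L2dot Omega phi psi = fourier_form (fun=> 1) phi psi.
Proof.
move=> tp tq; have cp := test_function_complex_test tp; have cq := test_function_complex_test tq.
transitivity (L2dot Omega phi (fourier_inv (fun xi => (1 : R)%:C * fourier psi xi))).
  apply: eq_cint => x _; congr (_ * _).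
  transitivity (fourier_inv (fourier psi) x); first exact: (esym (fourier_inversion cq x)).
  have -> : (fun xi => (1 : R)%:C * fourier psi xi) = fourier psi by apply/funext => xi; rewrite mul1r.
  by [].
apply: fourier_adjoint => //; first by move=> x; exact: test_function_out.
apply: cintegrable_weight_fourier => //.
by move=> xi; rewrite normr1 mul1r cauchy_weight_le1.
Qed.

Lemma fourier_form_integrable (m : 'rV[R]_d -> R) phi psi : complex_test phi -> complex_test psi ->
  measurable_fun setT m -> (forall xi, `|m xi| * cauchy_weight xi <= 1) ->
  cintegrable lam setT (fun xi => Num.conj (fourier phi xi) * ((m xi)%:C * fourier psi xi)).
Proof.
move=> tp tq mm m1; have [C hC] := fourier_decay tp.
apply: (cintegrableM_bounded measurableT (cintegrable_weight_fourier tq mm m1) (M := C)).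
  by apply: cmeasurable_conj; exact: cmeasurable_fourier.
move=> xi _; rewrite norm1c_conj; apply: le_trans (hC xi) _.
have W0 := cauchy_weight_gt0 xi; have W1 := cauchy_weight_le1 xi.
have C0 : 0 <= C.
  by have := le_trans (norm1c_ge0 _) (hC xi); rewrite pmulr_lge0// exprn_gt0.
by rewrite ler_piMr// exprn_ile1// ltW.
Qed.

Lemma fourier_form_diag (m : 'rV[R]_d -> R) phi :
  complex.Re (fourier_form m phi phi) = \int[lam]_xi (m xi * sqmod (fourier phi xi)).
Proof.
apply: eq_Rintegral => xi _.
by rewrite mulrCA conj_mulE -realcM.
Qed.

Let norm_weight (xi : 'rV[R]_d) : `|euclid_norm xi| * cauchy_weight xi <= 1.
Proof. by rewrite ger0_norm ?euclid_norm_ge0// euclid_norm_weight. Qed.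

Lemma sqrt_form_psd : @psd_form R V (test_function Omega) (sqrt_form Omega).
Proof.
have ti := test_function_complex_test.
have int phi psi (tp : test_function Omega phi) (tq : test_function Omega psi) :=
  fourier_form_integrable (ti _ tp) (ti _ tq) (@measurable_euclid_norm R d) norm_weight.
split.
- move=> a u v w tu tv tw.
  have tauv : test_function Omega (a *: u + v) by exact: test_function_linear.2.
  rewrite !sqrt_form_fourier// /fourier_form.
  rewrite -(cintZ measurableT a (int _ _ tw tu)).
  rewrite -(cintD measurableT (cintegrableZ measurableT a (int _ _ tw tu)) (int _ _ tw tv)).
  apply: eq_cint => xi _; rewrite (fourier_lin _ (ti _ tu) (ti _ tv)); ring.
- move=> u v tu tv; rewrite !sqrt_form_fourier// /fourier_form.
  rewrite -(cint_conj measurableT (int _ _ tv tu)).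
  apply: eq_cint => xi _.
  by rewrite [RHS]conjcM conjCK (conjcM (euclid_norm xi)%:C (fourier u xi)) conj_real; ring.
- move=> u tu; rewrite sqrt_form_fourier// fourier_form_diag.
  by apply: Rintegral_ge0 => xi _; rewrite mulr_ge0 ?euclid_norm_ge0// sqmod_ge0.
Qed.

End L2_form.

(** * Bessel's inequality for an almost orthonormal family *)

Section bessel.
Context (R : realType) (V : lmodType R[i]) (S : V -> Prop) (h : V -> V -> R[i]).
Context (subS : linear_subset S) (psdh : psd_form S h).

(** With a l = h u (f l), s the sum of the |a l|^2 and w the combination of the
    f l with coefficients conj (a l), one has h u w = s and h w w <= (1 + k e)
    s; Cauchy-Schwarz for u and w is then s^2 <= h u u (1 + k e) s. *)
Lemma almost_bessel k (e : R) (f : nat -> V) u : 0 <= e -> S u ->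
  (forall l, (l < k)%N -> S (f l)) ->
  (forall l l', (l < k)%N -> (l' < k)%N -> norm1c (h (f l) (f l') - (l == l')%:R) <= e) ->
  \sum_(l < k) sqmod (h u (f l)) <= (1 + k%:R * e) * complex.Re (h u u).
Proof.
move=> e0 Su Sf hf; pose a (l : 'I_k) := h u (f l).
pose s := \sum_(l < k) sqmod (a l).
have s0 : 0 <= s by apply: sumr_ge0 => l _; exact: sqmod_ge0.
pose w := \sum_(l < k) Num.conj (a l) *: f l.
have Sfl (l : 'I_k) : S (f l) by exact: Sf.
have Sw : S w by exact: (linear_subset_sum subS).
have linw v : S v -> h v w = \sum_(l < k) Num.conj (a l) * h v (f l).
  move=> Sv; rewrite /w.
  elim: (index_enum _) => [|i r ih]; first by rewrite !big_nil (psd_lin0 subS psdh).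
  rewrite !big_cons (psd_linD psdh) ?(psd_linZ subS psdh) ?ih//.
    exact: (linear_subsetZ subS).
  exact: (linear_subset_sum subS).
have huw : h u w = s%:C.
  rewrite linw// /s raddf_sum; apply: eq_bigr => l _.
  exact: conj_mulE.
have hww : complex.Re (h w w) <= (1 + k%:R * e) * s.
  have -> : h w w = \sum_(l < k) \sum_(l' < k) (Num.conj (a l) * a l') * h (f l') (f l).
    rewrite linw//; apply: eq_bigr => l _.
    rewrite (psd_sym psdh Sw (Sfl l)) linw// rmorph_sum mulr_sumr; apply: eq_bigr => l' _.
    by rewrite -[LHS]/(Num.conj (a l) * Num.conj _) conjcM conjCK -(psd_sym psdh (Sfl l') (Sfl l)) mulrA.
  have -> : complex.Re (\sum_(l < k) \sum_(l' < k) (Num.conj (a l) * a l') * h (f l') (f l)) =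
      s + \sum_(l < k) \sum_(l' < k)
        complex.Re ((Num.conj (a l) * a l') * (h (f l') (f l) - (l' == l :> nat)%:R)).
    have ReS (F : 'I_k -> R[i]) : complex.Re (\sum_(l < k) F l) = \sum_(l < k) complex.Re (F l).
      elim: (index_enum _) => [|i r ih]; first by rewrite !big_nil.
      by rewrite !big_cons RecD ih.
    rewrite ReS /s -big_split; apply: eq_bigr => l _ /=.
    rewrite ReS [X in _ = X + _](_ : _ =
        \sum_(l' < k) complex.Re ((Num.conj (a l) * a l') * (l' == l :> nat)%:R)); last first.
      rewrite (bigD1 l)//= eqxx mulr1 conj_mulE /= big1 ?addr0// => l' l'l.
      by have /negbTE -> : (l' != l :> nat) by []; rewrite mulr0.
    rewrite -big_split; apply: eq_bigr => l' _ /=.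
    by rewrite -RecD -mulrDr addrC subrK.
  rewrite mulrDl mul1r lerD2l.
  have bnd (l l' : 'I_k) : complex.Re ((Num.conj (a l) * a l') * (h (f l') (f l) - (l' == l :> nat)%:R))
      <= e * ((sqmod (a l) + sqmod (a l')) / 2).
    have := hf l' l (ltn_ord _) (ltn_ord _).
    set g := h _ _ - _; rewrite RecM /norm1c => hg.
    set z := Num.conj (a l) * a l'; pose m := (sqmod (a l) + sqmod (a l')) / 2.
    have m0 : 0 <= m by rewrite /m divr_ge0 // addr_ge0 // sqmod_ge0.
    have z1 : `|complex.Re z| <= m.
      rewrite /z /m !ReImE /sqmod ler_norml.
      have := sqr_ge0 (complex.Re (a l) - complex.Re (a l')).
      have := sqr_ge0 (complex.Re (a l) + complex.Re (a l')).
      have := sqr_ge0 (complex.Im (a l) - complex.Im (a l')).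
      have := sqr_ge0 (complex.Im (a l) + complex.Im (a l')).
      move=> ? ? ? ?; apply/andP; split; lra.
    have z2 : `|complex.Im z| <= m.
      rewrite /z /m !ReImE /sqmod ler_norml.
      have := sqr_ge0 (complex.Re (a l) - complex.Im (a l')).
      have := sqr_ge0 (complex.Re (a l) + complex.Im (a l')).
      have := sqr_ge0 (complex.Im (a l) - complex.Re (a l')).
      have := sqr_ge0 (complex.Im (a l) + complex.Re (a l')).
      move=> ? ? ? ?; apply/andP; split; lra.
    apply: le_trans (ler_norm _) _; apply: le_trans (ler_normB _ _) _; rewrite !normrM.
    apply: (@le_trans _ _ (m * `|complex.Re g| + m * `|complex.Im g|)).
      by apply: lerD; rewrite ler_wpM2r.
    by rewrite -mulrDr mulrC ler_wpM2r.
  apply: (@le_trans _ _ (\sum_(l < k) \sum_(l' < k) e * ((sqmod (a l) + sqmod (a l')) / 2))).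
    by apply: ler_sum => l _; apply: ler_sum => l' _; exact: bnd.
  under eq_bigr do rewrite -mulr_sumr -mulr_suml big_split /= sumr_const card_ord -/s.
  rewrite -mulr_sumr -mulr_suml big_split /= sumr_const card_ord sumrMnl -/s.
  rewrite -[s *+ k]mulr_natl; lra.
have := cauchy_schwarz subS psdh Su Sw; rewrite huw /= expr0n addr0 => cs.
have hu0 := psd_ge0 psdh Su.
have [s00|sn0] := eqVneq s 0.
  by rewrite -/s s00 mulr_ge0// addr_ge0// mulr_ge0.
have sp : 0 < s by rewrite lt_neqAle eq_sym sn0.
rewrite -(ler_pM2l sp) -expr2; apply: (le_trans cs).
apply: (le_trans (ler_wpM2l hu0 hww)).
by rewrite le_eqVlt; apply/orP; left; apply/eqP; ring.
Qed.

End bessel.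

(** * From the Friedrichs extension to test functions *)

Section transfer.
Context (R : realType) (d : nat) (Omega : set 'rV[R]_d) (mO : measurable Omega).
Context (Ofin : (lebesgue_rV R d Omega < +oo)%E).
Local Notation V := ('rV[R]_d -> R[i]).
Local Notation lam := (lebesgue_rV R d).
Local Notation H := (L2 Omega : V -> Prop).
Local Notation D := (test_function Omega : V -> Prop).
Local Notation h := (L2dot Omega : V -> V -> R[i]).
Local Notation q := (sqrt_form Omega : V -> V -> R[i]).
Implicit Types u v : V.

Lemma bounded_L2 (f : V) (C : R) : cmeasurable setT f -> (forall x, sqmod (f x) <= C) -> L2 Omega f.
Proof.
move=> [f1 f2] fC; apply/L2P; split; first by split; exact: measurable_funTS.
apply: measurable_bounded_integrable => //.
  by apply: measurable_funTS; apply: measurable_funD; exact: measurable_funX.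
exists C; split; first exact: num_real.
by move=> N CN x _ /=; rewrite ger0_norm ?sqmod_ge0// (le_trans (fC x))// ltW.
Qed.

Lemma sqmod_le (z : R[i]) : sqmod z <= norm1c z ^+ 2.
Proof.
rewrite /sqmod /norm1c sqrrD !real_normK ?num_real//.
have : 0 <= `|complex.Re z| * `|complex.Im z| by rewrite mulr_ge0.
lra.
Qed.

Lemma fourier_inv_L2 (f : V) : cintegrable lam setT f -> L2 Omega (fourier_inv f).
Proof.
move=> fi; have mf := cintegrable_measurable fi; have [m1 m2] := mf.
pose I x := cint lam setT (fun xi => expi (dot xi x) * f xi).
have mI : cmeasurable setT I.
  apply: (@cmeasurable_param R _ _ _ _ lam (fun z => expi (dot z.2 z.1) * f z.2)).
  apply: cmeasurableM.
    apply: cmeasurable_expi.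
    have -> : (fun z : 'rV[R]_d * 'rV[R]_d => dot z.2 z.1) = (fun z => dot z.1 z.2).
      by apply/funext => z; rewrite dotC.
    exact: measurable_dot.
  by split; [apply: (measurableT_comp m1)|apply: (measurableT_comp m2)].
pose N := \int[lam]_xi norm1c (f xi).
have IN x : norm1c (I x) <= 4 * N.
  have ie : cintegrable lam setT (fun xi => expi (dot xi x) * f xi).
    exact: (cintegrableM_bounded measurableT fi (cmeasurable_expi (measurable_dotr x))
      (fun xi _ => norm1c_expi _)).
  have bnd (g : 'rV[R]_d -> R) : lam.-integrable setT (EFin \o g) ->
      (forall xi, `|g xi| <= 2 * norm1c (f xi)) -> `|\int[lam]_xi g xi| <= 2 * N.
    move=> ig gf; apply: le_trans (le_normr_Rintegral measurableT ig) _.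
    rewrite /N -RintegralZl//; last exact: cintegrable_norm1c.
    apply: le_Rintegral => //; first exact: integrable_norm.
    by apply: RintegrableZl => //; exact: cintegrable_norm1c.
  have le2 xi : norm1c (expi (dot xi x) * f xi) <= 2 * norm1c (f xi).
    by apply: le_trans (norm1cM _ _) _; rewrite ler_wpM2r ?norm1c_ge0// norm1c_expi.
  have b1 := bnd _ ie.1 (fun xi => le_trans (ler_Re_norm1c _) (le2 xi)).
  have b2 := bnd _ ie.2 (fun xi => le_trans (ler_Im_norm1c _) (le2 xi)).
  rewrite /norm1c; apply: (le_trans (lerD b1 b2)); lra.
have IE x : fourier_inv f x = (fourier_factor R d)%:C * I x by [].
apply: (@bounded_L2 _ ((fourier_factor R d * (4 * N)) ^+ 2)).
  have := cmeasurableM (cmeasurable_cst setT (fourier_factor R d)%:C) mI.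
  by congr cmeasurable; apply/funext => x.
move=> x; apply: le_trans (sqmod_le _) _; rewrite IE.
have F0 := fourier_factor_gt0 R d.
have h1 : norm1c ((fourier_factor R d)%:C * I x) <= fourier_factor R d * (4 * N).
  apply: le_trans (norm1cM _ _) _.
  rewrite [X in X * _](_ : _ = fourier_factor R d); last by rewrite /norm1c /= normr0 addr0 gtr0_norm.
  by rewrite ler_wpM2l// ltW.
by rewrite ler_pXn2r// nnegrE ?norm1c_ge0// (le_trans _ h1)// norm1c_ge0.
Qed.

(** By definition sqrt_form v u is the scalar product of v and sqrt_laplacian u,
    which is a bounded function on a set of finite measure. *)
Lemma sqrt_form_bounded u : D u -> exists K : R, forall v, D v -> norm1c (q v u) <= K * seminorm h v.
Proof.
move=> tu; have wL2 : L2 Omega (sqrt_laplacian u).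
  apply: fourier_inv_L2; apply: cintegrable_weight_fourier.
  - exact: test_function_complex_test tu.
  - exact: measurable_euclid_norm.
  - by move=> xi; rewrite ger0_norm ?euclid_norm_ge0// euclid_norm_weight.
exists (2 * seminorm h (sqrt_laplacian u)) => v tv.
have := seminorm_cs (L2_linear mO) (L2dot_psd mO) (test_function_L2 mO tv) wL2.
by rewrite [X in _ <= 2 * X -> _]mulrC mulrA.
Qed.

Let subH := L2_linear mO.
Let subD := @test_function_linear R d Omega.
Let DH u (tu : D u) : H u := test_function_L2 mO tu.
Let psdh := L2dot_psd mO.
Let psdq := @sqrt_form_psd R d Omega.

(** L2sqnorm and the diagonal of sqrt_form are the squares of the two seminorms.
    *)
Lemma form_cvgP (F : nat -> V) u : L2 Omega u ->
  form_cvg Omega F u <-> form_limit D h q F u.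
Proof.
move=> Hu.
have tF : (forall n, D (F n)) -> forall n, L2 Omega (F n - u).
  by move=> DF n; apply: (linear_subsetB subH) => //; exact: DH.
have normE (DF : forall n, D (F n)) n : L2sqnorm Omega (F n \- u) = (seminorm h (F n - u) ^+ 2)%:E.
  by rewrite (seminorm_sqr psdh (tF DF n)) -L2sqnormE//; exact: tF.
split=> -[DF Fu cF]; split => //.
- have sq0 : seminorm h (F n - u) ^+ 2 @[n --> \oo] --> 0.
    move: Fu; rewrite (funext (normE DF)) => /fine_cvg; exact.
  have : Num.sqrt (seminorm h (F n - u) ^+ 2) @[n --> \oo] --> Num.sqrt (0 : R).
    by apply: (cvg_comp _ _ sq0); exact: sqrt_continuous.
  rewrite sqrtr0; under eq_fun do rewrite sqrtr_sqr ger0_norm ?seminorm_ge0//.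
  by [].
- move=> e e0; have [N _ hN] := cF (e ^+ 2) (exprn_gt0 _ e0).
  exists N => m n Nm Nn; have DFF : D (F m - F n) by exact: (linear_subsetB subD).
  have := hN N (leqnn N) m n Nm Nn.
  rewrite [X in `|X|](_ : _ = seminorm q (F m - F n) ^+ 2); last by rewrite (seminorm_sqr psdq DFF).
  rewrite ger0_norm ?sqr_ge0// => lt2.
  by rewrite -(@ltr_pXn2r _ 2)// ?nnegrE ?seminorm_ge0 ?(ltW e0).
- rewrite (funext (normE DF)); apply: cvg_EFin; first exact: nearW.
  rewrite -(mulr0 (0 : R)) -expr2; under eq_fun do rewrite expr2.
  by rewrite expr2; apply: cvgM.
- move=> e e0; have se0 : 0 < Num.sqrt e by rewrite sqrtr_gt0.
  have [N hN] := cF _ se0; exists N => // M /= NM m n Mm Mn.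
  have DFF : D (F m - F n) by exact: (linear_subsetB subD).
  rewrite [X in `|X|](_ : _ = seminorm q (F m - F n) ^+ 2); last by rewrite (seminorm_sqr psdq DFF).
  rewrite ger0_norm ?sqr_ge0//.
  rewrite -(sqr_sqrtr (ltW e0)) ltr_pXn2r// ?nnegrE ?seminorm_ge0 ?(ltW se0)//.
  by apply: hN; exact: leq_trans NM _.
Qed.

Lemma form_domainP u : form_domain Omega u <-> form_dom H D h q u.
Proof.
split=> -[Hu [F FF]]; split=> //; exists F; exact/(form_cvgP _ Hu).
Qed.

Lemma in_eigenspaceP lam0 u : in_eigenspace Omega lam0 u -> form_eigen H D h q lam0 u.
Proof.
move=> [du _ eu]; have Hu : L2 Omega u by case: du.
split; first exact/form_domainP.
move=> v dv; have Hv : L2 Omega v by case: dv.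
have [F [G [Fv Gu c]]] := eu v ((form_domainP v).2 dv).
exists F, G; split; [exact/form_cvgP|exact/form_cvgP|].
have -> : lam0%:C * h v u = L2dot Omega v (fun x => lam0%:C * u x) by
  rewrite -(psd_linZ subH psdh).
exact: c.
Qed.

Lemma L2freeP n (w : 'I_n -> V) : (forall i, L2 Omega (w i)) -> L2free Omega w -> form_free h w.
Proof.
move=> Hw fw c c0; apply: fw.
have E : (fun x => \sum_(i < n) c i * w i x) = \sum_(i < n) c i *: w i.
  by apply/funext => x; rewrite fct_sumE; apply: eq_bigr.
rewrite E L2sqnormE ?c0//; exact: (linear_subset_sum subH).
Qed.

Lemma eigenvalues_multiplicity beta : eigenvalues Omega beta ->
  forall (lam0 : R) (n : nat),
  (exists j : 'I_n -> nat, injective j /\ forall i, beta (j i) = lam0) ->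
  exists w : 'I_n -> V, (forall i, form_eigen H D h q lam0 (w i)) /\ form_free h w.
Proof.
move=> [_ mult] lam0 n /mult[w [ew fw]]; exists w; split.
  by move=> i; exact: in_eigenspaceP.
by apply: L2freeP => // i; case: (ew i) => -[].
Qed.

(** The integrand inequality |xi| F >= r F - M max(0, r - |xi|) holds where |xi|
    >= r because the last term vanishes, and where |xi| < r because F <= M. *)
Lemma bathtub k (e r : R) (f : nat -> V) : 0 < e -> 0 < r ->
  (forall l, (l < k)%N -> D (f l)) ->
  (forall l l', (l < k)%N -> (l' < k)%N -> norm1c (h (f l) (f l') - (l == l')%:R) <= e) ->
  r * (k%:R * (1 - e)) - (1 + k%:R * e) * (((2 * pi) ^+ d)^-1 * fine (lam Omega)) *
    (ball_vol R d * r ^+ d.+1 / d.+1%:R) <= \sum_(l < k) complex.Re (q (f l) (f l)).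
Proof.
move=> e0 r0 Df hf.
pose M := (1 + k%:R * e) * (((2 * pi) ^+ d)^-1 * fine (lam Omega)).
pose F xi := \sum_(l < k) sqmod (fourier (f l) xi).
have tf (l : 'I_k) : complex_test (f l) by apply: (@test_function_complex_test _ _ Omega); exact: Df.
have isq (m : 'rV[R]_d -> R) (l : 'I_k) : measurable_fun setT m ->
    (forall xi, `|m xi| * cauchy_weight xi <= 1) ->
    lam.-integrable setT (EFin \o (fun xi => m xi * sqmod (fourier (f l) xi))).
  move=> mm m1; have [ir _] := fourier_form_integrable (tf l) (tf l) mm m1.
  have E xi : complex.Re (Num.conj (fourier (f l) xi) * ((m xi)%:C * fourier (f l) xi)) =
      m xi * sqmod (fourier (f l) xi) by rewrite mulrCA conj_mulE -realcM.
  by apply: eq_integrable ir => // xi _; exact: (congr1 EFin (E xi)).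
have one_w xi : `|(1 : R)| * cauchy_weight (xi : 'rV[R]_d) <= 1.
  by rewrite normr1 mul1r cauchy_weight_le1.
have norm_w (xi : 'rV[R]_d) : `|euclid_norm xi| * cauchy_weight xi <= 1.
  by rewrite ger0_norm ?euclid_norm_ge0// euclid_norm_weight.
have isum (m : 'rV[R]_d -> R) : measurable_fun setT m ->
    (forall xi, `|m xi| * cauchy_weight xi <= 1) ->
    lam.-integrable setT (EFin \o (fun xi => m xi * F xi)) /\
    \int[lam]_xi (m xi * F xi) = \sum_(l < k) complex.Re (fourier_form m (f l) (f l)).
  move=> mm m1.
  under eq_bigr do rewrite fourier_form_diag.
  under [X in lam.-integrable _ (_ \o X)]eq_fun do rewrite /F mulr_sumr.
  under eq_Rintegral do rewrite /F mulr_sumr.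
  elim: (index_enum _) => [|l s [ih1 ih2]].
    rewrite big_nil; split.
      by under eq_fun do rewrite big_nil; exact: integrable0.
    by under eq_Rintegral do rewrite big_nil; rewrite /Rintegral integral0.
  rewrite big_cons; split.
    by under eq_fun do rewrite big_cons; apply: RintegrableD => //; exact: isq.
  under eq_Rintegral do rewrite big_cons.
  by rewrite RintegralD// ?ih2//; exact: isq.
have [iF1 iF1E] := isum (fun=> 1) (measurable_cst _) one_w.
have [iFn iFnE] := isum (@euclid_norm R d) (@measurable_euclid_norm R d) norm_w.
have -> : \sum_(l < k) complex.Re (q (f l) (f l)) = \int[lam]_xi (euclid_norm xi * F xi).
  rewrite iFnE; apply: eq_bigr => l _.
  by rewrite (sqrt_form_fourier (Df _ (ltn_ord l)) (Df _ (ltn_ord l))).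
have FM xi : F xi <= M.
  pose E x : R[i] := expi (dot xi x).
  have mE : cmeasurable setT E by exact: (cmeasurable_expi (measurable_dotl xi)).
  have E1 x : sqmod (E x) = 1 by rewrite /sqmod /E /= cos2Dsin2.
  have EL2 : L2 Omega E by apply: (bounded_L2 mE (C := 1)) => x; rewrite E1.
  have EE : complex.Re (h E E) = fine (lam Omega).
    rewrite L2dot_diag /=; under eq_Rintegral do rewrite E1.
    by rewrite Rintegral_cst// mul1r.
  have := almost_bessel subH psdh (ltW e0) EL2 (fun l lk => DH (Df l lk)) hf.
  rewrite EE => bes.
  have fE (l : 'I_k) : sqmod (fourier (f l) xi) = ((2 * pi) ^+ d)^-1 * sqmod (h E (f l)).
    have -> : fourier (f l) xi = (fourier_factor R d)%:C * h E (f l).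
      congr (_ * _).
      rewrite -[LHS]/(cint lam setT _) -[RHS]/(cint lam Omega _) [RHS]cint_setT.
        by apply: eq_cint => x _; rewrite expiN.
      by move=> x Ox; rewrite (test_function_out (Df l (ltn_ord l)) Ox) mulr0.
    by rewrite -fourier_factorE /sqmod !ReImE /=; ring.
  rewrite /F (eq_bigr _ (fun l _ => fE l)) -mulr_sumr /M mulrCA ler_wpM2l//.
  by rewrite invr_ge0 exprn_ge0// mulr_ge0// pi_ge0.
have itent := integrable_tent d r0.
apply: (@le_trans _ _ (\int[lam]_xi (r * (1 * F xi) - M * Num.max 0 (r - euclid_norm xi)))).
  rewrite RintegralB//; do ?exact: RintegrableZl.
  have -> : \int[lam]_xi (r * (1 * F xi)) = r * \int[lam]_xi (1 * F xi) by exact: RintegralZl.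
  have tentE := Rintegral_tent d r0.
  have -> : \int[lam]_xi (M * Num.max 0 (r - euclid_norm xi)) = M * (ball_vol R d * r ^+ d.+1 / d.+1%:R).
    by rewrite -tentE; exact: RintegralZl.
  rewrite iF1E -/M lerD2r ler_wpM2l ?(ltW r0)//.
  have -> : k%:R * (1 - e) = \sum_(l < k) (1 - e) by rewrite sumr_const card_ord mulr_natl.
  apply: ler_sum => l _.
  have tl := Df l (ltn_ord l).
  rewrite -(L2dot_fourier tl tl).
  have := le_trans (ler_Re_norm1c _) (hf l l (ltn_ord l) (ltn_ord l)).
  rewrite eqxx RecD RecN /= distrC => /ler_normlW; lra.
apply: le_Rintegral => //.
  by apply: RintegrableB => //; exact: RintegrableZl.
move=> xi _; rewrite mul1r.
have F0 : 0 <= F xi by apply: sumr_ge0 => l _; exact: sqmod_ge0.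
have [rx|xr] := leP (r - euclid_norm xi) 0.
  by rewrite mulr0 subr0 ler_wpM2r//; lra.
have : F xi * (r - euclid_norm xi) <= M * (r - euclid_norm xi).
  by rewrite ler_wpM2r// ltW.
lra.
Qed.

End transfer.

(** * The lower bound *)

Lemma le_of_linear_error (R : realType) (a b c : R) :
  (forall e : R, 0 < e -> a <= b + c * e) -> a <= b.
Proof.
move=> abc; apply/ler_addgt0Pr => e e0.
have c1 : 0 < `|c| + 1 by rewrite ltr_wpDl.
have := abc (e / (`|c| + 1)) (divr_gt0 e0 c1); move/le_trans; apply.
rewrite lerD2l mulrCA -[leRHS]mulr1 ler_pM2l// ler_pdivrMr// mul1r.
by rewrite (le_trans (ler_norm c))// lerDl.
Qed.

(** The energies of the test functions exceed the eigenvalues by at most e each,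
    and the error is linear in e. *)
Lemma sum_eigenvalues_ge (R : realType) (d : nat) (Omega : set 'rV[R]_d) (beta : nat -> R)
    (k : nat) (r : R) :
  measurable Omega -> (lebesgue_rV R d Omega < +oo)%E -> eigenvalues Omega beta -> 0 < r ->
  r * k%:R - ((2 * pi) ^+ d)^-1 * fine (lebesgue_rV R d Omega) *
    (ball_vol R d * r ^+ d.+1 / d.+1%:R) <= \sum_(l < k) beta l.
Proof.
move=> mO Ofin ev r0.
set m := fine _; set M := _^-1 * m; set W := ball_vol R d * r ^+ d.+1 / d.+1%:R.
(* The constant collects the terms of bathtub and of the energies that are linear
   in the error. *)
apply: (@le_of_linear_error _ _ _ (k%:R * (r + M * W + 1))) => e e0.
have [f [Df hf qf]] := almost_orthonormal_test_vectors (L2_linear mO)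
  (@test_function_linear R d Omega) (test_function_L2 mO) (L2dot_psd mO)
  (@sqrt_form_psd R d Omega) (sqrt_form_bounded mO Ofin)
  (eigenvalues_multiplicity mO ev) k e0.
have b1 := bathtub mO Ofin e0 r0 Df hf.
have b2 : \sum_(l < k) complex.Re (sqrt_form Omega (f l) (f l)) <= \sum_(l < k) beta l + k%:R * e.
  rewrite mulr_natl -[k in _ *+ k]card_ord -sumr_const -big_split.
  by apply: ler_sum => l _; exact: qf.
move: (le_trans b1 b2); rewrite -/m -/M -/W; lra.
Qed.

Theorem theorem3p2 (R : realType) (d : nat) (hd : (0 < d)%N)
    (Omega : set 'rV[R]_d) (hne : Omega !=set0) (hopen : open Omega)
    (hbdd : bounded_set Omega)
    (beta : nat -> R) (hbeta : eigenvalues Omega beta)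
    (k : nat) (hk : (0 < k)%N) :
  Num.sqrt (4 * pi) * d%:R / (d%:R + 1)
    * (Gamma (1 + d%:R / 2) * k%:R / fine (lebesgue_rV R d Omega)) `^ (d%:R^-1)
  <= mean beta k.
Proof.
have mO := open_measurable_rV hopen.
have Ofin := bounded_measurable_lty mO hbdd.
have bound := sum_eigenvalues_ge k mO Ofin hbeta.
set m := fine (lebesgue_rV R d Omega) in bound *.
have m0 : 0 <= m by exact: fine_ge0.
have k0 : (0 : R) < k%:R by rewrite ltr0n.
have d0 : (0 : R) < d%:R by rewrite ltr0n.
have p0 : (0 : R) < pi by exact: pi_gt0.
rewrite /mean mulrC ler_pdivlMl//.
have [mE|mN] := eqVneq m 0.
  (* As x / 0 = 0, the left-hand side is 0 here. *)
  rewrite mE invr0 mulr0 powR0 ?invr_neq0 ?gt_eqF// mul0r mulr0.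
  have := bound 1 ltr01; rewrite mE mulr0 mul0r subr0 mul1r.
  by apply: le_trans; exact: ltW.
have mp : 0 < m by rewrite lt_neqAle eq_sym mN.
have G := @Gamma_ball_vol R d.
have V0 := ball_vol_gt0 R d.
set g := Gamma _ in G *; set V := ball_vol R d in G V0 bound.
have sp0 : 0 < Num.sqrt pi :> R by rewrite sqrtr_gt0.
have g0 : 0 < g by rewrite -(pmulr_lgt0 _ V0) G exprn_gt0.
set x := g * k%:R / m; have x0 : 0 < x by rewrite /x divr_gt0// mulr_gt0.
set y := x `^ d%:R^-1.
have y0 : 0 < y by exact: powR_gt0.
have yd : y ^+ d = x.
  by rewrite -powR_mulrn ?(ltW y0)// /y -powRrM mulVf ?gt_eqF// powRr1// ltW.
pose r := Num.sqrt (4 * pi) * y.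
have s4 : Num.sqrt (4 * pi) = 2 * Num.sqrt pi :> R.
  by rewrite sqrtrM// (_ : 4 = 2 ^+ 2) ?sqrtr_sqr ?ger0_norm// -natrX.
have r0 : 0 < r by rewrite /r s4 !mulr_gt0.
(* The radius r is the one for which the bound of sum_eigenvalues_ge is largest:
   the derivative in r vanishes when Omega times the ball of radius r has volume
   (2 pi) ^+ d * k in phase space. *)
have crit : ((2 * pi) ^+ d)^-1 * m * (V * r ^+ d) = k%:R.
  have pE : (2 * pi : R) ^+ d = 2 ^+ d * (g * V) * Num.sqrt pi ^+ d.
    by rewrite G -!exprMn -mulrA -expr2 sqr_sqrtr// ltW.
  rewrite pE /r s4 !exprMn yd /x.
  have t0 : (2 : R) ^+ d != 0 by rewrite expf_neq0.
  have u0 : Num.sqrt pi ^+ d != 0 :> R by rewrite expf_neq0 ?gt_eqF.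
  have g1 : g != 0 by rewrite gt_eqF.
  have V1 : V != 0 by rewrite gt_eqF.
  by field; rewrite mN u0 V1 g1 t0.
have := bound r r0; apply: le_trans.
have -> : ((2 * pi) ^+ d)^-1 * m * (V * r ^+ d.+1 / d.+1%:R) = k%:R * r / d.+1%:R.
  by rewrite -crit exprSr; ring.
have d1 : (d%:R + 1 : R) != 0 by rewrite gt_eqF// addr_gt0.
rewrite -[d.+1%:R]natr1 le_eqVlt; apply/orP; left; apply/eqP.
by rewrite /r; field.
Qed.
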